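(* If $X$ is a non-tripartite Ramanujan $\widetilde A_2$-complex of density $q$, then the Perron–Frobenius eigenvalue of the bipartite graph $G^{(r)}=G^{(r)}(X)$ of vertices versus $r$-geodesics of $X$, with adjacency operator $A_{G^{(r)}}$, satisfies $$\lambda_1\left(A_{G^{(r)}}\right)=rq^r(1+o(1))\qquad(\text{as } q,r\to\infty),$$ and its second eigenvalue satisfies $$\lambda_2\left(A_{G^{(r)}}\right)\le\sqrt r\,q^r(1+o(1)).$$
   Context: Let $F$ be a non-archimedean local field with ring of integers $\mathcal O$, uniformizer $\pi$ and residue field $\mathbb F_q$. The building $\mathcal B=\mathcal B_3(F)$ is the 2-dimensional clique complex whose vertices are homothety classes of $\mathcal O$-lattices in $F^3$ (identified with $PGL_3(F)/PGL_3(\mathcal O)$, where $K=PGL_3(\mathcal O)$, via $gK\mapsto g\mathcal O^3$), two distinct classes being adjacent iff they have representatives with $\pi L<L'<L$. Vertices are colored by $\mathrm{col}(gK)=\mathrm{ord}_\pi\det g\in\mathbb Z/3\mathbb Z$, and directed edges by $\mathrm{col}(v\to w)=\mathrm{col}(w)-\mathrm{col}(v)\in\{1,2\}$. An $\widetilde A_2$-complex of density $q$ is a quotient $X=\Gamma\backslash\mathcal B$ by a cocompact lattice $\Gamma\le PGL_3(F)$ acting without fixed points (in this setting $\Gamma$ is taken torsion-free); it is a finite simplicial complex with fundamental group $\Gamma$ and inherits the edge coloring. $X$ is tripartite if $\Gamma$ preserves vertex colors. For $j=1,2$, $(A_jf)(v)=\sum_{w\sim v,\ \mathrm{col}(v\to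 w)=j}f(w)$, of degree $q^2+q+1$; eigenvalues of $A_j$ on $L^2(X(0))$ of absolute value $q^2+q+1$ are trivial. $X$ is Ramanujan if for $j=1,2$ every eigenvalue of $A_j$ on $L^2(X(0))$ is trivial or contained in the spectrum of $A_j$ on $L^2(\mathcal B(0))$. An $r$-geodesic (of color one) in $X$ is a sequence of vertices $v_0,\dots,v_r$ with $\{v_i,v_{i+1}\}\in X(1)$, $v_{i+2}\ne v_i$, $\{v_i,v_{i+1},v_{i+2}\}\notin X(2)$ and $\mathrm{col}(v_i\to v_{i+1})=1$. $G^{(r)}(X)$ is the bipartite graph formed by the $r$-geodesics in $X$ on one side and the vertices $X(0)$ on the other, with $v\in X(0)$ connected to a geodesic $\gamma$ if it appears along it.
   Formalization: A vertex is joined to a geodesic by one edge per occurrence along it (with simple incidence the claim on λ1 fails for fixed X and r much larger than |X(0)|); that X = Γ\B is a simplicial complex is an explicit condition; o(1) is uniform in F and Γ. *)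

(* Defs.v *)
From mathcomp Require Import all_boot all_order all_algebra.
From mathcomp Require Import finmap complex.
From mathcomp Require Import all_classical all_reals all_analysis.

Set Implicit Arguments.
Unset Strict Implicit.
Unset Printing Implicit Defensive.

Import Order.TTheory GRing.Theory Num.Theory.
Import ComplexField.Normc.

Local Open Scope classical_set_scope.
Local Open Scope ring_scope.

(* [ordv x] is the valuation of [x] when [x != 0]; its value at 0 is junk, so
   it should only be used through [pideal n], the fractional ideal pi^n O. *)
Definition pideal (F : fieldType) (ordv : F -> int) (n : int) : set F :=
  [set x | x = 0 \/ n <= ordv x].

Record local_field := LocalField {
  carrier :> fieldType;
  ordv : carrier -> int;
  uniformizer : carrier;
  residue_field : finFieldType;
  reduction : carrier -> residue_field;
  uniformizerP : uniformizer != 0 /\ ordv uniformizer = 1;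
  ordvM : forall x y, x != 0 -> y != 0 -> ordv (x * y) = ordv x + ordv y;
  pidealD : forall n x y,
        pideal ordv n x -> pideal ordv n y -> pideal ordv n (x + y);
  complete_ordv : forall u : nat -> carrier,
        (forall n : int, exists N, forall i j : nat, (N <= i)%N -> (N <= j)%N ->
           pideal ordv n (u i - u j)) ->
        exists l, forall n : int, exists N, forall i : nat, (N <= i)%N ->
           pideal ordv n (u i - l);
  (* [reduction] is only constrained on the ring of integers, where it is the
     quotient morphism O -> O / pi O. *)
  reduction1 : reduction 1 = 1;
  reductionDM : forall x y, pideal ordv 0 x -> pideal ordv 0 y ->
        reduction (x + y) = reduction x + reduction y /\
        reduction (x * y) = reduction x * reduction y;
  reduction_eq0 : forall x, pideal ordv 0 x -> (reduction x = 0 <-> pideal ordv 1 x);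
  reduction_surj : forall a, exists2 x, pideal ordv 0 x & reduction x = a
}.

Arguments ordv {l} _.
Arguments uniformizer {l}.

Definition residue_card (F : local_field) : nat := #|residue_field F|.

Definition integers (F : local_field) : set F := pideal (@ordv F) 0.

Section Building.
Variable F : local_field.

Definition lattice_of (g : 'M[F]_3) : set 'cV[F]_3 :=
  [set g *m x | x in [set x : 'cV[F]_3 | forall i, integers (x i 0)]].

Definition lattice_class (g : 'M[F]_3) : set (set 'cV[F]_3) :=
  [set lattice_of (c *: g) | c in [set c : F | c != 0]].

Definition lattice_classes : set (set (set 'cV[F]_3)) :=
  [set lattice_class g | g in [set g : 'M[F]_3 | g \in unitmx]].

(* B(0) *)
Definition vertex : Type := set_type lattice_classes.

Definition adjacent (v w : vertex) : Prop :=
  v <> w /\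
  exists L L' : set 'cV[F]_3, [/\ val v L, val w L',
    [set uniformizer *: x | x in L] `<` L' & L' `<` L].

Definition simplex (s : set vertex) : Prop :=
  [/\ s !=set0, finite_set s &
      forall v w, s v -> s w -> v <> w -> adjacent v w].

(* ord(det g) modulo 3 does not depend on the choice of g representing v. *)
Definition color (v : vertex) : 'Z_3 :=
  (ordv (\det (xget 1%:M [set g : 'M[F]_3 |
     g \in unitmx /\ lattice_class g = val v])))%:~R.

(* Translation of a vertex; the default value [v] of [insubd] is never taken
   when [g] is invertible. *)
Definition act (g : 'M[F]_3) (v : vertex) : vertex :=
  insubd v [set [set g *m x | x in L] | L in val v].

End Building.

Section Quotient.
Variable F : local_field.

(* A subgroup of PGL_3(F) is represented by its preimage in GL_3(F), i.e. by a
   subgroup of GL_3(F) containing the nonzero scalar matrices; an element of it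
   is trivial in PGL_3(F) iff it is a scalar matrix. *)
Definition pgl_subgroup (Gam : set 'M[F]_3) : Prop :=
  [/\ forall g, Gam g -> g \in unitmx,
      forall g h, Gam g -> Gam h -> Gam (g *m h),
      forall g, Gam g -> Gam (invmx g) &
      forall c : F, c != 0 -> Gam c%:M].

Definition mx_close (n : int) (g h : 'M[F]_3) : Prop :=
  forall i j, pideal ordv n (g i j - h i j).

(* The images of the sets {g | mx_close n g 1} with n >= 1 form a basis of
   neighbourhoods of 1 in PGL_3(F). *)
Definition discrete (Gam : set 'M[F]_3) : Prop :=
  exists n : int, forall g, Gam g -> mx_close n g 1%:M -> is_scalar_mx g.

Definition gl_open (U : set 'M[F]_3) : Prop :=
  forall g, g \in unitmx -> U g ->
  exists n : int, forall h, h \in unitmx -> mx_close n h g -> U h.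

(* Compactness of Gam \ PGL_3(F): its open sets are the left Gam-invariant open
   subsets of GL_3(F) (invariance under scalars is included). *)
Definition cocompact (Gam : set 'M[F]_3) : Prop :=
  forall C : set (set 'M[F]_3),
    (forall U, C U ->
       gl_open U /\ (forall g h, Gam g -> U h -> U (g *m h))) ->
    (forall g, g \in unitmx -> exists2 U, C U & U g) ->
  exists2 D : set (set 'M[F]_3), finite_set D /\ D `<=` C &
    forall g, g \in unitmx -> exists2 U, D U & U g.

Definition torsion_free (Gam : set 'M[F]_3) : Prop :=
  forall (g : 'M[F]_3) (n : nat), Gam g -> (0 < n)%N ->
    is_scalar_mx (g ^+ n) -> is_scalar_mx g.

(* No nontrivial element fixes a point of (the geometric realization of) B,
   i.e. stabilizes a simplex. *)
Definition fixed_point_free (Gam : set 'M[F]_3) : Prop :=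
  forall (g : 'M[F]_3) (s : set (vertex F)), Gam g -> simplex s ->
    act g @` s = s -> is_scalar_mx g.

Definition orbit (Gam : set 'M[F]_3) (v : vertex F) : set (vertex F) :=
  [set act g v | g in Gam].

(* Gam \ B is a simplicial complex: the projection is injective on every
   simplex, and two simplices with the same image vertices are identified. *)
Definition simplicial_quotient (Gam : set 'M[F]_3) : Prop :=
  (forall (s : set (vertex F)) v w, simplex s -> s v -> s w ->
     orbit Gam v = orbit Gam w -> v = w) /\
  (forall s t : set (vertex F), simplex s -> simplex t ->
     orbit Gam @` s = orbit Gam @` t -> exists2 g, Gam g & act g @` s = t).

Definition A2_lattice (Gam : set 'M[F]_3) : Prop :=
  [/\ pgl_subgroup Gam, discrete Gam /\ cocompact Gam,
      torsion_free Gam, fixed_point_free Gam & simplicial_quotient Gam].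

Definition tripartite (Gam : set 'M[F]_3) : Prop :=
  forall g v, Gam g -> color (act g v) = color v.

(* X(0) for X = Gam \ B, as a finite type; its elements are Gam-orbits. The set
   of orbits is finite when Gam is cocompact ([fset_set] of an infinite set
   would be empty). *)
Definition X0 (Gam : set 'M[F]_3) : finType := fset_set (range (orbit Gam)).

Definition over (Gam : set 'M[F]_3) (x : X0 Gam) (v : vertex F) : Prop :=
  val x v.

(* X(k), as a set of sets of vertices of X *)
Definition cell (Gam : set 'M[F]_3) (k : nat) (t : {set X0 Gam}) : Prop :=
  #|t| = k.+1 /\
  exists2 s : set (vertex F), simplex s &
    forall x, x \in t <-> exists2 v, s v & over x v.

(* col(x -> y) = j, for an edge {x, y} of X *)
Definition edge_color (Gam : set 'M[F]_3) (x y : X0 Gam) (j : 'Z_3) : Prop :=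
  exists v w : vertex F,
    [/\ over x v, over y w, adjacent v w & color w - color v = j].

Definition colored_edge (Gam : set 'M[F]_3) (j : 'Z_3) (x y : X0 Gam) : Prop :=
  cell 1 [set x; y]%SET /\ edge_color x y j.

Definition r_geodesic (Gam : set 'M[F]_3) (r : nat)
    (p : {ffun 'I_r.+1 -> X0 Gam}) : Prop :=
  (forall i j : 'I_r.+1, j = i.+1 :> nat -> colored_edge 1 (p i) (p j)) /\
  (forall i j k : 'I_r.+1, j = i.+1 :> nat -> k = i.+2 :> nat ->
     p k <> p i /\ ~ cell 2 [set p i; p j; p k]%SET).

Definition geodesics (Gam : set 'M[F]_3) (r : nat) : finType :=
  {p : {ffun 'I_r.+1 -> X0 Gam} | `[< r_geodesic p >]}.

End Quotient.

Section Spectra.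
Variables (R : realType) (F : local_field).

Definition hecke (j : 'Z_3) (f : vertex F -> R[i]) (v : vertex F) : R[i] :=
  \sum_(w \in [set w | adjacent v w /\ color w - color v = j]) f w.

Definition l2norm_sq (f : vertex F -> R[i]) : \bar R :=
  \esum_(v in [set: vertex F]) ((normc (f v)) ^+ 2)%:E.

(* lam is in the resolvent set of A_j: A_j - lam has a bounded two-sided
   inverse S on L^2(B(0)). *)
Definition hecke_resolvent (j : 'Z_3) (lam : R[i]) : Prop :=
  exists (S : (vertex F -> R[i]) -> (vertex F -> R[i])) (M : R),
  forall f, (l2norm_sq f < +oo)%E ->
    [/\ (l2norm_sq (S f) <= M%:E * l2norm_sq f)%E,
        (fun v => hecke j (S f) v - lam * S f v) = f &
        S (fun v => hecke j f v - lam * f v) = f].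

Definition hecke_spectrum (j : 'Z_3) : set R[i] :=
  [set lam | ~ hecke_resolvent j lam].

Definition heckeX (Gam : set 'M[F]_3) (j : 'Z_3) (f : X0 Gam -> R[i])
    (x : X0 Gam) : R[i] :=
  \sum_(y : X0 Gam | `[< colored_edge j x y >]) f y.

Definition heckeX_eigenvalue (Gam : set 'M[F]_3) (j : 'Z_3) (lam : R[i]) :
    Prop :=
  exists2 f : X0 Gam -> R[i], exists x, f x != 0 &
    forall x, heckeX j f x = lam * f x.

Definition trivial_eigenvalue (lam : R[i]) : Prop :=
  let q := residue_card F in normc lam = (q ^ 2 + q + 1)%:R.

Definition ramanujan (Gam : set 'M[F]_3) : Prop :=
  forall j : 'Z_3, j \in [:: 1; 2%:R] ->
  forall lam : R[i], heckeX_eigenvalue Gam j lam ->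
    trivial_eigenvalue lam \/ hecke_spectrum j lam.

(* Adjacency of the bipartite graph G^(r)(X). A vertex and a geodesic are
   joined by as many edges as the vertex occurs along the geodesic (a geodesic
   of a finite complex may revisit a vertex). *)
Definition geodesic_graph_adj (Gam : set 'M[F]_3) (r : nat)
    (a b : X0 Gam + geodesics Gam r) : R :=
  match a, b with
  | inl x, inr p | inr p, inl x => #|[pred i | val p i == x]|%:R
  | _, _ => 0
  end.

Definition geodesic_graph_mx (Gam : set 'M[F]_3) (r : nat) :
    'M[R]_#|{: X0 Gam + geodesics Gam r}| :=
  \matrix_(a, b) geodesic_graph_adj (enum_val a) (enum_val b).

End Spectra.

(* The eigenvalues of a matrix with real spectrum, listed with multiplicity in
   non-increasing order. *)
Definition spectrum (R : realType) (n : nat) (A : 'M[R]_n) : seq R :=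
  xget [::] [set s : seq R |
    sorted >=%R s /\ char_poly A = \prod_(a <- s) ('X - a%:P)].

(* lambda_k, for k >= 1 *)
Definition eigenvalue_nth (R : realType) (n : nat) (A : 'M[R]_n) (k : nat) : R :=
  nth 0 (spectrum A) k.-1.

(* Main.v *)
Require Import Defs.
From mathcomp Require Import all_boot all_order all_algebra.
From mathcomp Require Import perm finalg spectral sesquilinear mxabelem complex finmap.
From mathcomp Require Import all_classical all_reals all_analysis.
From mathcomp Require Import ring lra zify.

(** The nonzero eigenvalues of the bipartite graph are the square roots of those of
    the form Q(f) = sum over the geodesics gamma of |sum_i f(gamma_i)|^2 on L^2(X(0)).
    Constants give lambda_1 exactly. On their orthogonal complement, Q is expanded
    into the correlations I_k(f, g) = sum over k-geodesics of f(gamma_0) g(gamma_k).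
    Since the link of a vertex is a projective plane, counting triangles gives
      I_{k+1}(f, g) = I_k(A_2 f, g) - q I_{k-1}(A_1 f, g) + q^3 I_{k-2}(f, g),
    so that |I_k| <= (2a)^k as soon as A_1 and A_2 are bounded by a there. A bound
    a = o(q^2), much weaker than the sharp 3q, makes the terms with k > 0 contribute
    o(r q^{2r}), whereas the diagonal contributes r q^{2r} (1 + o(1)).

    Such a bound comes from Schur's test on the building with the weight
    q^(beta/2), beta being the Busemann function of a rational plane: it
    gives ||A_1|| <= 5 q^{3/2} on L^2(B(0)), so the Ramanujan property yields
    |lambda| <= 10 q^{3/2} for the nontrivial eigenvalues of A_1 on X. Now A_1 is
    normal, and X is connected and not tripartite, so that the eigenfunctions of
    trivial eigenvalues are constant. *)

Set Implicit Arguments.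
Unset Strict Implicit.
Unset Printing Implicit Defensive.

Import Order.TTheory GRing.Theory Num.Theory.
Import ComplexField.Normc.
(* MathComp-Analysis shadows [adjacent]. *)
Import Defs.

Local Open Scope classical_set_scope.
Local Open Scope ring_scope.

(** * Counting geodesics *)

(** Schur's test with a constant weight only returns the trivial bound q^2 + q + 1 on A_1, because
    both degrees have this value; the weight must make most neighbors lighter, and a single Busemann
    function already does so. The test yields 5 q^{3/2}, and A_1 - lambda is inverted only for
    |lambda| beyond twice that norm, whence a = 10 q^{3/2}. The correlations ask two things of a:
    q^3 <= a^2, so that the lower terms of the recursion are absorbed, and 4 a <= q^2, so that (2
    a)^k decays geometrically against the q^{2k} continuations of a geodesic. The latter holds for
    large q only. The bound for A_2 is that for A_1, its transpose, by normality. An r-geodesic has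
    r + 1 vertices, and the exact first eigenvalue is (r + 1) q^{r-1} (q^2 + q + 1)^{1/2}. For the
    second one no eigenvector is known; instead, two orthogonal eigenvectors with eigenvalues above
    the bound would combine into one vector whose part on X(0) has sum zero, where Q is
    controlled. *)

Section SeqSum.
Variables (T : finType) (R : comNzRingType).
Implicit Types F G : seq T -> R.

(** Iterated sums over lists, rather than sums over finite functions, make prepending and appending
    a vertex computational; [seqsum_ffun] returns to the functions that define geodesics. *)
Fixpoint seqsum k F : R :=
  if k is k'.+1 then \sum_x seqsum k' (fun s => F (x :: s)) else F [::].

Lemma eq_seqsum k F G :
  (forall s, size s = k -> F s = G s) -> seqsum k F = seqsum k G.
Proof.
elim: k F G => [|k IH] F G FG /=; first exact: FG.
by apply: eq_bigr => x _; apply: IH => s sk; apply: FG; rewrite /= sk.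
Qed.

Lemma seqsumD k F G :
  seqsum k (fun s => F s + G s) = seqsum k F + seqsum k G.
Proof.
elim: k F G => [//|k IH] F G /=.
by rewrite -big_split; apply: eq_bigr => x _; rewrite IH.
Qed.

Lemma seqsumZ k a F : seqsum k (fun s => a * F s) = a * seqsum k F.
Proof.
elim: k F => [//|k IH] F /=.
by rewrite mulr_sumr; apply: eq_bigr => x _; rewrite IH.
Qed.

Lemma seqsum_sum (I : finType) k (F : I -> seq T -> R) :
  seqsum k (fun s => \sum_i F i s) = \sum_i seqsum k (F i).
Proof.
elim: k F => [//|k IH] F /=.
by rewrite exchange_big /=; apply: eq_bigr => x _; rewrite IH.
Qed.

Lemma seqsum_rcons k F :
  seqsum k.+1 F = seqsum k (fun s => \sum_x F (rcons s x)).
Proof.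
elim: k F => [//|k IH] F.
by apply: eq_bigr => x _; apply: etrans (IH (fun s => F (x :: s))) _.
Qed.

Lemma seqsum_ffun k F :
  \sum_(p : {ffun 'I_k -> T}) F [seq p i | i <- enum 'I_k] = seqsum k F.
Proof.
elim: k F => [|k IH] F /=.
  rewrite (eq_bigr (fun=> F [::])); last first.
    by move=> p _; rewrite (size0nil (s := enum 'I_0)) ?size_enum_ord.
  by rewrite big_const card_ffun card_ord expn0 /= addr0.
under [RHS]eq_bigr do rewrite -IH.
rewrite pair_big /=.
pose c (u : T * {ffun 'I_k -> T}) : {ffun 'I_k.+1 -> T} :=
  [ffun i => if unlift ord0 i is Some j then u.2 j else u.1].
pose d (p : {ffun 'I_k.+1 -> T}) := (p ord0, [ffun j => p (lift ord0 j)]).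
rewrite (reindex c) /=; last first.
  exists d => [[x p]|p] _.
    congr (_, _); first by rewrite ffunE unlift_none.
    by apply/ffunP => j; rewrite !ffunE liftK.
  apply/ffunP => i; rewrite !ffunE; case: unliftP => [j ->|->] //=.
  by rewrite ffunE.
apply: eq_bigr => -[x p] _; congr F.
rewrite enum_ordSl /= ffunE unlift_none; congr (_ :: _).
by rewrite -map_comp; apply: eq_map => j /=; rewrite ffunE liftK.
Qed.

End SeqSum.

(** * Correlations along geodesics and their recursion *)

Section GeodesicSums.
Variables (T : finType) (R : rcfType) (q : nat).
Variables (e : rel T) (tri : T -> T -> T -> bool).
Local Notation N := (q ^ 2 + q + 1)%N.

(* [e x y] stands for an edge of color one and [tri x y z] for a triangle with edges
   x -> y -> z -> x of color one. In the link of y, predecessors of y are the lines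
   and successors the planes of a 3-dimensional space over F_q, and [tri x y z] is
   the incidence of the line x with the plane z. *)
Record plane_links : Prop := PlaneLinks {
  tri_rot : forall x y z, tri x y z -> tri y z x;
  tri_edge : forall x y z, tri x y z -> e x y;
  card_out : forall x, #|[pred y | e x y]| = N;
  card_in : forall y, #|[pred x | e x y]| = N;
  card_tri : forall x y, e x y -> #|[pred z | tri x y z]| = q.+1;
  card_meet : forall x x' y, e x y -> e x' y -> x != x' ->
    #|[pred z | tri x y z && tri x' y z]| = 1%N;
  card_join : forall y z z', e y z -> e y z' -> z != z' ->
    #|[pred x | tri x y z && tri x y z']| = 1%N }.

Hypothesis links : plane_links.

Fixpoint geo (s : seq T) : bool :=
  if s is x :: s1 then
    (if s1 is y :: s2 then
       e x y && (if s2 is z :: _ then ~~ tri x y z else true) else true)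
    && geo s1
  else true.

Lemma sum_pred (P : pred T) : \sum_x (P x)%:R = #|[pred x | P x]|%:R :> R.
Proof. by rewrite -sum1_card natr_sum [RHS]big_mkcond; apply: eq_bigr => x _;
  rewrite -topredE /=; case: (P x). Qed.

Lemma triE x y z : tri x y z = tri y z x.
Proof.
apply/idP/idP; first exact: (tri_rot links).
by move=> /(tri_rot links)/(tri_rot links).
Qed.

Lemma tri_edge2 x y z : tri x y z -> e y z.
Proof. by rewrite triE => /(tri_edge links). Qed.

Lemma tri_edge3 x y z : tri x y z -> e z x.
Proof. by rewrite triE => /tri_edge2. Qed.

Lemma sum_in y : \sum_x (e x y)%:R = N%:R :> R.
Proof. by rewrite sum_pred (card_in links). Qed.

Lemma sum_out x : \sum_y (e x y)%:R = N%:R :> R.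
Proof. by rewrite sum_pred (card_out links). Qed.

(** Of the q^2 + q + 1 lines in the link of y, the q + 1 contained in the plane z close up a
    triangle. *)
Lemma sum_ext_in y z : e y z ->
  \sum_x (e x y && ~~ tri x y z)%:R = (q ^ 2)%:R :> R.
Proof.
move=> yz; have := sum_in y.
rewrite (eq_bigr (fun x => (e x y && ~~ tri x y z)%:R + (tri x y z)%:R)); last first.
  move=> x _; have := @tri_edge links x y z.
  by case: (tri x y z) => [->|_] //=; rewrite ?add0r ?andbT ?addr0.
rewrite big_split /= [X in _ + X]sum_pred.
rewrite (eq_card (B := [pred x | tri y z x])); last by move=> x; rewrite !inE triE.
rewrite (card_tri links yz) => /(canRL (addrK _)) ->.
by rewrite addn1 -addnS natrD addrK.
Qed.

Lemma sum_ext_out x y : e x y ->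
  \sum_z (e y z && ~~ tri x y z)%:R = (q ^ 2)%:R :> R.
Proof.
move=> xy; have := sum_out y.
rewrite (eq_bigr (fun z => (e y z && ~~ tri x y z)%:R + (tri x y z)%:R)); last first.
  move=> z _; have := @tri_edge2 x y z.
  by case: (tri x y z) => [->|_] //=; rewrite ?add0r ?andbT ?addr0.
rewrite big_split /= [X in _ + X]sum_pred (card_tri links xy) => /(canRL (addrK _)) ->.
by rewrite addn1 -addnS natrD addrK.
Qed.

Lemma sum_tri x z : \sum_y (tri x y z)%:R = (e z x)%:R * q.+1%:R :> R.
Proof.
rewrite sum_pred; case: (boolP (e z x)) => zx; rewrite ?mul0r ?mul1r.
  by rewrite -(card_tri links zx); congr (_%:R); apply: eq_card => y;
    rewrite !inE -(triE z x y).
by rewrite eq_card0 // => y; rewrite !inE; apply/negP => /tri_edge3; rewrite (negPf zx).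
Qed.

(** In the link of z, y runs over the q + 1 lines of the plane x, minus those which also lie in the
    plane w: a single one if x and w differ ([card_join]), all of them if x = w. *)
Lemma sum_tri_ntri x z w : e z w ->
  \sum_y (tri x y z && ~~ tri y z w)%:R = (e z x)%:R * (x != w)%:R * q%:R :> R.
Proof.
move=> zw; have := sum_tri x z.
rewrite (eq_bigr (fun y => (tri x y z && ~~ tri y z w)%:R
  + (tri x y z && tri y z w)%:R)); last first.
  by move=> y _; case: (tri x y z); case: (tri y z w); rewrite /= ?addr0 ?add0r.
rewrite big_split /= [X in _ + X]sum_pred => /(canRL (addrK _)) ->.
case: (boolP (e z x)) => zx; last first.
  rewrite !mul0r eq_card0 ?subr0 // => y; rewrite !inE.
  by apply/negP => /andP[/tri_edge3]; rewrite (negPf zx).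
rewrite !mul1r; case: (eqVneq x w) => [<-|xw] /=.
  rewrite mul0r (eq_card (B := [pred y | tri z x y])) ?(card_tri links zx) ?subrr //.
  by move=> y; rewrite !inE -(triE x y z) andbb -(triE z x y).
rewrite mul1r (eq_card (B := [pred y | tri y z x && tri y z w])).
  by rewrite (card_join links zx zw xw) -natr1 addrK.
by move=> y; rewrite !inE (triE x y z).
Qed.

(** The index k counts edges, hence the k + 1 vertices of [seqsum]. *)
Definition gsum k (F : seq T -> R) := seqsum k.+1 (fun s => (geo s)%:R * F s).

Lemma geo_edge x y s : geo (x :: y :: s) -> e x y.
Proof. by move=> /= /andP[/andP[]]. Qed.

(** The number of ways to extend a geodesic with k edges at either end. A single vertex has no
    preceding edge to avoid, whence the exceptional value at k = 0. *)
Definition ext_deg k : R := if k is 0 then N%:R else (q ^ 2)%:R.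

Lemma gsum_behead k F : gsum k.+1 (fun s => F (behead s)) = ext_deg k * gsum k F.
Proof.
apply: etrans (esym (seqsum_sum k.+1 (fun x s => (geo (x :: s))%:R * F s))) _.
rewrite /gsum -seqsumZ.
apply: eq_seqsum => -[//|y s] [sk].
rewrite -mulr_suml mulrA; congr (_ * _).
case: k s sk => [|k] [|z s] //= _; first by under eq_bigr do rewrite !andbT;
  rewrite sum_in mulr1.
case: (boolP (e y z)) => yz /=; last first.
  by rewrite mulr0 big1 // => x _; rewrite andbF.
rewrite -(sum_ext_in yz) mulr_suml; apply: eq_bigr => x _.
by rewrite -natrM mulnb.
Qed.

Lemma geo_rcons s x y z :
  geo (rcons (rcons (rcons s x) y) z) =
  [&& geo (rcons (rcons s x) y), e y z & ~~ tri x y z].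
Proof.
elim: s => [|a s IH].
  by rewrite /=; case: (e x y); case: (tri x y z); case: (e y z).
rewrite !rcons_cons [LHS]/= IH [RHS]/= -[RHS]andbA; congr (_ && _).
by case: s {IH} => [|b [|c s]].
Qed.

Lemma gsum_rcons k F F' :
  (forall s x, size s = k.+1 -> F' (rcons s x) = F s) ->
  gsum k.+1 F' = ext_deg k * gsum k F.
Proof.
move=> FF'; rewrite /gsum seqsum_rcons -seqsumZ; apply: eq_seqsum => s sk.
under eq_bigr => x _ do rewrite FF' //.
rewrite -mulr_suml mulrA; congr (_ * _).
case: k sk {FF'} => [|k].
  by case: s => [|y [|]] //= _; under eq_bigr do rewrite !andbT; rewrite sum_out mulr1.
case/lastP: s => // s y; case/lastP: s => // s x _.
under eq_bigr do rewrite geo_rcons.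
case: (boolP (geo _)) => g /=; last by rewrite mulr0 big1.
rewrite mulr1 sum_ext_out //.
by elim: s g => [|a s IH] /=; [rewrite !andbT | move=> /andP[_ /IH]].
Qed.


Definition hd_val (f : T -> R) (s : seq T) : R := if s is x :: _ then f x else 0.
Definition last_val (g : T -> R) (s : seq T) : R :=
  if s is x :: s' then g (last x s') else 0.

(** This is I_k(f, g) of the overview. *)
Definition corr k (f g : T -> R) : R :=
  gsum k (fun s => hd_val f s * last_val g s).

(** On the quotient complex, [out_sum] is A_1 and [in_sum] is A_2. *)
Definition out_sum (f : T -> R) (x : T) : R := \sum_y (e x y)%:R * f y.
Definition in_sum (f : T -> R) (y : T) : R := \sum_x (e x y)%:R * f x.

Lemma corr0 f g : corr 0 f g = \sum_x f x * g x.
Proof. by apply: eq_bigr => x _ /=; rewrite mul1r. Qed.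

Lemma corr1 f g : corr 1 f g = corr 0 (in_sum f) g.
Proof.
rewrite corr0 /corr /gsum /= exchange_big /=; apply: eq_bigr => y _.
by rewrite mulr_suml; apply: eq_bigr => x _; rewrite !andbT mulrA.
Qed.

Let tri3 x (t : seq T) := if t is y :: z :: _ then tri x y z else false.

(* Prepend a predecessor x to a geodesic y, z, w, ...: the result is a geodesic unless
   x, y, z is a triangle. In that case x is a successor of z, and if x <> w the
   vertex y can be any of the q lines of the link of z in x but not in w. *)
Lemma corr_front k f g : corr k.+2 f g = corr k.+1 (in_sum f) g
  - \sum_x seqsum k.+2 (fun t => (geo t && tri3 x t)%:R * (f x * last_val g t)).
Proof.
rewrite -seqsum_sum.
have -> : corr k.+2 f g = seqsum k.+2
    (fun t => \sum_x (geo (x :: t))%:R * (f x * last_val g t)).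
  rewrite seqsum_sum; apply: eq_bigr => x _.
  by apply: (@eq_seqsum T R k.+2 (fun t => _ * (_ * last_val g (x :: t)))) => -[].
apply/eqP; rewrite eq_sym subr_eq -seqsumD eq_sym /corr /gsum; apply/eqP.
apply: eq_seqsum => -[|y [|z t]] // _.
rewrite [hd_val _ _]/= !mulr_suml mulr_sumr -big_split /=; apply: eq_bigr => x _.
have := @tri_edge links x y z.
case: (e y z); rewrite /= ?andbF ?mul0r ?add0r //.
case: (tri x y z) => [->|_] //=; rewrite ?andbT ?andbF ?mul0r ?add0r ?addr0 ?mul1r //.
by case: (e x y); rewrite ?mul1r ?mul0r ?mulr0 ?andbF ?mul0r.
Qed.

(** Here no vertex w follows z, so all q + 1 lines y of the plane x are admissible, against q of
    them in [corr_rec]. *)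
Lemma corr2 f g : corr 2 f g = corr 1 (in_sum f) g - q.+1%:R * corr 0 (out_sum f) g.
Proof.
rewrite corr_front; congr (_ - _); rewrite corr0 mulr_sumr /=.
under eq_bigr => x _ do rewrite exchange_big /=.
rewrite exchange_big /=; apply: eq_bigr => z _.
rewrite mulr_suml mulr_sumr; apply: eq_bigr => x _.
rewrite mulrA (mulrCA q.+1%:R) !mulrA -sum_tri !mulr_suml; apply: eq_bigr => y _.
have := @tri_edge2 x y z; rewrite mulrA; case: (tri x y z) => [->|_] //=.
by rewrite !andbF !mul0r.
Qed.

(** By [sum_tri_ntri] the triangles x, y, z contribute q times the sum of f over the successors x of
    z other than w. Restoring x = w completes the sum to [out_sum f]; the added term depends on w
    and its followers only, so that summing z away leaves [ext_deg k * corr k f g]. *)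
Lemma corr_rec k f g : corr k.+3 f g = corr k.+2 (in_sum f) g
  - q%:R * (corr k.+1 (out_sum f) g - ext_deg k * corr k f g).
Proof.
rewrite corr_front; congr (_ - _).
have -> : ext_deg k * corr k f g = seqsum k.+2 (fun t =>
    (geo t)%:R * (hd_val f (behead t) * last_val g (behead t))).
  by rewrite -gsum_behead.
rewrite mulrBr -!seqsumZ -mulN1r -seqsumZ -seqsumD.
(* The vertex y is moved innermost, which turns both sides into sums over the geodesic z, w, ...
   that follows it. *)
apply: etrans (eq_bigr _ (fun x _ => esym (seqsum_sum k.+2
  (fun y t => (geo (y :: t) && tri3 x (y :: t))%:R * (f x * last_val g (y :: t)))))) _.
apply: etrans (esym (seqsum_sum k.+2 _)) _.
apply: eq_seqsum => -[|z [|w t]] // _.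
rewrite [last_val _ (behead _)]/= [last_val _ (z :: _)]/=; set G := g (last w t).
under eq_bigr => x _.
  under eq_bigr => y _ do rewrite (_ : last_val g (y :: _) = G) //.
  rewrite -mulr_suml.
  over.
rewrite [behead _]/= [hd_val _ _]/= [hd_val _ _]/=.
have gE y : geo [:: y, z, w & t] =
  (e y z && ~~ tri y z w) && geo [:: z, w & t] by [].
case: (boolP (geo [:: z, w & t])) => gt; last first.
  rewrite !mul0r !mulr0 addr0 big1 // => x _; rewrite big1 ?mul0r // => y _.
  by rewrite gE (negPf gt) !andbF.
have zw : e z w by move: gt => /geo_edge.
under eq_bigr => x _.
  under eq_bigr => y _.
    rewrite (_ : geo _ && _ = tri x y z && ~~ tri y z w); last first.
      rewrite gE gt andbT /=.
      by have := @tri_edge2 x y z; case: (tri x y z) => [->|_]; rewrite ?andbT ?andbF.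
    over.
  rewrite (sum_tri_ntri x zw).
  over.
rewrite !mul1r mulN1r; apply/eqP; rewrite eq_sym subr_eq; apply/eqP.
rewrite /out_sum mulr_suml mulr_sumr (bigD1 w) //= [in RHS](bigD1 w) //= eqxx zw.
rewrite mulr0 !mul0r add0r mul1r addrC; congr (_ + _).
by apply: eq_bigr => x /negPf ->; rewrite /= mulr1; ring.
Qed.


Definition l2norm (f : T -> R) : R := Num.sqrt (\sum_x f x ^+ 2).

Lemma sumsq_ge0 (f : T -> R) : 0 <= \sum_x f x ^+ 2.
Proof. by apply: sumr_ge0 => x _; rewrite sqr_ge0. Qed.

Lemma sqr_l2norm f : l2norm f ^+ 2 = \sum_x f x ^+ 2.
Proof. by rewrite sqr_sqrtr ?sumsq_ge0. Qed.

Lemma l2norm_ge0 f : 0 <= l2norm f. Proof. exact: sqrtr_ge0. Qed.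

(** Lagrange's identity: the difference is half the double sum of the squares (f x g y - f y g
    x)^2. *)
Lemma cauchy_schwarz_sum (f g : T -> R) :
  (\sum_x f x * g x) ^+ 2 <= (\sum_x f x ^+ 2) * (\sum_x g x ^+ 2).
Proof.
have : 0 <= \sum_x \sum_y (f x * g y - f y * g x) ^+ 2.
  by apply: sumr_ge0 => x _; apply: sumr_ge0 => y _; rewrite sqr_ge0.
have -> : \sum_x \sum_y (f x * g y - f y * g x) ^+ 2 =
   \sum_x \sum_y f x ^+ 2 * g y ^+ 2 + \sum_x \sum_y g x ^+ 2 * f y ^+ 2
   - \sum_x \sum_y (f x * g x) * (f y * g y) *+ 2.
  rewrite -!sumrN -!big_split /=; apply: eq_bigr => x _.
  by rewrite -!sumrN -!big_split /=; apply: eq_bigr => y _; ring.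
under eq_bigr do rewrite -mulr_sumr; rewrite -mulr_suml.
under [X in _ + X - _]eq_bigr do rewrite -mulr_sumr; rewrite -mulr_suml.
under [X in _ - X]eq_bigr do rewrite sumrMnl -mulr_sumr -mulrnAr.
rewrite -mulr_suml; lra.
Qed.

Lemma ler_l2norm_dot f g : `|\sum_x f x * g x| <= l2norm f * l2norm g.
Proof.
rewrite -sqrtrM ?sumsq_ge0 // -sqrtr_sqr.
by rewrite ler_wsqrtr // cauchy_schwarz_sum.
Qed.

Lemma in_sum0 f : \sum_x f x = 0 -> \sum_x in_sum f x = 0.
Proof.
move=> f0; rewrite exchange_big /=.
under eq_bigr do rewrite -mulr_suml sum_out.
by rewrite -mulr_sumr f0 mulr0.
Qed.

Lemma out_sum0 f : \sum_x f x = 0 -> \sum_x out_sum f x = 0.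
Proof.
move=> f0; rewrite exchange_big /=.
under eq_bigr do rewrite -mulr_suml sum_in.
by rewrite -mulr_sumr f0 mulr0.
Qed.

(** * Bounds for functions with sum zero *)

Section Bounds.
Variable a : R.
Hypothesis q_gt0 : (0 < q)%N.
Hypothesis a_ge0 : 0 <= a.
(** Through this condition the powers of a dominate the coefficients q and q^3 of the recursion; the
    next one makes the ratio 2 a / q^2 at most 1/2. Together they force 4 q <= a, which is [u4a]. *)
Hypothesis q_le_a : q%:R ^+ 3 <= a ^+ 2.
Hypothesis a_le_q : 4 * a <= q%:R ^+ 2.
Hypothesis out_bound : forall f, \sum_x f x = 0 -> l2norm (out_sum f) <= a * l2norm f.
Hypothesis in_bound : forall f, \sum_x f x = 0 -> l2norm (in_sum f) <= a * l2norm f.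

Let u : R := q%:R.

Let u_ge1 : 1 <= u. Proof. by rewrite /u ler1n. Qed.

Let u4a : 4 * u <= a.
Proof.
have u3 : u ^+ 3 <= a ^+ 2 := q_le_a.
have au : 4 * a <= u ^+ 2 := a_le_q.
rewrite leNgt; apply/negP => lt_au.
have : 4 * a ^+ 2 <= a * u ^+ 2 by rewrite expr2 mulrCA ler_wpM2l.
have : a * u ^+ 2 < (4 * u) * u ^+ 2 by rewrite ltr_pM2r // exprn_gt0 // (lt_le_trans
  ltr01).
have -> : 4 * u * u ^+ 2 = 4 * u ^+ 3 by ring.
lra.
Qed.

(** Divided by (2 a)^k, the induction step reads 4 a^3 + 2 a^2 u + 3 u^3 <= 8 a^3 with u = q. The
    leading term uses half of the right side; the other two are small by [u4a] and [q_le_a]. This is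
    what the factor 2 in 2 a pays for. *)
Lemma corr_bound k f g : \sum_x f x = 0 ->
  `|corr k f g| <= (2 * a) ^+ k * (l2norm f * l2norm g).
Proof.
have u0 := u_ge1; have ua := u4a.
elim/ltn_ind: k f => -[|[|[|k]]] IH f f0.
- by rewrite expr0 mul1r corr0 ler_l2norm_dot.
- rewrite corr1; apply: le_trans (IH 0%N isT _ (in_sum0 f0)) _.
  rewrite expr0 mul1r expr1 mulrA ler_wpM2r ?l2norm_ge0 //.
  apply: le_trans (in_bound f0) _; rewrite ler_wpM2r ?l2norm_ge0 //; lra.
- rewrite corr2; apply: le_trans (ler_normB _ _) _.
  rewrite normrM normr_nat -natr1.
  have h1 := IH 1%N isT _ (in_sum0 f0); have h0 := IH 0%N isT _ (out_sum0 f0).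
  have Kf : l2norm (in_sum f) * l2norm g <= a * (l2norm f * l2norm g).
    by rewrite mulrA ler_wpM2r ?l2norm_ge0 ?in_bound.
  have Kf' : l2norm (out_sum f) * l2norm g <= a * (l2norm f * l2norm g).
    by rewrite mulrA ler_wpM2r ?l2norm_ge0 ?out_bound.
  have K0 : 0 <= l2norm f * l2norm g by rewrite mulr_ge0 ?l2norm_ge0.
  move: h1 h0 Kf Kf' K0; rewrite -/u.
  set c1 := `|_|; set c0 := `|_|; set K := l2norm f * _.
  set X := l2norm _ * _; set Y := l2norm _ * _ => h1 h0 hX hY K0.
  have e1 : c1 <= 2 * a * (a * K).
    by apply: le_trans h1 _; rewrite expr1 ler_wpM2l // mulr_ge0.
  have e0 : (u + 1) * c0 <= (u + 1) * (a * K).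
    rewrite ler_wpM2l ?addr_ge0 //.
    by rewrite expr0 mul1r in h0; exact: le_trans h0 hY.
  have aK : 0 <= a * K by rewrite mulr_ge0.
  have : (u + 1) * (a * K) <= (2 * a) * (a * K) by rewrite ler_wpM2r //; lra.
  rewrite expr2 -!mulrA in e1 e0 *; nra.
- rewrite corr_rec; apply: le_trans (ler_normB _ _) _.
  rewrite normrM normr_nat -/u.
  have h2 := IH k.+2 (ltnSn _) _ (in_sum0 f0).
  have h1 := IH k.+1 (leqnSn _) _ (out_sum0 f0).
  (* The factor 3 u^2 covers both values of [ext_deg], namely q^2 + q + 1 at k = 0 and q^2
     beyond. *)
  have h0 : `|ext_deg k * corr k f g| <= 3 * u ^+ 2 * ((2 * a) ^+ k * (l2norm f *
    l2norm g)).
    rewrite normrM; apply: ler_pM; rewrite ?normr_ge0 //;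
      last exact: (IH k (leq_addl 2 k.+1) _ f0).
    case: (k) => [|j]; rewrite /ext_deg normr_nat ?natrD ?natrX -/u; nra.
  have Kf : l2norm (in_sum f) * l2norm g <= a * (l2norm f * l2norm g).
    by rewrite mulrA ler_wpM2r ?l2norm_ge0 ?in_bound.
  have Kf' : l2norm (out_sum f) * l2norm g <= a * (l2norm f * l2norm g).
    by rewrite mulrA ler_wpM2r ?l2norm_ge0 ?out_bound.
  have K0 : 0 <= l2norm f * l2norm g by rewrite mulr_ge0 ?l2norm_ge0.
  have := ler_normB (corr k.+1 (out_sum f) g) (ext_deg k * corr k f g).
  move: h2 h1 h0 Kf Kf' K0.
  set c2 := `|_|; set c1 := `|_|; set c0 := `|_|; set c := `|_|.
  set K := l2norm f * _; set X := l2norm _ * _; set Y := l2norm _ * _.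
  move=> h2 h1 h0 hX hY K0 hc.
  set P := (2 * a) ^+ k in h0 *.
  have P0 : 0 <= P by rewrite exprn_ge0 // mulr_ge0.
  have e2 : c2 <= 4 * a ^+ 3 * (P * K).
    apply: le_trans h2 _; apply: le_trans (ler_wpM2l _ hX) _;
      first by rewrite exprn_ge0 ?mulr_ge0.
    by rewrite !exprS -/P le_eqVlt; apply/orP; left; apply/eqP; ring.
  have e1 : c1 <= 2 * a ^+ 2 * (P * K).
    apply: le_trans h1 _; apply: le_trans (ler_wpM2l _ hY) _;
      first by rewrite exprn_ge0 ?mulr_ge0.
    by rewrite !exprS -/P le_eqVlt; apply/orP; left; apply/eqP; ring.
  have PK : 0 <= P * K by rewrite mulr_ge0.
  have euc : u * c <= (2 * a ^+ 2 * u + 3 * u ^+ 3) * (P * K).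
    have : u * c <= u * ((2 * a ^+ 2 + 3 * u ^+ 2) * (P * K)).
      by rewrite ler_wpM2l //; lra.
    move/le_trans; apply; rewrite le_eqVlt; apply/orP; left; apply/eqP; ring.
  have -> : (2 * a) ^+ k.+3 * K = 8 * a ^+ 3 * (P * K) by rewrite !exprS -/P; ring.
  apply: le_trans (lerD e2 euc) _; rewrite -mulrDl ler_wpM2r //.
  have u3 : u ^+ 3 <= a ^+ 2 := q_le_a.
  have a2 : 0 <= a ^+ 2 by rewrite sqr_ge0.
  have : 4 * u * a ^+ 2 <= a * a ^+ 2 by rewrite ler_wpM2r.
  have : 4 * 1 * a ^+ 2 <= a * a ^+ 2 by rewrite ler_wpM2r //; lra.
  rewrite -exprS; nra.
Qed.


Definition visit_sum (f : T -> R) (s : seq T) : R := \sum_(x <- s) f x.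

Lemma eq_gsum k F G :
  (forall s, size s = k.+1 -> F s = G s) -> gsum k F = gsum k G.
Proof. by move=> FG; apply: eq_seqsum => s /FG ->. Qed.

Lemma gsumD k F G : gsum k (fun s => F s + G s) = gsum k F + gsum k G.
Proof. by rewrite /gsum -seqsumD; apply: eq_seqsum => s _; rewrite mulrDr. Qed.

Lemma gsumZ k c F : gsum k (fun s => c * F s) = c * gsum k F.
Proof. by rewrite /gsum -seqsumZ; apply: eq_seqsum => s _; rewrite mulrCA. Qed.

(** A geodesic with k + 1 edges and given initial vertex has N choices for its first edge and q^2
    for each of the k others. *)
Lemma gsum_hd k f : gsum k.+1 (hd_val f) = N%:R * u ^+ (2 * k) * \sum_x f x.
Proof.
have hdE s x : (0 < size s)%N -> hd_val f (rcons s x) = hd_val f s by case: s.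
elim: k => [|k IH].
  rewrite (@gsum_rcons 0 (hd_val f)) => [|s x sz]; last by rewrite hdE ?sz.
  rewrite muln0 expr0 mulr1; congr (_ * _).
  by apply: eq_bigr => x _; rewrite /= mul1r.
rewrite (@gsum_rcons k.+1 (hd_val f)) => [|s x sz]; last by rewrite hdE ?sz.
by rewrite IH /= mulnS exprD natrX; ring.
Qed.

(** Each of the k + 2 positions along a geodesic visits every vertex equally often, so each
    contributes the value of [gsum_hd]. *)
Lemma gsum_visits k f :
  gsum k.+1 (visit_sum f) = (k.+2 * N)%:R * u ^+ (2 * k) * \sum_x f x.
Proof.
have rec j : gsum j.+1 (visit_sum f) =
    gsum j.+1 (hd_val f) + ext_deg j * gsum j (visit_sum f).
  rewrite -gsum_behead -gsumD; apply: eq_gsum => -[|x s] //= _.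
  by rewrite /visit_sum big_cons.
elim: k => [|k IH]; rewrite rec gsum_hd.
  have -> : gsum 0 (visit_sum f) = \sum_x f x.
    by apply: eq_bigr => x _; rewrite /visit_sum big_seq1 /= mul1r.
  by rewrite muln0 expr0 natrM /=; ring.
by rewrite IH /= mulnS exprD natrX !natrM -[k.+3%:R]natr1; ring.
Qed.

(** The correlation of the initial vertex with all later ones. When the square of [visit_sum] is
    expanded one head at a time, these are the only cross terms. *)
Definition tail_corr k (f : T -> R) : R :=
  gsum k (fun s => hd_val f s * visit_sum f (behead s)).

(** The last vertex is split off: the remaining terms do not depend on it, and summing it away
    yields [ext_deg k]. *)
Lemma tail_corr_rec k f :
  tail_corr k.+1 f = ext_deg k * tail_corr k f + corr k.+1 f f.
Proof.
pose A s := hd_val f s * (visit_sum f (behead s) - last_val f s).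
have -> : ext_deg k * tail_corr k f = gsum k.+1 A.
  symmetry; apply: gsum_rcons => -[|x s] y //= _.
  by rewrite /A /= /visit_sum last_rcons -cats1 big_cat big_seq1 addrK.
by rewrite -gsumD; apply: eq_gsum => s _; rewrite /A -mulrDr subrK.
Qed.

Lemma tail_corr_bound k f : \sum_x f x = 0 ->
  tail_corr k.+1 f <= u ^+ (2 * k) * (4 * a) * \sum_x f x ^+ 2.
Proof.
move=> f0; have u0 := u_ge1; have au : 4 * a <= u ^+ 2 := a_le_q.
have u2 : 0 < u ^+ 2 by rewrite exprn_gt0 // (lt_le_trans ltr01).
pose t := 2 * a / u ^+ 2; have tu : t * u ^+ 2 = 2 * a by rewrite divfK ?gt_eqF.
have t0 : 0 <= t by rewrite divr_ge0 ?sqr_ge0 ?mulr_ge0.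
have t1 : t <= 1 / 2 by rewrite ler_pdivrMr //; lra.
set K := \sum_x _; have K0 : 0 <= K by apply: sumsq_ge0.
have cb k' : corr k' f f <= (2 * a) ^+ k' * K.
  apply: le_trans (ler_norm _) (le_trans (corr_bound _ _ f0) _).
  by rewrite -expr2 sqr_l2norm.
(* The recursion solves to the geometric sum u^{2j} (t + ... + t^j), where 1 / (1 - t) is at most 2.
   The negative term is what closes the induction. *)
suff H j : tail_corr j f <= (2 * t * u ^+ (2 * j) - 2 * t * (2 * a) ^+ j) * K.
  apply: le_trans (H k.+1) _; rewrite ler_wpM2r // mulnS exprD.
  have -> : 2 * t * (u ^+ 2 * u ^+ (2 * k)) = u ^+ (2 * k) * (4 * a).
    by rewrite [2 * t]mulrC; transitivity (2 * u ^+ (2 * k) * (t * u ^+ 2));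
      [|rewrite tu]; ring.
  have a2 : 0 <= 2 * a by rewrite mulr_ge0.
  by rewrite gerBl mulr_ge0 ?exprn_ge0 // mulr_ge0.
elim: j => [|j IH].
  rewrite muln0 !expr0 subrr mul0r /tail_corr /gsum /= big1 // => x _.
  by rewrite /visit_sum big_nil !mulr0.
have ext : ext_deg j * tail_corr j f <= u ^+ 2 * ((2 * t * u ^+ (2 * j) - 2 * t * (2 *
  a) ^+ j) * K).
  (* At j = 0 the factor [ext_deg 0] is N instead of u^2, but [tail_corr 0] vanishes. *)
  case: j IH => [|j] IH; last by rewrite /= natrX ler_wpM2l // sqr_ge0.
  rewrite muln0 !expr0 subrr mul0r mulr0 /tail_corr /gsum /= big1 ?mulr0 // => x _.
  by rewrite /visit_sum big_nil !mulr0.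
rewrite tail_corr_rec; apply: le_trans (lerD ext (cb _)) _.
rewrite mulrA -mulrDl ler_wpM2r // mulnS exprD [(2 * a) ^+ _.+1]exprS.
set P := (2 * a) ^+ j; set U := u ^+ (2 * j).
have P0 : 0 <= P by rewrite exprn_ge0 // mulr_ge0.
have -> : u ^+ 2 * (2 * t * U - 2 * t * P) =
  2 * t * (u ^+ 2 * U) - 2 * (t * u ^+ 2) * P by ring.
rewrite tu.
have aP : 0 <= a * P by rewrite mulr_ge0.
have : t * (a * P) <= 1 / 2 * (a * P) by rewrite ler_wpM2r.
lra.
Qed.

(** In (f x + S)^2, with x the head, the squares contribute N q^{2k} for each of the k + 2 vertices,
    and twice [tail_corr] contributes at most 8 a q^{2k} for each of the k + 1 heads that have a
    tail. *)
Lemma gsum_visits_sqr_bound k f : \sum_x f x = 0 ->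
  gsum k.+1 (fun s => visit_sum f s ^+ 2) <=
  u ^+ (2 * k) * (k.+2%:R * N%:R + k.+1%:R * (8 * a)) * \sum_x f x ^+ 2.
Proof.
move=> f0.
have rec j : gsum j.+1 (fun s => visit_sum f s ^+ 2) =
    gsum j.+1 (hd_val (fun x => f x ^+ 2)) + 2 * tail_corr j.+1 f
    + ext_deg j * gsum j (fun s => visit_sum f s ^+ 2).
  rewrite -gsum_behead -gsumZ -!gsumD; apply: eq_gsum => -[|x s] //= _.
  by rewrite /visit_sum big_cons; ring.
elim: k => [|k IH]; rewrite rec gsum_hd.
  have := tail_corr_bound 0 f0; rewrite muln0 expr0 mulr1 !mul1r /=.
  have -> : gsum 0 (fun s => visit_sum f s ^+ 2) = \sum_x f x ^+ 2.
    by apply: eq_bigr => x _; rewrite /visit_sum big_seq1 /= mul1r.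
  set K := \sum_x _; lra.
have := tail_corr_bound k.+1 f0; have := sumsq_ge0 f.
move: IH; rewrite /= natrX -/u mulnS exprD -[k.+3%:R]natr1 -[k.+2%:R]natr1.
set K := \sum_x _; set U := u ^+ (2 * k); set Q := gsum _ _; set D := tail_corr _ _.
move=> IH K0 hD; have : u ^+ 2 * Q <= u ^+ 2 * (U * ((k.+1%:R + 1) * N%:R + k.+1%:R *
  (8 * a)) * K).
  by rewrite ler_wpM2l // exprn_ge0.
move: hD; set V := u ^+ 2.
lra.
Qed.

End Bounds.

End GeodesicSums.

(** * Normal and symmetric matrices *)

Section NormalMatrices.
Variable C : numClosedFieldType.

Lemma char_poly_conj n (P A : 'M[C]_n) : P \in unitmx ->
  char_poly (invmx P *m A *m P) = char_poly A.
Proof.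
move=> Pu; rewrite /char_poly /char_poly_mx !map_mxM.
have PV : map_mx polyC (invmx P) *m map_mx polyC P = 1%:M.
  by rewrite -map_mxM mulVmx // map_mx1.
rewrite (_ : 'X%:M - _ = map_mx polyC (invmx P) *m
  ('X%:M - map_mx polyC A) *m map_mx polyC P).
  by rewrite !det_mulmx mulrAC -det_mulmx PV det1 mul1r.
by rewrite mulmxBr mulmxBl mul_mx_scalar -scalemxAl PV scalemx1.
Qed.

Lemma normalmx_row_eigen n (A : 'M[C]_n) i : A \is normalmx ->
  row i (spectralmx A) *m A = spectral_diag A 0 i *: row i (spectralmx A).
Proof.
move=> /orthomx_spectralP AE; have U := spectral_unit A.
rewrite {2}AE !mulmxA -row_mul mulmxV //.
by rewrite -row_mul mul1mx row_diag_mx -scalemxAl -rowE.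
Qed.

Lemma sqnorm_rowE n (u : 'rV[C]_n) : (u *m (u ^t* )%sesqui) 0 0 = \sum_i `|u 0 i| ^+ 2.
Proof. by rewrite mxE; apply: eq_bigr => i _; rewrite !mxE normCK. Qed.

(** In an orthonormal eigenbasis, u has no coordinate along the eigenvectors whose eigenvalue may
    exceed a. *)
Lemma normalmx_bound n (A : 'M[C]_n) (a : C) (u : 'rV[C]_n) : A \is normalmx ->
  (forall (v : 'rV[C]_n) lam, v != 0 -> v *m A = lam *: v ->
     `|lam| <= a \/ u *m (v ^t* )%sesqui = 0) ->
  \sum_i `|(u *m A) 0 i| ^+ 2 <= a ^+ 2 * \sum_i `|u 0 i| ^+ 2.
Proof.
move=> An H; have /orthomx_spectralP AE := An.
have PU := spectral_unitarymx A.
have row_eig := fun i => normalmx_row_eigen i An.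
move: AE PU row_eig; set P := spectralmx A; set d := spectral_diag A.
move=> AE PU row_eig.
have PP : P *m (P ^t* )%sesqui = 1%:M by apply/unitarymxP.
have PV : invmx P = (P ^t* )%sesqui by apply: invmx_unitary.
pose c := u *m (P ^t* )%sesqui.
have uE : u = c *m P by rewrite /c -PV mulmxKV ?unitarymx_unit.
have uAE : u *m A = (c *m diag_mx d) *m P by rewrite AE PV !mulmxA.
have iso (w : 'rV[C]_n) : \sum_i `|(w *m P) 0 i| ^+ 2 = \sum_i `|w 0 i| ^+ 2 :> C.
  rewrite -!sqnorm_rowE trmx_mul map_mxM mulmxA -[w *m P *m _]mulmxA PP.
  by rewrite mulmx1.
rewrite uAE iso uE iso mulr_sumr; apply: ler_sum => i _.
have -> : (c *m diag_mx d) 0 i = c 0 i * d 0 i by rewrite mul_mx_diag mxE.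
rewrite normrM exprMn mulrC.
have Pi0 : row i P != 0.
  apply: contraTneq isT => Pi0.
  have : (P *m (P ^t* )%sesqui) i i = 0.
    rewrite mxE big1 // => j _; have /matrixP/(_ 0 j) := Pi0.
    by rewrite !mxE => ->; rewrite mul0r.
  by rewrite PP mxE eqxx => /eqP; rewrite oner_eq0.
have [lea|c0] := H _ _ Pi0 (row_eig i).
  rewrite ler_wpM2r ?exprn_ge0 //.
  by rewrite lerXn2r // nnegrE (le_trans _ lea).
have -> : c 0 i = 0.
  have /matrixP/(_ 0 0) := c0; rewrite !mxE => c0'.
  by rewrite -[RHS]c0'; apply: eq_bigr => j _; rewrite !mxE.
by rewrite normr0 expr0n /= !mulr0.
Qed.

End NormalMatrices.

Section Spectral.
Variable R : realType.
Local Notation C := R[i].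
Local Notation toC := (real_complex R).

Lemma normcE (z : C) : `|z| = (normc z)%:C%C.
Proof. by case: z. Qed.

Lemma normsqR (x : R) : `|toC x| ^+ 2 = toC (x ^+ 2) :> C.
Proof.
rewrite normcE -rmorphXn /=; congr toC.
by rewrite expr0n /= addr0 sqrtr_sqr real_normK ?num_real.
Qed.

(** A function with sum zero is orthogonal to the constants, which are the only eigenfunctions
    allowed a large eigenvalue. The spectral theorem needs complex eigenfunctions, although k and f
    are real. *)
Lemma normal_kernel_bound (T : finType) (k : T -> T -> R) (a : R) (f : T -> R) :
  (forall x y, \sum_z k x z * k y z = \sum_z k z x * k z y) -> 0 <= a ->
  (forall (g : T -> C) (lam : C), (exists x, g x != 0) ->
     (forall x, \sum_y toC (k x y) * g y = lam * g x) ->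
     normc lam <= a \/ exists c, forall x, g x = c) ->
  \sum_x f x = 0 ->
  \sum_x (\sum_y k x y * f y) ^+ 2 <= a ^+ 2 * \sum_x f x ^+ 2.
Proof.
move=> knormal a0 H f0.
(* The kernel is transposed because [normalmx_bound] acts on row vectors. *)
pose M : 'M[C]_#|T| := \matrix_(i, j) toC (k (enum_val j) (enum_val i)).
pose u : 'rV[C]_#|T| := \row_j toC (f (enum_val j)).
have sumT (V : nmodType) (F : T -> V) : \sum_x F x = \sum_(i < #|T|) F (enum_val i).
  by rewrite (reindex (fun i : 'I_#|T| => enum_val i)) //=; exact: onW_bij (enum_val_bij _).
have conjR (x : R) : (toC x)^* = toC x by exact: conjc_real.
have Mn : M \is normalmx.
  apply/normalmxP/matrixP => i j; rewrite !mxE.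
  under eq_bigr do rewrite !mxE conjR -rmorphM.
  under [RHS]eq_bigr do rewrite !mxE conjR -rmorphM.
  rewrite -!raddf_sum; congr toC.
  by have := esym (knormal (enum_val i) (enum_val j)); rewrite !sumT.
have muM (v : 'rV[C]_#|T|) j :
    (v *m M) 0 j = \sum_x toC (k (enum_val j) x) * v 0 (enum_rank x).
  by rewrite mxE sumT; apply: eq_bigr => i _; rewrite enum_valK mxE mulrC.
have := normalmx_bound (a := toC a) (u := u) Mn _.
have -> : \sum_i `|(u *m M) 0 i| ^+ 2 = toC (\sum_x (\sum_y k x y * f y) ^+ 2).
  rewrite raddf_sum sumT; apply: eq_bigr => i _.
  rewrite muM /= -normsqR; congr (`|_| ^+ 2).
  by rewrite raddf_sum; apply: eq_bigr => y _; rewrite mxE enum_rankK /= rmorphM.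
have -> : \sum_i `|u 0 i| ^+ 2 = toC (\sum_x f x ^+ 2).
  rewrite raddf_sum sumT; apply: eq_bigr => i _.
  by rewrite mxE /= normsqR.
rewrite -rmorphXn -rmorphM lecR; apply => v lam v0 vM.
have [||lea|[c vc]] := H (fun x => v 0 (enum_rank x)) lam.
- case/rV0Pn: v0 => i vi; exists (enum_val i); by rewrite enum_valK.
- move=> x; have /matrixP/(_ 0 (enum_rank x)) := vM.
  by rewrite muM enum_rankK mxE.
- by left; rewrite normcE lecR.
- right; apply/matrixP => i j; rewrite !ord1 !mxE.
  under eq_bigr => l _ do rewrite !mxE -(enum_valK l) vc enum_valK.
  by rewrite -mulr_suml -raddf_sum -(sumT _ f) f0 raddf0 mul0r.
Qed.

(** As [spectrum] is chosen by [xget], a sorted list of roots has to be exhibited first. The chosen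
    list is then a permutation of the diagonal of the spectral theorem, and the rows of the
    eigenbasis are permuted accordingly. *)
Lemma spectrum_symP n (A : 'M[R]_n) : A^T = A ->
  let s := spectrum A in
  [/\ size s = n,
    sorted >=%R s /\ char_poly A = \prod_(x <- s) ('X - x%:P) &
    exists2 P : 'M[C]_n, P \is unitarymx &
    forall i : 'I_n, row i P *m map_mx toC A = toC s`_i *: row i P].
Proof.
move=> At s; set B := map_mx toC A.
have conjR (x : R) : (toC x)^* = toC x by exact: conjc_real.
have Bh : B \is hermsymmx.
  apply: realsym_hermsym.
    apply/is_hermitianmxP; rewrite expr0 scale1r; apply/matrixP => i j.
    by rewrite !mxE -{1}At mxE.
  by apply/mxOverP => i j; rewrite mxE; apply/CrealP; rewrite conjR.
have Bn := hermitian_normalmx Bh.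
have /orthomx_spectralP BE := Bn.
have PU := spectral_unitarymx B; have Pu := spectral_unit B.
have dR := hermitian_spectral_diag_real Bh.
have row_eig := fun i => normalmx_row_eigen i Bn.
move: BE PU Pu dR row_eig; set P := spectralmx B; set d := spectral_diag B.
move=> BE PU Pu dR row_eig.
have dE i : d 0 i = toC (complex.Re (d 0 i)).
  have /mxOverP/(_ 0 i)/CrealP := dR; case: (d 0 i) => x y [] /esym/eqP.
  by rewrite -subr_eq0 opprK -mulr2n mulrn_eq0 /= => /eqP ->.
pose D := [tuple complex.Re (d 0 i) | i < n].
have charA : char_poly A = \prod_(x <- D) ('X - x%:P).
  apply: (map_poly_inj toC); rewrite map_char_poly -/B BE char_poly_conj //.
  rewrite char_poly_trig ?diag_mx_is_trig // rmorph_prod /= big_map big_enum /=.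
  apply: eq_bigr => i _; rewrite mxE eqxx mulr1n dE.
  by rewrite rmorphB /= map_polyX map_polyC.
have [s_sorted sE] : sorted >=%R s /\ char_poly A = \prod_(x <- s) ('X - x%:P).
  rewrite /s /spectrum; case: xgetP => [t -> //|/(_ (sort >=%R D))[]].
  split; first by apply: sort_sorted => x y; exact: ge_total.
  by rewrite charA; apply: perm_big; rewrite perm_sym perm_sort.
have sD : perm_eq s D by apply: prod_XsubC_eq; rewrite -sE.
split=> //; first by rewrite (perm_size sD) size_tuple.
have /tuple_permP[p sp] := sD.
exists (row_perm p P).
  apply/unitarymxP/matrixP => i j; have /unitarymxP/matrixP/(_ (p i) (p j)) := PU.
  rewrite !mxE (inj_eq perm_inj) => <-.
  by apply: eq_bigr => l _; rewrite !mxE.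
move=> i; have -> : s`_i = complex.Re (d 0 (p i)).
  by rewrite sp (nth_map i) ?size_enum_ord // nth_ord_enum tnth_mktuple.
have -> : row i (row_perm p P) = row (p i) P by apply/rowP => j; rewrite !mxE.
by rewrite -dE -row_eig.
Qed.

End Spectral.

(** * Integral matrices and links in the building *)

Section Integers.
Variable F : local_field.
Local Notation k := (residue_field F).
Local Notation pi := (@uniformizer F).
Local Notation red := (@reduction F).
Implicit Types x y : F.

Lemma pi_neq0 : pi != 0. Proof. by case: (uniformizerP F). Qed.
Lemma ordv_pi : ordv pi = 1. Proof. by case: (uniformizerP F). Qed.

Lemma ordv1 : ordv (1 : F) = 0.
Proof. have := @ordvM F 1 1 (oner_neq0 _) (oner_neq0 _); rewrite mulr1; lia. Qed.

Lemma ordvN1 : ordv (-1 : F) = 0.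
Proof.
have N1 : (-1 : F) != 0 by rewrite oppr_eq0 oner_neq0.
have := ordvM N1 N1; rewrite mulrNN mulr1 ordv1; lia.
Qed.

Lemma ordvV x : x != 0 -> ordv x^-1 = - ordv x.
Proof.
move=> x0; have := @ordvM F x x^-1 x0; rewrite invr_eq0 => /(_ x0).
by rewrite divff // ordv1; lia.
Qed.

Lemma ordvX x m : x != 0 -> ordv (x ^+ m) = ordv x *+ m.
Proof.
move=> x0; elim: m => [|m IH]; first by rewrite expr0 ordv1.
by rewrite exprS ordvM ?expf_neq0 // IH mulrS.
Qed.

Lemma ordv_expz (z : int) : ordv (pi ^ z) = z.
Proof.
case: z => m.
  by rewrite -exprnP ordvX ?pi_neq0 // ordv_pi; lia.
by rewrite NegzE -exprnN ordvV ?expf_neq0 ?pi_neq0 // ordvX ?pi_neq0 // ordv_pi; lia.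
Qed.

Lemma pi_expz_neq0 (z : int) : pi ^ z != 0.
Proof. exact/expfz_neq0/pi_neq0. Qed.

Lemma integers0 : integers (0 : F). Proof. by left. Qed.
Lemma integers1 : integers (1 : F). Proof. by right; rewrite ordv1. Qed.
Lemma integers_pi : integers pi. Proof. by right; rewrite ordv_pi. Qed.

Lemma integersM x y : integers x -> integers y -> integers (x * y).
Proof.
have [->|x0] := eqVneq x 0; first by rewrite mul0r.
have [->|y0] := eqVneq y 0; first by rewrite mulr0.
case=> [/eqP|hx]; first by rewrite (negPf x0).
case=> [/eqP|hy]; first by rewrite (negPf y0).
by right; rewrite ordvM //; lia.
Qed.

Lemma integersD x y : integers x -> integers y -> integers (x + y).
Proof. exact: pidealD. Qed.

Lemma integersN1 : integers (-1 : F). Proof. by right; rewrite ordvN1. Qed.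

Lemma integersP x : x != 0 -> integers x <-> 0 <= ordv x.
Proof. by move=> x0; split; [case=> // /eqP; rewrite (negPf x0)|right]. Qed.

Lemma red0 : red 0 = 0.
Proof. by apply/(reduction_eq0 integers0); left. Qed.

Lemma redN1 : red (-1) = -1.
Proof.
have [h _] := reductionDM integers1 integersN1.
by move: h; rewrite subrr red0 reduction1 => /eqP; rewrite eq_sym addrC addr_eq0 => /eqP.
Qed.

Lemma red_pi : red pi = 0.
Proof. by apply/(reduction_eq0 integers_pi); right; rewrite ordv_pi. Qed.

Lemma red_neq0 x : integers x -> red x != 0 <-> x != 0 /\ ordv x = 0.
Proof.
move=> ix; split.
  move=> rx; have x0 : x != 0 by apply: contraNneq rx => ->; rewrite red0.
  split=> //; have /(integersP x0) := ix.
  suff : ~~ (1 <= ordv x) by lia.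
  by apply: contra rx => h; apply/eqP/(reduction_eq0 ix); right.
move=> [x0 ox]; apply/eqP => /(reduction_eq0 ix)[/eqP|]; first exact/negP.
by rewrite ox.
Qed.

Lemma red_eq0_div x : integers x -> red x = 0 -> integers (pi^-1 * x).
Proof.
move=> ix /(reduction_eq0 ix)[->|h]; first by rewrite mulr0; exact: integers0.
have [->|x0] := eqVneq x 0; first by rewrite mulr0; exact: integers0.
by right; rewrite ordvM ?invr_eq0 ?pi_neq0 // ordvV ?pi_neq0 // ordv_pi; lia.
Qed.

(** Since [reduction] is unconstrained outside the integers, integrality and the reduced value are
    carried together through sums, products and determinants. *)
Definition reduces x (a : k) := integers x /\ red x = a.

Lemma reduces0 : reduces 0 0. Proof. by split; [exact: integers0|exact: red0]. Qed.
Lemma reduces1 : reduces 1 1.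
Proof. by split; [exact: integers1|exact: reduction1]. Qed.
Lemma reducesN1 : reduces (-1) (-1).
Proof. by split; [exact: integersN1|exact: redN1]. Qed.
Lemma reducesD x y a b : reduces x a -> reduces y b -> reduces (x + y) (a + b).
Proof.
move=> [ix <-] [iy <-]; split; first exact: integersD.
by have [] := reductionDM ix iy.
Qed.
Lemma reducesM x y a b : reduces x a -> reduces y b -> reduces (x * y) (a * b).
Proof.
move=> [ix <-] [iy <-]; split; first exact: integersM.
by have [] := reductionDM ix iy.
Qed.

Lemma reduces_sum (I : finType) (f : I -> F) (g : I -> k) :
  (forall i, reduces (f i) (g i)) -> reduces (\sum_i f i) (\sum_i g i).
Proof. by move=> fg; apply: big_ind2 => //; [exact: reduces0|move=> *;
  exact: reducesD]. Qed.

Lemma reduces_prod (I : finType) (f : I -> F) (g : I -> k) :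
  (forall i, reduces (f i) (g i)) -> reduces (\prod_i f i) (\prod_i g i).
Proof. by move=> fg; apply: big_ind2 => //; [exact: reduces1|move=> *;
  exact: reducesM]. Qed.

Definition mx_reduces m n (A : 'M[F]_(m, n)) (B : 'M[k]_(m, n)) :=
  forall i j, reduces (A i j) (B i j).

Lemma mx_reducesM m n p (A : 'M[F]_(m, n)) (B : 'M[F]_(n, p)) A' B' :
  mx_reduces A A' -> mx_reduces B B' -> mx_reduces (A *m B) (A' *m B').
Proof.
move=> hA hB i j; rewrite !mxE; apply: reduces_sum => l.
exact: reducesM.
Qed.

Lemma mx_reduces1 n : @mx_reduces n n 1%:M 1%:M.
Proof.
by move=> i j; rewrite !mxE; case: (i == j); [exact: reduces1|exact: reduces0].
Qed.

Lemma reduces_sign m : reduces ((-1) ^+ m) ((-1) ^+ m).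
Proof.
elim: m => [|m IH]; first exact: reduces1.
by rewrite !exprS; apply: reducesM IH; exact: reducesN1.
Qed.

Lemma reduces_det n (A : 'M[F]_n) A' : mx_reduces A A' -> reduces (\det A) (\det A').
Proof.
move=> hA; apply: reduces_sum => s; apply: reducesM; first exact: reduces_sign.
by apply: reduces_prod => i.
Qed.

Lemma mx_reduces_adj n (A : 'M[F]_n) A' : mx_reduces A A' -> mx_reduces (\adj A) (\adj A').
Proof.
move=> hA i j; rewrite !mxE; apply: reducesM; first exact: reduces_sign.
by apply: reduces_det => a b; rewrite !mxE.
Qed.

Definition intmx m n (A : 'M[F]_(m, n)) := forall i j, integers (A i j).
Definition redmx m n (A : 'M[F]_(m, n)) : 'M[k]_(m, n) := map_mx red A.

Lemma redmxP m n (A : 'M[F]_(m, n)) : intmx A -> mx_reduces A (redmx A).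
Proof. by move=> hA i j; rewrite mxE; split. Qed.

Lemma mx_reducesE m n (A : 'M[F]_(m, n)) A' : mx_reduces A A' -> intmx A /\ redmx A = A'.
Proof.
move=> hA; split; first by move=> i j; case: (hA i j).
by apply/matrixP => i j; rewrite mxE; case: (hA i j).
Qed.

Lemma intmxM m n p (A : 'M[F]_(m, n)) (B : 'M[F]_(n, p)) :
  intmx A -> intmx B -> intmx (A *m B).
Proof. by move=> hA hB; have [] := mx_reducesE (mx_reducesM (redmxP hA) (redmxP hB)). Qed.

Lemma redmxM m n p (A : 'M[F]_(m, n)) (B : 'M[F]_(n, p)) :
  intmx A -> intmx B -> redmx (A *m B) = redmx A *m redmx B.
Proof. by move=> hA hB; have [] := mx_reducesE (mx_reducesM (redmxP hA) (redmxP hB)). Qed.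

Lemma intmx1 n : @intmx n n 1%:M.
Proof. by have [] := mx_reducesE (@mx_reduces1 n). Qed.

Lemma redmx1 n : redmx (1%:M : 'M[F]_n) = 1%:M.
Proof. by have [] := mx_reducesE (@mx_reduces1 n). Qed.

Lemma intmx_tr m n (A : 'M[F]_(m, n)) : intmx A -> intmx A^T.
Proof. by move=> hA i j; rewrite mxE. Qed.

Lemma redmx_tr m n (A : 'M[F]_(m, n)) : redmx A^T = (redmx A)^T.
Proof. by apply/matrixP => i j; rewrite !mxE. Qed.

Lemma intmxZ m n a (A : 'M[F]_(m, n)) : integers a -> intmx A -> intmx (a *: A).
Proof. by move=> ha hA i j; rewrite mxE; apply: integersM. Qed.

Lemma redmx_piZ m n (A : 'M[F]_(m, n)) : intmx A -> redmx (pi *: A) = 0.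
Proof.
move=> hA; apply/matrixP => i j; rewrite !mxE.
by have [_ ->] := reductionDM integers_pi (hA i j); rewrite red_pi mul0r.
Qed.

Lemma redmx_eq0_div m n (A : 'M[F]_(m, n)) : intmx A -> redmx A = 0 -> intmx (pi^-1 *: A).
Proof.
move=> hA /matrixP A0 i j; rewrite mxE; apply: red_eq0_div => //.
by have := A0 i j; rewrite !mxE.
Qed.

Lemma integers_det n (A : 'M[F]_n) : intmx A -> integers (\det A).
Proof. by move=> hA; have [] := reduces_det (redmxP hA). Qed.

Lemma red_det n (A : 'M[F]_n) : intmx A -> red (\det A) = \det (redmx A).
Proof. by move=> hA; have [] := reduces_det (redmxP hA). Qed.

Lemma intmx_adj n (A : 'M[F]_n) : intmx A -> intmx (\adj A).
Proof. by move=> hA; have [] := mx_reducesE (mx_reduces_adj (redmxP hA)). Qed.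

Lemma redmx_lift m n (B : 'M[k]_(m, n)) : exists2 A, intmx A & redmx A = B.
Proof.
have /choice[f hf] : forall ij : 'I_m * 'I_n, exists x, reduces x (B ij.1 ij.2).
  by move=> [i j]; have [x ix rx] := reduction_surj (B i j); exists x.
exists (\matrix_(i, j) f (i, j)) => [i j|].
  by rewrite mxE; case: (hf (i, j)).
by apply/matrixP => i j; rewrite !mxE; case: (hf (i, j)).
Qed.

(** For d = 0 this is GL_n(O); for d = 1 it describes the sublattices of index q in O^n. *)
Definition intdet (d : int) n (A : 'M[F]_n) :=
  [/\ intmx A, \det A != 0 & ordv (\det A) = d].

Lemma intdet_unit d n (A : 'M[F]_n) : intdet d A -> A \in unitmx.
Proof. by case=> _ d0 _; rewrite unitmxE unitfE. Qed.

Lemma intdetM d d' n (A B : 'M[F]_n) : intdet d A -> intdet d' B ->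
  intdet (d + d') (A *m B).
Proof.
move=> [iA A0 oA] [iB B0 oB]; split; first exact: intmxM.
  by rewrite det_mulmx mulf_neq0.
by rewrite det_mulmx ordvM // oA oB.
Qed.

Lemma intdet1 n : @intdet 0 n 1%:M.
Proof. by split; [exact: intmx1|rewrite det1 oner_neq0|rewrite det1 ordv1]. Qed.

Lemma intdet_tr d n (A : 'M[F]_n) : intdet d A -> intdet d A^T.
Proof. by case=> iA A0 oA; split; rewrite ?det_tr //; exact: intmx_tr. Qed.

Lemma intdet_ge0 d n (A : 'M[F]_n) : intdet d A -> 0 <= d.
Proof. by case=> iA A0 <-; apply/(integersP A0)/integers_det. Qed.

Lemma intdet0V n (A : 'M[F]_n) : intdet 0 A -> intdet 0 (invmx A).
Proof.
move=> hA; have Au := intdet_unit hA; case: hA => iA A0 oA.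
split; rewrite ?det_inv ?invr_eq0 //; last by rewrite ordvV // oA.
rewrite /invmx Au; apply: intmxZ; last exact: intmx_adj.
by right; rewrite ordvV // oA.
Qed.

Lemma intdet_inv_int n (A : 'M[F]_n) : A \in unitmx -> intmx A -> intmx (invmx A) ->
  intdet 0 A.
Proof.
move=> Au iA iV; have A0 : \det A != 0 by rewrite -unitfE -unitmxE.
split=> //; have /(integersP A0) := integers_det iA.
have V0 : \det (invmx A) != 0 by rewrite det_inv invr_eq0.
have /(integersP V0) := integers_det iV.
by rewrite det_inv ordvV // => h1 h2; apply: le_anti; rewrite h2 -oppr_ge0 h1.
Qed.

Lemma intdet0_lift n (U : 'M[k]_n) : U \in unitmx -> exists2 A, intdet 0 A & redmx A = U.
Proof.
move=> Uu; have [A iA rA] := redmx_lift U; exists A => //.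
have : red (\det A) != 0 by rewrite red_det // rA -unitfE -unitmxE.
by move/(red_neq0 (integers_det iA)) => [? ?]; split.
Qed.

Lemma intdet_divl d d' n (A B : 'M[F]_n) : intdet d A -> B \in unitmx ->
  ordv (\det B) = d' -> intmx (invmx A *m B) -> intdet (d' - d) (invmx A *m B).
Proof.
move=> [iA A0 oA] Bu oB iAB.
have B0 : \det B != 0 by rewrite -unitfE -unitmxE.
by split=> //; rewrite det_mulmx det_inv ?mulf_neq0 ?invr_eq0 // ordvM ?invr_eq0 //
  ordvV // oA oB; lia.
Qed.

End Integers.

(** * Sublattices of index q and their planes in the residue space *)

Section LinkMatrices.
Variable F : local_field.
Local Notation k := (residue_field F).
Local Notation pi := (@uniformizer F).
Local Notation N1 := (@intdet F 1 3).
Local Notation GLO := (@intdet F 0 3).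

Lemma invmx_mul (K : comUnitRingType) n (A B : 'M[K]_n) :
  A \in unitmx -> B \in unitmx -> invmx (A *m B) = invmx B *m invmx A.
Proof.
move=> Au Bu; have ABu : A *m B \in unitmx by rewrite unitmx_mul Au.
by apply: (can_inj (mulKmx ABu)); rewrite mulmxV // mulmxA mulmxK // mulmxV.
Qed.

Lemma complete_row (K : fieldType) n (phi : 'rV[K]_n.+1) : phi != 0 ->
  exists2 U : 'M[K]_n.+1, U \in unitmx & row 0 U = phi.
Proof.
move=> phi0; have rk : \rank phi = 1%N by rewrite rank_rV phi0.
have := mulmx_ebase phi; rewrite rk; set c := col_ebase phi; set W := row_ebase phi.
move=> phiE; have c0 : c 0 0 != 0.
  by have := col_ebase_unit phi; rewrite unitmxE det_mx11 unitfE.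
exists (c 0 0 *: W).
  by rewrite unitmxE detZ unitrM -[X in _ && X]unitmxE row_ebase_unit andbT unitrX //
    unitfE.
rewrite -phiE [c in RHS]mx11_scalar -mulmxA mul_scalar_mx linearZ /=; congr (_ *: _).
rewrite rowE; congr (_ *m _); apply/rowP => j; rewrite !mxE eqxx /= ltnS leqn0.
by rewrite (eq_sym 0) eq_sym -val_eqE /= eq_sym; case: (nat_of_ord j).
Qed.

Let D : 'M[F]_3 := diag_mx (\row_i (if i == 0 then pi else 1)).

Let DN1 : N1 D.
Proof.
have detD : \det D = pi.
  rewrite det_diag (bigD1 0) //= mxE eqxx big1 ?mulr1 // => i /negPf i0.
  by rewrite mxE i0.
split; rewrite ?detD ?pi_neq0 ?ordv_pi // => i j; rewrite !mxE.
case: (i == j); rewrite ?mulr1n ?mulr0n; last exact: integers0.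
by case: (i == 0); [exact: integers_pi|exact: integers1].
Qed.

(** Take A in GL_3(O) whose first row reduces to phi, and n = A^{-1} diag(pi, 1, 1). The lattice of
    n consists of the integral vectors on which phi vanishes modulo pi, so it contains the columns
    of every integral m with phi m = 0 modulo pi. *)
Lemma plane_matrix (phi : 'rV[k]_3) : phi != 0 -> exists n : 'M[F]_3,
  [/\ N1 n,
      forall psi : 'rV[k]_3, psi *m redmx n = 0 <-> exists a, psi = a *: phi &
      forall m : 'M[F]_3, intmx m -> phi *m redmx m = 0 -> intmx (invmx n *m m)].
Proof.
move=> /complete_row[U Uu U0]; have [A hA rA] := intdet0_lift Uu.
have hV := intdet0V hA; have Au := intdet_unit hA.
have [iA _ _] := hA; have [iV _ _] := hV; have [iD _ _] := DN1.
have rV : redmx (invmx A) *m U = 1%:M by rewrite -rA -redmxM // mulVmx // redmx1.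
have rV' : redmx (invmx A) = invmx U.
  by rewrite -[LHS]mulmx1 -(mulmxV Uu) mulmxA rV mul1mx.
exists (invmx A *m D); split.
- by have := intdetM hV DN1; rewrite add0r.
- move=> psi; rewrite redmxM // rV' mulmxA.
  have DE (w : 'rV[k]_3) j : (w *m redmx D) 0 j = if j == 0 then 0 else w 0 j.
    rewrite mxE (bigD1 j) //= big1 ?addr0; last first.
      by move=> i /negPf ij; rewrite !mxE ij mulr0n red0 mulr0.
    rewrite !mxE eqxx mulr1n; case: (j == 0); first by rewrite red_pi mulr0.
    by rewrite reduction1 mulr1.
  split=> [psi0|[a ->]].
    set w := psi *m invmx U in psi0.
    exists (w 0 0); rewrite -U0 rowE scalemxAl.
    rewrite -[LHS](mulmxKV Uu) -/w; congr (_ *m _); apply/rowP => j.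
    rewrite [RHS]mxE [X in _ * X]mxE eqxx /=.
    case: eqVneq => [->|j0]; rewrite ?mulr1 ?mulr0 //.
    by have /matrixP/(_ 0 j) := psi0; rewrite DE (negPf j0) => ->; rewrite mxE.
  rewrite -U0 -scalemxAl -row_mul mulmxV //; apply/rowP => j; rewrite DE.
  case: eqVneq => [_|j0]; rewrite !mxE //.
  by rewrite eq_sym (negPf j0) mulr0.
- move=> m im phim.
  rewrite invmx_mul ?unitmx_inv ?(intdet_unit DN1) // invmxK.
  rewrite -mulmxA; set M := A *m m.
  have iM : intmx M by apply: intmxM.
  have key (X M' : 'M[F]_3) i j : D *m X = M' ->
      X i j = (if i == 0 then pi^-1 else 1) * M' i j.
    move=> <-; rewrite mul_diag_mx !mxE.
    by case: (i == 0); rewrite ?mul1r ?mulKf ?pi_neq0.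
  move=> i j; rewrite (key _ M) ?mulKVmx ?(intdet_unit DN1) //.
  case: eqVneq => [->|_]; last by rewrite mul1r.
  apply: red_eq0_div; first exact: iM.
  have /matrixP/(_ 0 j) : row 0 (redmx M) = 0.
    by rewrite redmxM // rA row_mul U0.
  by rewrite !mxE.
Qed.

Lemma intdet_pos_singular d (n : 'M[F]_3) : 0 < d -> intdet d n ->
  exists2 phi : 'rV[k]_3, phi != 0 & phi *m redmx n = 0.
Proof.
move=> d0 [iN n0 oN].
have /eqP/det0P[v v0 vn] : \det (redmx n) = 0.
  rewrite -red_det //; apply/(reduction_eq0 (integers_det iN)); right.
  by rewrite oN -gtz0_ge1.
by exists v.
Qed.

(** Both matrices are right multiples of the one of [plane_matrix], with quotients of determinant
    valuation 0: a sublattice of index q is determined by its plane. *)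
Lemma plane_matrix_eq (phi : 'rV[k]_3) n n' : phi != 0 -> N1 n -> N1 n' ->
  phi *m redmx n = 0 -> phi *m redmx n' = 0 -> exists2 u, GLO u & n' = n *m u.
Proof.
move=> /plane_matrix[n0 [hn0 _ H]] hn hn' pn pn'.
have n0u := intdet_unit hn0.
have div m : N1 m -> phi *m redmx m = 0 -> GLO (invmx n0 *m m).
  move=> hm pm; have [im _ om] := hm.
  by have := intdet_divl hn0 (intdet_unit hm) om (H _ im pm); rewrite subrr.
have h := div _ hn pn; have h' := div _ hn' pn'.
exists (invmx (invmx n0 *m n) *m (invmx n0 *m n')).
  by have := intdetM (intdet0V h) h'; rewrite addr0.
rewrite invmx_mul ?unitmx_inv ?(intdet_unit hn) // invmxK.
by rewrite !mulmxA mulmxV ?(intdet_unit hn) // mul1mx mulmxV // mul1mx.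
Qed.

Lemma plane_matrix_ker (phi psi : 'rV[k]_3) n : phi != 0 -> N1 n ->
  phi *m redmx n = 0 -> psi *m redmx n = 0 -> exists a, psi = a *: phi.
Proof.
move=> phi0 hn pn psin; have [n0 [hn0 K _]] := plane_matrix phi0.
apply/K.
have [u hu ->] := plane_matrix_eq phi0 hn hn0 pn ((K phi).2 (ex_intro _ 1 (esym
  (scale1r _)))).
have [iN _ _] := hn; have [iu _ _] := hu.
by rewrite redmxM // mulmxA psin mul0mx.
Qed.

(** Up to a unit, pi n^{-1} is the adjugate of n. If it reduced to 0, then n^{-1} would be integral
    and det n a unit. *)
Lemma N1_coadj n : N1 n -> intmx (pi *: invmx n) /\ redmx (pi *: invmx n) != 0.
Proof.
move=> hn; have nu := intdet_unit hn; have [iN n0 oN] := hn.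
have iX : intmx (pi *: invmx n).
  rewrite /invmx nu scalerA; apply: intmxZ; last exact: intmx_adj.
  by right; rewrite ordvM ?invr_eq0 ?pi_neq0 // ordvV // oN ordv_pi subrr.
split=> //; apply/eqP => r0.
have := redmx_eq0_div iX r0; rewrite scalerA mulVf ?pi_neq0 // scale1r => iV.
have := intdet_inv_int nu iN iV => -[_ _]; rewrite oN => /eqP; exact/negP.
Qed.

(** Modulo pi, the rows of pi n^{-1} are killed by n, hence are multiples of phi: the reduction has
    rank one. *)
Lemma N1_coadj_cols (phi : 'rV[k]_3) n : phi != 0 -> N1 n -> phi *m redmx n = 0 ->
  exists2 b : 'cV[k]_3, b != 0 & redmx (pi *: invmx n) = b *m phi.
Proof.
move=> phi0 hn pn; have [iX X0] := N1_coadj hn; have [iN _ _] := hn.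
have Xn : redmx (pi *: invmx n) *m redmx n = 0.
  by rewrite -redmxM // -scalemxAl mulVmx ?(intdet_unit hn) // redmx_piZ //; exact: intmx1.
have /choice[b hb] : forall i, exists a, row i (redmx (pi *: invmx n)) = a *: phi.
  move=> i; apply: (plane_matrix_ker phi0 hn pn).
  by rewrite -row_mul Xn linear0.
have E : redmx (pi *: invmx n) = (\col_i b i) *m phi.
  apply/row_matrixP => i; rewrite hb row_mul; apply/rowP => j.
  by rewrite !mxE big_ord1 !mxE.
exists (\col_i b i) => //.
by apply: contraNneq X0; rewrite E => ->; rewrite mul0mx.
Qed.

(* The vertex with plane phi and the vertex with line c of the link are incident
   iff phi vanishes on c. *)
Lemma incidence (phi : 'rV[k]_3) (c : 'cV[k]_3) n n' : phi != 0 -> c != 0 ->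
  N1 n -> N1 n' -> redmx n *m c = 0 -> phi *m redmx n' = 0 ->
  intmx (pi *: (invmx n' *m invmx n)) <-> phi *m c = 0.
Proof.
move=> phi0 c0 hn hn' nc pn'.
have [b b0 X'E] := N1_coadj_cols phi0 hn' pn'.
have ct0 : c^T != 0 by rewrite trmx_eq0.
have cn : c^T *m redmx n^T = 0 by rewrite redmx_tr -trmx_mul nc trmx0.
have [a' a0 XE] := N1_coadj_cols ct0 (intdet_tr hn) cn.
have [iX _] := N1_coadj hn; have [iX' _] := N1_coadj hn'.
have {}XE : redmx (pi *: invmx n) = c *m a'^T.
  apply: trmx_inj; rewrite trmx_mul trmxK -XE -redmx_tr linearZ /=.
  by rewrite trmx_inv.
set Y := pi *: _.
have YE : pi *: Y = (pi *: invmx n') *m (pi *: invmx n).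
  by rewrite /Y -scalemxAl -scalemxAr.
(* Both factors have rank one modulo pi, so the product is the scalar phi c times the nonzero matrix
   b a'^T: it vanishes exactly when phi c does. *)
have rY : redmx (pi *: Y) = (phi *m c) 0 0 *: (b *m a'^T).
  rewrite YE redmxM // X'E XE -mulmxA (mulmxA phi); set s := (phi *m c) 0 0.
  by rewrite [phi *m c]mx11_scalar mul_scalar_mx -scalemxAr.
have ba0 : b *m a'^T != 0.
  have /cV0Pn[i bi] := b0; have /cV0Pn[j aj] := a0.
  apply/eqP => /matrixP/(_ i j); rewrite !mxE big_ord1 mxE => /eqP.
  by rewrite mulf_eq0 (negPf bi) (negPf aj).
split=> [iY|pc].
  have /eqP := redmx_piZ iY; rewrite rY scaler_eq0 (negPf ba0) orbF => /eqP pc.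
  by rewrite [LHS]mx11_scalar pc; apply/matrixP => i j; rewrite !mxE mul0rn.
have iPY : intmx (pi *: Y) by rewrite YE; apply: intmxM.
have r0 : redmx (pi *: Y) = 0 by rewrite rY pc mxE scale0r.
by have := redmx_eq0_div iPY r0; rewrite scalerA mulVf ?pi_neq0 // scale1r.
Qed.

End LinkMatrices.

Section Vertices.
Variable F : local_field.
Local Notation k := (residue_field F).
Local Notation pi := (@uniformizer F).
Local Notation N1 := (@intdet F 1 3).
Local Notation GLO := (@intdet F 0 3).
Implicit Types g h : 'M[F]_3.

Lemma lattice_sub g h : g \in unitmx ->
  lattice_of h `<=` lattice_of g <-> intmx (invmx g *m h).
Proof.
move=> gu; split=> [sub i j|ih _ [x ix <-]].
  have [y iy gy] : lattice_of g (col j h).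
    apply: sub; exists (delta_mx j 0); last by rewrite -colE.
    by move=> l; rewrite mxE andbT; case: (_ == _); [exact: integers1|exact: integers0].
  have <- : col j (invmx g *m h) i 0 = (invmx g *m h) i j by rewrite mxE.
  by rewrite colE -mulmxA -colE -gy mulKmx.
exists (invmx g *m h *m x); last by rewrite -mulmxA mulKVmx.
by move=> i; apply: intmxM => // a b; rewrite ord1.
Qed.

Lemma lattice_eq g h : g \in unitmx -> h \in unitmx ->
  lattice_of g = lattice_of h <-> GLO (invmx g *m h).
Proof.
move=> gu hu; have ghu : invmx g *m h \in unitmx by rewrite unitmx_mul unitmx_inv gu.
have E : invmx (invmx g *m h) = invmx h *m g by rewrite invmx_mul ?unitmx_inv // invmxK.
split=> [eq|H].
  apply: intdet_inv_int => //; first by apply/(lattice_sub h gu); rewrite eq.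
  by rewrite E; apply/(lattice_sub g hu); rewrite eq.
have [iH _ _] := H; have := intdet0V H; rewrite E => -[iV _ _].
by apply/seteqP; split; [apply/(lattice_sub g hu)|apply/(lattice_sub h gu)].
Qed.

Lemma latticeZ (c : F) g :
  lattice_of (c *: g) = [set c *: x | x in lattice_of g].
Proof.
apply/seteqP; split=> [_ [x ix <-]|_ [_ [x ix <-] <-]].
  by exists (g *m x); [exists x|rewrite scalemxAl].
by exists x => //; rewrite scalemxAl.
Qed.

Definition same_class g h := exists c u, [/\ c != 0, GLO u & h = c *: (g *m u)].

Lemma unitmxZ (c : F) g : c != 0 -> (c *: g \in unitmx) = (g \in unitmx).
Proof. by move=> c0; rewrite !unitmxE detZ unitrM unitrX ?unitfE. Qed.

Lemma lattice_class_eq g h : g \in unitmx -> h \in unitmx ->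
  lattice_class g = lattice_class h <-> same_class g h.
Proof.
move=> gu hu; split=> [eq|[c [u [c0 hU ->]]]].
  have : lattice_class g (lattice_of h).
    by rewrite eq; exists 1; [rewrite /= oner_neq0|rewrite scale1r].
  move=> [c /= c0 cE]; exists c, (invmx (c *: g) *m h); split=> //.
    by apply/lattice_eq; rewrite ?unitmxZ.
  by rewrite scalemxAl mulKVmx // unitmxZ.
have uu := intdet_unit hU.
have key a : a != 0 -> lattice_of (a *: g) = lattice_of (a *: (g *m u)).
  move=> a0; apply/lattice_eq; rewrite ?unitmxZ ?unitmx_mul ?gu //.
  by rewrite scalemxAl mulKmx ?unitmxZ.
apply/seteqP; split=> [_ [a /= a0 <-]|_ [a /= a0 <-]].
  exists (a / c); first by rewrite /= mulf_neq0 // invr_eq0.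
  by rewrite scalerA divfK // -key.
exists (a * c); first by rewrite /= mulf_neq0.
by rewrite scalerA key // mulf_neq0.
Qed.

Lemma lattice_class_mem g : g \in unitmx -> lattice_class g \in @lattice_classes F.
Proof. by move=> gu; rewrite inE; exists g. Qed.

Definition cls g : vertex F :=
  insubd (exist (fun c => c \in @lattice_classes F) _
    (lattice_class_mem (unitmx1 F 3)) : vertex F) (lattice_class g).

Lemma val_cls g : g \in unitmx -> val (cls g) = lattice_class g.
Proof. by move=> gu; rewrite val_insubd lattice_class_mem. Qed.

Lemma cls_surj (v : vertex F) : exists2 g, g \in unitmx & v = cls g.
Proof.
have := valP v; rewrite inE => -[g gu gE]; exists g => //.
by apply: val_inj; rewrite val_cls.
Qed.

Lemma cls_eq g h : g \in unitmx -> h \in unitmx -> cls g = cls h <-> same_class g h.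
Proof.
move=> gu hu; rewrite -lattice_class_eq //; split=> [E|E].
  by rewrite -!val_cls // E.
by apply: val_inj; rewrite !val_cls.
Qed.

Lemma cls_mulr g u : g \in unitmx -> GLO u -> cls (g *m u) = cls g.
Proof.
move=> gu hu; apply/esym/cls_eq; rewrite ?unitmx_mul ?gu ?(intdet_unit hu) //.
by exists 1, u; rewrite oner_neq0 scale1r.
Qed.

Lemma cls_scale g (c : F) : g \in unitmx -> c != 0 -> cls (c *: g) = cls g.
Proof.
move=> gu c0; apply/esym/cls_eq; rewrite ?unitmxZ //.
by exists c, 1%:M; rewrite mulmx1; split=> //; exact: intdet1.
Qed.

Lemma act_cls g h : g \in unitmx -> h \in unitmx -> act g (cls h) = cls (g *m h).
Proof.
move=> gu hu; apply: val_inj; rewrite val_cls ?unitmx_mul ?gu // /act.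
have -> : [set [set g *m x | x in L] | L in val (cls h)] = lattice_class (g *m h).
  have E (c : F) : [set g *m x | x in lattice_of (c *: h)] = lattice_of (c *: (g *m h)).
    apply/seteqP; split=> [_ [_ [x ix <-] <-]|_ [x ix <-]].
      by exists x => //; rewrite mulmxA -scalemxAr.
    by exists (c *: h *m x); [exists x|rewrite mulmxA -scalemxAr].
  rewrite val_cls //; apply/seteqP; split=> [_ [_ [c c0 <-] <-]|_ [c c0 <-]].
    by exists c => //; rewrite E.
  by exists (lattice_of (c *: h)); [exists c|rewrite E].
by rewrite val_insubd lattice_class_mem // unitmx_mul gu.
Qed.

Lemma color_cls g : g \in unitmx -> color (cls g) = (ordv (\det g))%:~R.
Proof.
move=> gu; rewrite /color; case: xgetP => [h _ [hu]|/(_ g)[]]; last first.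
  by split=> //; rewrite val_cls.
rewrite val_cls // => /(lattice_class_eq hu gu)[c [u [c0 [iu u0 ou] ->]]].
have h0 : \det h != 0 by rewrite -unitfE -unitmxE.
rewrite detZ det_mulmx ordvM ?expf_neq0 ?mulf_neq0 // ordvX // ordvM // ou addr0.
by rewrite mulrSr intrD -mulrSr rmorphMn /= -mulr_natr (_ : 3%:R = 0 :> 'Z_3) ?mulr0
  ?add0r //; apply/val_inj.
Qed.

End Vertices.

(** * Edges of color one and the links of vertices *)

Section Links.
Variable F : local_field.
Local Notation k := (residue_field F).
Local Notation pi := (@uniformizer F).
Local Notation N1 := (@intdet F 1 3).
Local Notation GLO := (@intdet F 0 3).
Implicit Types (g h n : 'M[F]_3) (v w : vertex F).

(** The edges of color one, as [adjacent_color] shows, given by matrices instead of nested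
    lattices. *)
Definition edge1 v w :=
  exists g n, [/\ g \in unitmx, N1 n, v = cls g & w = cls (g *m n)].

Lemma intdetZ d m (c : F) (A : 'M[F]_m) : intdet d A -> c != 0 -> ordv c = 0 ->
  intdet d (c *: A).
Proof.
case=> iA A0 oA c0 oc; split.
- by apply: intmxZ => //; right; rewrite oc.
- by rewrite detZ mulf_neq0 ?expf_neq0.
- by rewrite detZ ordvM ?expf_neq0 // ordvX // oc mul0rn add0r.
Qed.

Lemma same_class_intdet d n n' u (c : F) : intdet d n -> intdet d n' -> GLO u ->
  c != 0 -> n' = c *: (n *m u) -> c != 0 /\ ordv c = 0.
Proof.
move=> [_ n0 on] [_ n0' on'] [_ u0 ou] c0 n'E; split=> //.
have := on'; rewrite n'E detZ det_mulmx ordvM ?mulf_neq0 ?expf_neq0 // ordvX //.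
by rewrite ordvM // on ou; lia.
Qed.

Lemma edge1_out g w : g \in unitmx ->
  edge1 (cls g) w <-> exists2 n, N1 n & w = cls (g *m n).
Proof.
move=> gu; split=> [[g' [n [g'u hn /(cls_eq gu g'u)[c [u [c0 hu ->]]] ->]]]|[n hn ->]];
  last by exists g, n.
exists (u *m n); first by have := intdetM hu hn; rewrite add0r.
rewrite -scalemxAl cls_scale // ?mulmxA // !unitmx_mul gu.
by rewrite (intdet_unit hu) (intdet_unit hn).
Qed.

Lemma edge1_in g u : g \in unitmx ->
  edge1 u (cls g) <-> exists2 n, N1 n & u = cls (g *m invmx n).
Proof.
move=> gu; split=> [[g' [n [g'u hn -> E]]]|[n hn ->]]; last first.
  exists (g *m invmx n), n; split=> //; last by rewrite mulmxKV ?(intdet_unit hn).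
  by rewrite unitmx_mul gu unitmx_inv (intdet_unit hn).
have nu := intdet_unit hn; have g'nu : g' *m n \in unitmx by rewrite unitmx_mul g'u.
have /esym/(cls_eq g'nu gu)[c [x [c0 hx gE]]] := E.
have xu := intdet_unit hx.
exists (n *m x); first by have := intdetM hn hx; rewrite addr0.
rewrite gE -mulmxA -scalemxAl mulmxK ?unitmx_mul ?nu //.
by rewrite cls_scale.
Qed.

Lemma color_edge1 v w : edge1 v w -> color w = color v + 1.
Proof.
move=> [g [n [gu hn -> ->]]]; have nu := intdet_unit hn; case: hn => _ n0 on.
rewrite !color_cls ?unitmx_mul ?gu // det_mulmx ordvM ?on ?intrD //.
by rewrite -unitfE -unitmxE.
Qed.

Lemma lattice_proper g h : g \in unitmx -> h \in unitmx ->
  lattice_of h `<` lattice_of g <->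
  intmx (invmx g *m h) /\ ordv (\det g) < ordv (\det h).
Proof.
move=> gu hu; have g0 : \det g != 0 by rewrite -unitfE -unitmxE.
have h0 : \det h != 0 by rewrite -unitfE -unitmxE.
have oI : ordv (\det (invmx g *m h)) = ordv (\det h) - ordv (\det g).
  by rewrite det_mulmx det_inv ordvM ?invr_eq0 // ordvV // addrC.
have d0 : \det (invmx g *m h) != 0 by rewrite det_mulmx det_inv mulf_neq0 ?invr_eq0.
split=> [[/(lattice_sub h gu) iH nsub]|[iH lt_gh]].
  split=> //; have /(integersP d0) := integers_det iH; rewrite oI subr_ge0.
  rewrite le_eqVlt => /orP[/eqP e|//]; case: nsub.
  suff -> : lattice_of g = lattice_of h by [].
  by apply/(lattice_eq gu hu); split=> //; rewrite oI e subrr.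
split; first exact/(lattice_sub h gu).
move=> sub; have /(lattice_eq gu hu)[_ _] : lattice_of g = lattice_of h.
  by apply/seteqP; split=> //; apply/(lattice_sub h gu).
by rewrite oI => e; move: lt_gh; rewrite -subr_gt0 e ltxx.
Qed.

Lemma edge1_neq v w : edge1 v w -> v <> w.
Proof.
move=> e E; have := color_edge1 e; rewrite E => /eqP.
by rewrite -subr_eq0 opprD addNKr oppr_eq0.
Qed.

Lemma edge1_lattices g n : g \in unitmx -> N1 n ->
  [set pi *: x | x in lattice_of g] `<` lattice_of (g *m n) /\
  lattice_of (g *m n) `<` lattice_of g.
Proof.
move=> gu hn; have nu := intdet_unit hn;
  have gnu : g *m n \in unitmx by rewrite unitmx_mul gu.
have pgu : pi *: g \in unitmx by rewrite unitmxZ ?pi_neq0.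
have [iN n0 on] := hn; have [iX _] := N1_coadj hn.
have g0 : \det g != 0 by rewrite -unitfE -unitmxE.
have ogn : ordv (\det (g *m n)) = ordv (\det g) + 1 by rewrite det_mulmx ordvM // on.
rewrite -latticeZ; split; apply/lattice_proper => //; split.
- by rewrite invmx_mul // -scalemxAr mulmxKV.
- rewrite ogn detZ ordvM ?expf_neq0 ?pi_neq0 // ordvX ?pi_neq0 // ordv_pi.
  by rewrite addrC ltrD2r.
- by rewrite mulKmx.
- by rewrite ogn ltrDl.
Qed.

Lemma adjacent_sym_edge v w : edge1 v w -> adjacent v w /\ adjacent w v.
Proof.
move=> e; have vw := edge1_neq e; case: e => g [n [gu hn vE wE]].
have nu := intdet_unit hn; have gnu : g *m n \in unitmx by rewrite unitmx_mul gu.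
have [h1 h2] := edge1_lattices gu hn.
have wv : w <> v by move/esym.
split; split=> //.
- exists (lattice_of g), (lattice_of (g *m n)); split=> //.
    by rewrite vE val_cls //; exists 1; rewrite /= ?oner_neq0 ?scale1r.
  by rewrite wE val_cls //; exists 1; rewrite /= ?oner_neq0 ?scale1r.
- exists (lattice_of (g *m n)), (lattice_of (pi *: g)); split.
  + by rewrite wE val_cls //; exists 1; rewrite /= ?oner_neq0 ?scale1r.
  + by rewrite vE val_cls //; exists pi; rewrite /= ?pi_neq0.
  + rewrite latticeZ; split; first by move=> _ [x hx <-]; exists x => //; apply: h2.1.
    move=> sub; apply: h2.2 => x hx.
    have [|y hy /(scalerI (pi_neq0 F)) <- //] := sub (pi *: x).
    by exists x.
  + by rewrite latticeZ.
Qed.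

(** The inclusions pi L < L' < L leave two possible indices: q gives an edge from v to w, and q^2
    gives an edge from w to the class of pi L, which is v. *)
Lemma adjacentP v w : adjacent v w <-> edge1 v w \/ edge1 w v.
Proof.
split=> [|[/adjacent_sym_edge[]|/adjacent_sym_edge[]]//].
case=> _ [L [L' [vL wL' sub1 sub2]]].
have [g0 g0u vE] := cls_surj v; have [h0 h0u wE] := cls_surj w.
move: vL wL'; rewrite vE wE !val_cls // => -[c c0 LE] [c' c0' LE'].
have : exists2 g, g \in unitmx & cls g0 = cls g /\ L = lattice_of g.
  by exists (c *: g0); [rewrite unitmxZ|split=> //; rewrite cls_scale].
have : exists2 h, h \in unitmx & cls h0 = cls h /\ L' = lattice_of h.
  by exists (c' *: h0); [rewrite unitmxZ|split=> //; rewrite cls_scale].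
move=> [h hu [-> {}LE']] [g gu [-> {}LE]] {c c0 c' c0' vE wE g0 g0u h0 h0u}.
have pgu : pi *: g \in unitmx by rewrite unitmxZ ?pi_neq0.
have dg0 : \det g != 0 by rewrite -unitfE -unitmxE.
rewrite LE LE' -latticeZ in sub1 sub2.
have [iY] := (lattice_proper hu pgu).1 sub1; have [iX ltgh] :=
  (lattice_proper gu hu).1 sub2.
have op : ordv (\det (pi *: g)) = ordv (\det g) + 3.
  rewrite detZ ordvM ?expf_neq0 ?pi_neq0 // ordvX ?pi_neq0 // ordv_pi addrC.
  by congr (_ + _).
rewrite op => lthg.
have [h1|h2] : ordv (\det h) = ordv (\det g) + 1 \/ ordv (\det h) = ordv (\det g) + 2.
  move: ltgh lthg; move: (ordv _) (ordv _) => x y; lia.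
- left; apply/(edge1_out _ gu); exists (invmx g *m h); last by rewrite mulKVmx.
  have [_ d0 _] : intdet 0 (1%:M : 'M[F]_3) by exact: intdet1.
  split=> //; first by rewrite det_mulmx det_inv mulf_neq0 ?invr_eq0 // -unitfE -unitmxE.
  by rewrite det_mulmx det_inv ordvM ?invr_eq0 -?unitfE -?unitmxE // ordvV // h1 addrC
    addrAC subrr add0r.
- right; have <- : cls (pi *: g) = cls g by rewrite cls_scale ?pi_neq0.
  apply/(edge1_out _ hu); exists (invmx h *m (pi *: g)); last by rewrite mulKVmx.
  have dh0 : \det h != 0 by rewrite -unitfE -unitmxE.
  have dp0 : \det (pi *: g) != 0 by rewrite -unitfE -unitmxE.
  split=> //; first by rewrite det_mulmx det_inv mulf_neq0 ?invr_eq0.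
  by rewrite det_mulmx det_inv ordvM ?invr_eq0 // ordvV // h2 op; lia.
Qed.

Lemma adjacent_color v w : (adjacent v w /\ color w - color v = 1) <-> edge1 v w.
Proof.
split=> [[/adjacentP[//|e]]|e].
  rewrite (color_edge1 e) opprD addNKr => /eqP.
  by rewrite -subr_eq0 -opprD oppr_eq0.
by split; [have [] := adjacent_sym_edge e|rewrite (color_edge1 e) addrC addKr].
Qed.

Lemma edge1_asym v w : edge1 v w -> ~ edge1 w v.
Proof.
move=> /color_edge1 e /color_edge1; rewrite e -addrA => /eqP.
by rewrite eq_sym addrC -subr_eq0 addrK.
Qed.

Definition plane_mx (phi : 'rV[k]_3) : 'M[F]_3 :=
  xget 1%:M [set n | N1 n /\ phi *m redmx n = 0].

Lemma plane_mxP phi : phi != 0 -> N1 (plane_mx phi) /\ phi *m redmx (plane_mx phi) = 0.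
Proof.
move=> phi0; rewrite /plane_mx; case: xgetP => [n _ //|].
have [n [hn H _]] := plane_matrix phi0.
by move=> /(_ n)[]; split=> //; apply/H; exists 1; rewrite scale1r.
Qed.

(** In the coordinates g, successors correspond to planes, given by a linear form phi, and
    predecessors to lines, spanned by the column psi^T. Both are indexed by row vectors up to
    scalars, so that one count of projective points serves for the two. *)
Definition plane_vertex g (phi : 'rV[k]_3) := cls (g *m plane_mx phi).
Definition line_vertex g (psi : 'rV[k]_3) := cls (g *m invmx (plane_mx psi)^T).

Lemma plane_vertex_edge g phi : g \in unitmx -> phi != 0 ->
  edge1 (cls g) (plane_vertex g phi).
Proof. by move=> gu /plane_mxP[hn _]; apply/edge1_out => //; exists (plane_mx phi). Qed.

Lemma line_vertex_edge g psi : g \in unitmx -> psi != 0 ->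
  edge1 (line_vertex g psi) (cls g).
Proof.
move=> gu /plane_mxP[hn _]; apply/edge1_in => //.
by exists (plane_mx psi)^T => //; apply: intdet_tr.
Qed.

Lemma plane_vertexP g phi n : g \in unitmx -> phi != 0 -> N1 n ->
  cls (g *m n) = plane_vertex g phi <-> phi *m redmx n = 0.
Proof.
move=> gu phi0 hn; have [hm pm] := plane_mxP phi0; rewrite /plane_vertex;
  move: (plane_mx phi) hm pm => m hm pm.
have nu := intdet_unit hn; have mu := intdet_unit hm.
have gnu : g *m n \in unitmx by rewrite unitmx_mul gu.
have gmu : g *m m \in unitmx by rewrite unitmx_mul gu.
split=> [/esym/(cls_eq gmu gnu)[c [u [c0 hu E]]]|pn].
  have {}E : n = c *: (m *m u).
    by rewrite -[LHS](mulKmx gu) E -scalemxAr -mulmxA mulKmx.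
  have [_ oc] := same_class_intdet hm hn hu c0 E.
  have [im _ _] := hm; have [icu _ _] := intdetZ hu c0 oc.
  by rewrite E scalemxAr redmxM // mulmxA pm mul0mx.
have [u hu ->] := plane_matrix_eq phi0 hm hn pm pn.
by rewrite mulmxA cls_mulr.
Qed.

Lemma line_vertexP g psi n : g \in unitmx -> psi != 0 -> N1 n ->
  cls (g *m invmx n) = line_vertex g psi <-> psi *m redmx n^T = 0.
Proof.
move=> gu psi0 hn; have [hm pm] := plane_mxP psi0; rewrite /line_vertex;
  move: (plane_mx psi) hm pm => m hm pm.
have nu := intdet_unit hn; have mu := intdet_unit hm.
have mtu : m^T \in unitmx by rewrite unitmx_tr.
have gnu : g *m invmx n \in unitmx by rewrite unitmx_mul gu unitmx_inv.
have gmu : g *m invmx m^T \in unitmx by rewrite unitmx_mul gu unitmx_inv.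
split=> [/(cls_eq gnu gmu)[c [u [c0 hu E]]]|pn].
  have uu := intdet_unit hu.
  have {}E : n^T = c *: (m *m u^T).
    have : invmx m^T = c *: (invmx n *m u).
      by rewrite -[LHS](mulKmx gu) E -scalemxAr -mulmxA mulKmx.
    move=> /(congr1 (fun X => n *m X *m m^T)).
    rewrite -mulmxA mulVmx // mulmx1 -scalemxAr mulKVmx // => ->.
    by rewrite -scalemxAl linearZ /= trmx_mul trmxK.
  have [_ oc] := same_class_intdet hm (intdet_tr hn) (intdet_tr hu) c0 E.
  have [im _ _] := hm; have [icu _ _] := intdetZ (intdet_tr hu) c0 oc.
  by rewrite E scalemxAr redmxM // mulmxA pm mul0mx.
have [u hu E] := plane_matrix_eq psi0 hm (intdet_tr hn) pm pn.
have {}E : n = u^T *m m^T by rewrite -[LHS]trmxK E trmx_mul.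
have uu := intdet_unit (intdet_tr hu).
rewrite E invmx_mul // mulmxA cls_mulr //; first by exact/intdet0V/intdet_tr.
Qed.

Lemma plane_vertex_surj g w : g \in unitmx -> edge1 (cls g) w ->
  exists2 phi, phi != 0 & w = plane_vertex g phi.
Proof.
move=> gu /(edge1_out _ gu)[n hn ->].
have [phi phi0 pn] := intdet_pos_singular ltr01 hn.
by exists phi => //; apply/plane_vertexP.
Qed.

Lemma line_vertex_surj g u : g \in unitmx -> edge1 u (cls g) ->
  exists2 psi, psi != 0 & u = line_vertex g psi.
Proof.
move=> gu /(edge1_in _ gu)[n hn ->].
have [psi psi0 pn] := intdet_pos_singular ltr01 (intdet_tr hn).
by exists psi => //; apply/line_vertexP.
Qed.

Lemma plane_vertex_eq g phi psi : g \in unitmx -> phi != 0 -> psi != 0 ->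
  plane_vertex g phi = plane_vertex g psi <-> exists a, psi = a *: phi.
Proof.
move=> gu phi0 psi0; have [hm pm] := plane_mxP phi0.
rewrite plane_vertexP //; split=> [|[a ->]]; first exact: plane_matrix_ker pm.
by rewrite -scalemxAl pm scaler0.
Qed.

Lemma line_vertex_eq g phi psi : g \in unitmx -> phi != 0 -> psi != 0 ->
  line_vertex g phi = line_vertex g psi <-> exists a, psi = a *: phi.
Proof.
move=> gu phi0 psi0; have [hm pm] := plane_mxP phi0.
rewrite line_vertexP ?trmxK //; last exact: intdet_tr.
split=> [|[a ->]]; first exact: plane_matrix_ker pm.
by rewrite -scalemxAl pm scaler0.
Qed.

(** The passage from the first vertex to the second is m^{-1} n^{-T} up to scalars. Times pi, its
    determinant has valuation 3 - 1 - 1 = 1 automatically, so only integrality is at stake, and that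
    is [incidence]. *)
Lemma edge1_plane_line g phi psi : g \in unitmx -> phi != 0 -> psi != 0 ->
  edge1 (plane_vertex g phi) (line_vertex g psi) <-> phi *m psi^T = 0.
Proof.
move=> gu phi0 psi0; have [hm pm] := plane_mxP phi0; have [hn pn] := plane_mxP psi0.
rewrite /plane_vertex /line_vertex; move: (plane_mx phi) (plane_mx psi) hm pm hn pn =>
  m n hm pm hn pn.
have mu := intdet_unit hm; have nu := intdet_unit hn.
have ntu : n^T \in unitmx by rewrite unitmx_tr.
have gmu : g *m m \in unitmx by rewrite unitmx_mul gu.
have gnu : g *m invmx n^T \in unitmx by rewrite unitmx_mul gu unitmx_inv.
have npsi : redmx n^T *m psi^T = 0 by rewrite redmx_tr -trmx_mul pn trmx0.
have psit0 : psi^T != 0 by rewrite trmx_eq0.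
rewrite -(incidence phi0 psit0 (intdet_tr hn) hm npsi pm).
have [_ m0 om] := hm; have [_ n0 on] := intdet_tr hn.
split=> [/(edge1_out _ gmu)[x hx E]|iX].
  have gmxu : g *m m *m x \in unitmx by rewrite unitmx_mul gmu (intdet_unit hx).
  have [c [u [c0 hu {}E]]] := (cls_eq gmxu gnu).1 (esym E).
  have uu := intdet_unit hu.
  have {}E : invmx m *m invmx n^T = c *: (x *m u).
    have : invmx n^T = c *: (m *m x *m u).
      by rewrite -[LHS](mulKmx gu) E -scalemxAr -!mulmxA mulKmx.
    by move=> ->; rewrite -scalemxAr -!mulmxA mulKmx.
  have [ixu xu0 oxu] := intdetM hx hu.
  (* Comparing determinants: 3 ord(c) + 1 = -2. *)
  have oc : ordv c = -1.
    have := congr1 (fun X => ordv (\det X)) E.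
    rewrite det_mulmx !det_inv detZ.
    move: m0 om n0 on xu0 oxu.
    move: (\det m) (\det n^T) (\det (x *m u)) => a b e a0 oa b0 ob e0 oe.
    rewrite ordvM ?invr_eq0 // (ordvV a0) (ordvV b0) oa ob.
    rewrite ordvM ?expf_neq0 // ordvX // oe.
    by move: (ordv c) => z; clear; lia.
  rewrite E scalerA; apply: intmxZ => //.
  by right; rewrite ordvM ?pi_neq0 // ordv_pi oc.
apply/(edge1_out _ gmu); exists (pi *: (invmx m *m invmx n^T)).
  suff [] : \det (pi *: (invmx m *m invmx n^T)) != 0 /\
            ordv (\det (pi *: (invmx m *m invmx n^T))) = 1 by [].
  rewrite detZ det_mulmx !det_inv.
  move: m0 om n0 on; move: (\det m) (\det n^T) => a b a0 oa b0 ob.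
  have ab0 : a^-1 * b^-1 != 0 by rewrite mulf_neq0 ?invr_eq0.
  split; first by rewrite mulf_neq0 ?expf_neq0 ?pi_neq0.
  rewrite ordvM ?expf_neq0 ?pi_neq0 // ordvX ?pi_neq0 // ordv_pi.
  by rewrite ordvM ?invr_eq0 // (ordvV a0) (ordvV b0) oa ob.
by rewrite -scalemxAr mulmxA mulmxK // cls_scale ?pi_neq0.
Qed.

(** An integral matrix of determinant valuation d is a product of d factors in [N1] and a unit: any
    linear form killed by its reduction gives a factor to split off on the left. This is also the
    connectedness of the building by edges of color one. *)
Lemma edge1_path (C : comNzRingType) (zeta : C) (f : vertex F -> C) g m (d : nat) :
  (forall v w, edge1 v w -> f w = zeta * f v) ->
  g \in unitmx -> intdet d%:Z m -> f (cls (g *m m)) = zeta ^+ d * f (cls g).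
Proof.
move=> hf; elim: d g m => [|d IH] g m gu hm.
  by rewrite cls_mulr // expr0 mul1r.
have [phi phi0 pm] := intdet_pos_singular (isT : 0 < d.+1%:Z) hm.
have [n [hn _ H]] := plane_matrix phi0; have nu := intdet_unit hn.
have [im m0 om] := hm.
have hm' : intdet d%:Z (invmx n *m m).
  have := intdet_divl hn (intdet_unit hm) om (H _ im pm).
  by rewrite intS addrAC subrr add0r.
have -> : g *m m = g *m n *m (invmx n *m m) by rewrite -mulmxA mulKVmx.
rewrite IH ?unitmx_mul ?gu //.
rewrite exprSr -mulrA -(hf (cls g) (cls (g *m n))) //.
by apply/(edge1_out _ gu); exists n.
Qed.

End Links.

(** * Counting points and lines of a projective plane over a finite field *)

Section ProjectiveCounting.
Variable k : finFieldType.
Local Notation q := #|k|.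

Definition proj_points (T : eqType) n (p : 'rV[k]_n -> T) : seq T :=
  undup [seq p phi | phi <- enum [pred phi : 'rV[k]_n | phi != 0]].

Definition proj_map (T : eqType) n (p : 'rV[k]_n -> T) :=
  forall phi psi, phi != 0 -> psi != 0 -> p phi = p psi <-> exists a, psi = a *: phi.

Lemma proj_points_uniq (T : eqType) n (p : 'rV[k]_n -> T) : uniq (proj_points p).
Proof. exact: undup_uniq. Qed.

Lemma mem_proj_points (T : eqType) n (p : 'rV[k]_n -> T) t :
  t \in proj_points p <-> exists2 phi, phi != 0 & t = p phi.
Proof.
rewrite mem_undup; split=> [/mapP[phi]|[phi phi0 ->]].
  by rewrite mem_enum => ? ->; exists phi.
by apply: map_f; rewrite mem_enum.
Qed.

(** Double counting of the pairs (phi, t) with p phi = t: each fiber consists of the q - 1 nonzero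
    multiples of one vector. *)
Lemma count_proj_points (T : eqType) n (p : 'rV[k]_n -> T) (P : pred T) : proj_map p ->
  (q.-1 * count P (proj_points p) = #|[pred phi : 'rV[k]_n | (phi != 0%R) && P (p phi)]|)%N.
Proof.
move=> pP; rewrite -[RHS]sum1_card -sum1_count big_distrr /=.
transitivity (\sum_(phi : 'rV[k]_n | phi != 0%R) \sum_(t <- proj_points p | P t && (p
  phi == t)) 1)%N; last first.
  rewrite [RHS]big_mkcondr; apply: eq_bigr => phi phi0.
  rewrite sum1_count; case: ifP => Pp.
    rewrite (eq_count (a2 := pred1 (p phi))).
      by rewrite count_uniq_mem ?proj_points_uniq // (mem_proj_points p _).2 //; exists phi.
    by move=> t /=; case: eqVneq => [<-|]; rewrite ?Pp ?eqxx ?andbF // eq_sym => /negPf.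
  rewrite (eq_count (a2 := pred0)) ?count_pred0 // => t /=.
  by case: eqVneq => [<-|]; rewrite ?Pp ?andbF.
rewrite (exchange_big_dep P) /=; last by move=> phi t _ /andP[].
rewrite big_seq_cond [RHS]big_seq_cond; apply: eq_bigr =>
  t /andP[/mem_proj_points[psi psi0 ->] Pt].
rewrite Pt /= muln1.
rewrite sum1_card.
have -> : q.-1 = #|([set a *: psi | a in [set~ (0 : k)]])%SET|.
  rewrite card_imset ?cardsC1 //.
  by move=> a b /eqP; rewrite -subr_eq0 -scalerBl scaler_eq0 (negPf psi0) orbF subr_eq0
    => /eqP.
apply: eq_card => phi; rewrite [RHS]unfold_in; apply/imsetP/andP =>
  [[a]|[phi0 /eqP/esym/pP-/(_ psi0 phi0)[a E]]].
  rewrite !inE => a0 ->; have ap0 : a *: psi != 0 by rewrite scaler_eq0 (negPf a0).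
  by split=> //; apply/eqP/esym/pP => //; exists a.
by exists a => //; rewrite !inE; apply: contraNneq phi0 => a0; rewrite E a0 scale0r.
Qed.

Lemma card_row_ker n m (A : 'M[k]_(n, m)) :
  #|[pred phi : 'rV[k]_n | (phi != 0) && (phi *m A == 0)]| = (q ^ (n - \rank A)).-1%N.
Proof.
have -> : (q ^ (n - \rank A))%N = #|[pred phi : 'rV[k]_n | phi *m A == 0]|.
  rewrite -mxrank_ker -card_rowg; apply: eq_card => phi.
  by rewrite mem_rowg inE (sameP sub_kermxP eqP).
rewrite (cardD1 0 [pred phi | phi *m A == 0]) inE mul0mx eqxx /=.
by apply: eq_card => phi; rewrite !inE.
Qed.

Lemma card_row_nz n : #|[pred phi : 'rV[k]_n | phi != 0]| = (q ^ n).-1%N.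
Proof.
have := @card_row_ker n n 0; rewrite mxrank0 subn0 => <-.
by apply: eq_card => phi; rewrite !inE mulmx0 eqxx andbT.
Qed.

Section Plane.
Variables (T : eqType) (p : 'rV[k]_3 -> T).
Hypothesis pP : proj_map p.

Let q_gt1 : (1 < q)%N. Proof. exact: (card_finNzRing_gt1 k). Qed.

Let q1_gt0 : (0 < q.-1)%N. Proof. by rewrite -subn1 subn_gt0. Qed.

Lemma size_proj_points : size (proj_points p) = (q ^ 2 + q + 1)%N.
Proof.
apply/eqP; rewrite -(eqn_pmul2l q1_gt0) -count_predT count_proj_points //.
rewrite (eq_card (B := [pred phi | phi != 0])) ?card_row_nz; last first.
  by move=> phi; rewrite !inE andbT.
by apply/eqP; move: q q_gt1 => [|[|j]] //= _; rewrite !expnS expn0; nia.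
Qed.

Lemma count_line (P : pred T) (psi : 'rV[k]_3) : psi != 0 ->
  (forall phi, phi != 0 -> P (p phi) = (phi *m psi^T == 0)) ->
  count P (proj_points p) = q.+1.
Proof.
move=> psi0 PE; apply/eqP; rewrite -(eqn_pmul2l q1_gt0) count_proj_points //.
rewrite (eq_card (B := [pred phi | (phi != 0) && (phi *m psi^T == 0)])); last first.
  by move=> phi; rewrite !inE; case: eqVneq => //= /PE.
rewrite card_row_ker mxrank_tr rank_rV psi0.
by apply/eqP; move: q q_gt1 => [|[|j]] //= _; rewrite !expnS expn0; nia.
Qed.

Lemma count_two_lines (P : pred T) (psi psi' : 'rV[k]_3) : psi != 0 ->
  ~ (exists a, psi' = a *: psi) ->
  (forall phi, phi != 0 ->
     P (p phi) = (phi *m psi^T == 0) && (phi *m psi'^T == 0)) ->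
  count P (proj_points p) = 1%N.
Proof.
move=> psi0 indep PE; apply/eqP; rewrite -(eqn_pmul2l q1_gt0) count_proj_points //.
rewrite (eq_card (B := [pred phi | (phi != 0) && (phi *m (col_mx psi psi')^T == 0)])).
  rewrite card_row_ker mxrank_tr (_ : \rank _ = 2) ?expn1 ?muln1 //.
  apply/eqP; rewrite eqn_leq rank_leq_row /= -addsmxE ltnNge; apply/negP => le1.
  case: indep; apply/sub_rVP.
  have : (psi' <= psi + psi')%MS by exact: addsmxSr.
  suff /eqmxP/eqmx_sym -> // : (psi == psi + psi')%MS.
    by [].
  by rewrite -(geq_leqif (mxrank_leqif_eq (addsmxSl psi psi'))) rank_rV psi0.
move=> phi; rewrite !inE; case: eqVneq => //= /PE ->.
by rewrite tr_col_mx mul_mx_row row_mx_eq0.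
Qed.

End Plane.

End ProjectiveCounting.

(** * Incidence counts in the links of the building *)

Section LinkCounts.
Variable F : local_field.
Local Notation k := (residue_field F).
Local Notation q := (residue_card F).
Implicit Types (u v w : vertex F).

Definition repr v : 'M[F]_3 := xget 1%:M [set g | g \in unitmx /\ v = cls g].

Lemma reprP v : repr v \in unitmx /\ v = cls (repr v).
Proof.
rewrite /repr; case: xgetP => [g _ //|]; have [g gu ->] := cls_surj v.
by move=> /(_ g)[].
Qed.

Definition outs v := proj_points (plane_vertex (repr v)).
Definition ins v := proj_points (line_vertex (repr v)).

Lemma outs_uniq v : uniq (outs v). Proof. exact: proj_points_uniq. Qed.
Lemma ins_uniq v : uniq (ins v). Proof. exact: proj_points_uniq. Qed.

Lemma plane_vertex_proj (g : 'M[F]_3) : g \in unitmx -> proj_map (plane_vertex g).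
Proof. by move=> gu phi psi phi0 psi0; exact: plane_vertex_eq. Qed.

Lemma line_vertex_proj (g : 'M[F]_3) : g \in unitmx -> proj_map (line_vertex g).
Proof. by move=> gu phi psi phi0 psi0; exact: line_vertex_eq. Qed.

Lemma mem_outs v w : w \in outs v <-> edge1 v w.
Proof.
have [gu vE] := reprP v; rewrite {2}vE mem_proj_points; split=> [[phi phi0 ->]|].
  exact: plane_vertex_edge.
by move=> /(plane_vertex_surj gu)[phi phi0 ->]; exists phi.
Qed.

Lemma mem_ins v u : u \in ins v <-> edge1 u v.
Proof.
have [gu vE] := reprP v; rewrite {2}vE mem_proj_points; split=> [[phi phi0 ->]|].
  exact: line_vertex_edge.
by move=> /(line_vertex_surj gu)[phi phi0 ->]; exists phi.
Qed.

Lemma size_outs v : size (outs v) = (q ^ 2 + q + 1)%N.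
Proof. by have [gu _] := reprP v; exact: size_proj_points (plane_vertex_proj gu). Qed.

Lemma size_ins v : size (ins v) = (q ^ 2 + q + 1)%N.
Proof. by have [gu _] := reprP v; exact: size_proj_points (line_vertex_proj gu). Qed.

Lemma count_outs u v : edge1 u v -> count (fun w => `[<edge1 w u>]) (outs v) = q.+1.
Proof.
have [gu vE] := reprP v; rewrite {1}vE => /(line_vertex_surj gu)[psi psi0 ->].
apply: (count_line (plane_vertex_proj gu) psi0) => phi phi0.
by apply/asboolP/eqP; rewrite edge1_plane_line.
Qed.

Lemma count_ins v w : edge1 v w -> count (fun u => `[<edge1 w u>]) (ins v) = q.+1.
Proof.
have [gu vE] := reprP v; rewrite {1}vE => /(plane_vertex_surj gu)[phi phi0 ->].
apply: (count_line (line_vertex_proj gu) phi0) => psi psi0.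
apply/asboolP/eqP; rewrite edge1_plane_line // => h; apply: trmx_inj.
  by rewrite trmx_mul trmxK h trmx0.
by rewrite trmx_mul trmxK h trmx0.
Qed.

Lemma count_outs2 u u' v : edge1 u v -> edge1 u' v -> u != u' ->
  count (fun w => `[<edge1 w u>] && `[<edge1 w u'>]) (outs v) = 1%N.
Proof.
have [gu vE] := reprP v; rewrite {1 2}vE => /(line_vertex_surj gu)[psi psi0 ->].
move=> /(line_vertex_surj gu)[psi' psi0' ->] neq.
apply: (count_two_lines (plane_vertex_proj gu) psi0 (psi' := psi')) => [|phi phi0].
  by move=> /(line_vertex_eq gu psi0 psi0') /eqP; rewrite (negPf neq).
by congr (_ && _); apply/asboolP/eqP; rewrite edge1_plane_line.
Qed.

Lemma count_ins2 v w w' : edge1 v w -> edge1 v w' -> w != w' ->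
  count (fun u => `[<edge1 w u>] && `[<edge1 w' u>]) (ins v) = 1%N.
Proof.
have [gu vE] := reprP v; rewrite {1 2}vE => /(plane_vertex_surj gu)[phi phi0 ->].
move=> /(plane_vertex_surj gu)[phi' phi0' ->] neq.
apply: (count_two_lines (line_vertex_proj gu) phi0 (psi' := phi')) => [|psi psi0].
  by move=> /(plane_vertex_eq gu phi0 phi0') /eqP; rewrite (negPf neq).
have trE (a b : 'rV[k]_3) : (a *m b^T == 0) = (b *m a^T == 0).
  by rewrite -trmx_eq0 trmx_mul trmxK.
by rewrite !(trE psi); congr (_ && _); apply/asboolP/eqP; rewrite edge1_plane_line.
Qed.

End LinkCounts.

(** * The spectrum of the Hecke operator on the building *)

Section ComplexLimits.
Import numFieldNormedType.Exports.
Variable R : realType.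
Local Notation C := R[i].
Local Notation Re := (@complex.Re R).
Local Notation Im := (@complex.Im R).

Lemma sqr_normc (z : C) : normc z ^+ 2 = Re z ^+ 2 + Im z ^+ 2.
Proof. by case: z => a b /=; rewrite sqr_sqrtr // addr_ge0 ?sqr_ge0. Qed.

Lemma normc_ge0 (z : C) : 0 <= normc z.
Proof. by case: z => a b; exact: sqrtr_ge0. Qed.

Lemma normcB_sqr (z w : C) : normc (z - w) ^+ 2 <= 2 * normc z ^+ 2 + 2 * normc w ^+ 2.
Proof.
rewrite !sqr_normc; case: z w => [a b] [a' b'] /=.
have := sqr_ge0 (a + a'); have := sqr_ge0 (b + b'); rewrite !expr2; lra.
Qed.

(** Limits in R[i] are taken on real and imaginary parts, where completeness of the reals applies
    directly. *)
Definition ccvg (z : nat -> C) (l : C) :=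
  (fun n => Re (z n)) @ \oo --> Re l /\ (fun n => Im (z n)) @ \oo --> Im l.

Definition clim (z : nat -> C) : C :=
  Complex (lim ((fun n => Re (z n)) @ \oo)) (lim ((fun n => Im (z n)) @ \oo)).

Lemma ccvg_clim z l : ccvg z l -> clim z = l.
Proof.
move=> [/cvg_lim zr /cvg_lim zi]; rewrite /clim zr ?zi //; first by case: l {zr zi}.
Qed.

Lemma ccvg_cst l : ccvg (fun=> l) l.
Proof. by split; apply: cvg_cst. Qed.

Lemma ccvgD z z' l l' : ccvg z l -> ccvg z' l' -> ccvg (fun n => z n + z' n) (l + l').
Proof.
have ReD (x y : C) : Re (x + y) = Re x + Re y by case: x y => [a b] [].
have ImD (x y : C) : Im (x + y) = Im x + Im y by case: x y => [a b] [].
move=> [zr zi] [zr' zi']; split; [rewrite ReD|rewrite ImD].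
- under eq_fun do rewrite ReD; exact: cvgD.
- under eq_fun do rewrite ImD; exact: cvgD.
Qed.

Lemma ccvgM a z l : ccvg z l -> ccvg (fun n => a * z n) (a * l).
Proof.
have ReM (x y : C) : Re (x * y) = Re x * Re y - Im x * Im y by case: x y => [? ?] [].
have ImM (x y : C) : Im (x * y) = Re x * Im y + Im x * Re y by case: x y => [? ?] [].
move=> [zr zi]; split; [rewrite ReM|rewrite ImM].
- under eq_fun do rewrite ReM; apply: cvgB; apply: cvgM => //; exact: cvg_cst.
- under eq_fun do rewrite ImM; apply: cvgD; apply: cvgM => //; exact: cvg_cst.
Qed.

Lemma ccvg_sum (I : Type) (r : seq I) (z : nat -> I -> C) (l : I -> C) :
  (forall i, ccvg (z^~ i) (l i)) -> ccvg (fun n => \sum_(i <- r) z n i) (\sum_(i <- r) l i).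
Proof.
move=> H; elim: r => [|i r IH].
  by rewrite big_nil; under eq_fun do rewrite big_nil; exact: ccvg_cst.
by rewrite big_cons; under eq_fun do rewrite big_cons; exact: ccvgD.
Qed.

Lemma ccvg_shift z l : ccvg z l -> ccvg (fun n => z n.+1) l.
Proof.
move=> [zr zi]; split.
  by have := zr; rewrite -(@cvg_shiftS _ (fun n => Re (z n))).
by have := zi; rewrite -(@cvg_shiftS _ (fun n => Im (z n))).
Qed.

Lemma ccvg_uniq z l l' : ccvg z l -> ccvg z l' -> l = l'.
Proof. by move=> /ccvg_clim <- /ccvg_clim <-. Qed.

Lemma cvg_geometric_steps (x : nat -> R) K :
  (forall n, `|x n.+1 - x n| <= K * 2^-1 ^+ n) -> cvg (x @ \oo).
Proof.
move=> H.
have -> : x = (fun n => x 0%N + series (fun k => x k.+1 - x k) n).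
  apply/funext => n; rewrite /series /=.
  by rewrite telescope_sumr // addrC subrK.
apply: is_cvgD; first exact: is_cvg_cst.
apply: normed_cvg; apply: (@series_le_cvg _ _ (geometric K 2^-1)) => [n|n|n|].
- exact: normr_ge0.
- exact: le_trans (H n).
- exact: H.
- by apply: is_cvg_geometric_series; rewrite ger0_norm; lra.
Qed.

Lemma geometric_part (K : R) : 0 <= K -> forall (x y : R) n,
  x ^+ 2 + y ^+ 2 <= K * 4^-1 ^+ n -> `|x| <= Num.sqrt K * 2^-1 ^+ n.
Proof.
move=> K0 x y n h.
rewrite -(ler_pXn2r (n := 2)) ?nnegrE ?mulr_ge0 ?exprn_ge0 ?sqrtr_ge0 //.
rewrite exprMn sqr_sqrtr // -exprM mulnC exprM real_normK ?num_real //.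
have -> : 2^-1 ^+ 2 = 4^-1 :> R by field.
by apply: le_trans h; rewrite lerDl sqr_ge0.
Qed.

Lemma ccvg_geometric (z : nat -> C) K :
  (forall n, normc (z n.+1 - z n) ^+ 2 <= K * 4^-1 ^+ n) -> ccvg z (clim z).
Proof.
move=> H.
have K0 : 0 <= K by have := H 0%N; rewrite expr0 mulr1; apply: le_trans; rewrite sqr_ge0.
have step := geometric_part K0.
split; apply: (@cvg_geometric_steps _ (Num.sqrt K)) => n.
  have := H n; rewrite sqr_normc => /step; case: (z n.+1) (z n) => [a b] [] //.
have := H n; rewrite sqr_normc addrC => /step; case: (z n.+1) (z n) => [a b] [] //.
Qed.

Lemma ccvg0_geometric (z : nat -> C) K :
  (forall n, normc (z n) ^+ 2 <= K * 4^-1 ^+ n) -> ccvg z 0.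
Proof.
move=> H.
have K0 : 0 <= K by have := H 0%N; rewrite expr0 mulr1; apply: le_trans; rewrite sqr_ge0.
have K2 : (fun n => Num.sqrt K * 2^-1 ^+ n) @ \oo --> (0 : R).
  by apply: cvg_geometric; rewrite ger0_norm; lra.
have step := geometric_part K0.
split; apply: norm_cvg0; apply: (squeeze_cvgr _ (cvg_cst 0) K2); near=> n.
  by rewrite normr_ge0 /=; apply: (step _ (Im (z n))); rewrite -sqr_normc.
by rewrite normr_ge0 /=; apply: (step _ (Re (z n))); rewrite addrC -sqr_normc.
Unshelve. all: by end_near.
Qed.

End ComplexLimits.

Section WeightedSums.
Variable R : realType.

(** Cauchy-Schwarz for h^{1/2} and x h^{-1/2}: once the double sum is symmetrized in i and j, the
    difference is termwise a square over a positive number. *)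
Lemma weighted_sum_sqr (I : eqType) (r : seq I) (x h : I -> R) : (forall i, 0 < h i) ->
  (\sum_(i <- r) x i) ^+ 2 <= (\sum_(i <- r) h i) * (\sum_(i <- r) x i ^+ 2 / h i).
Proof.
move=> h0; rewrite expr2 !big_distrlr /=.
have sym : \sum_(i <- r) \sum_(j <- r) h i * (x j ^+ 2 / h j) =
    \sum_(i <- r) \sum_(j <- r) 2^-1 * (h i * (x j ^+ 2 / h j) + h j * (x i ^+ 2 / h i)).
  under [RHS]eq_bigr do rewrite -mulr_sumr big_split /=.
  rewrite -[RHS]mulr_sumr big_split /= [X in _ + X]exchange_big /=.
  set S := \sum_(i <- r) _; lra.
rewrite sym; apply: ler_sum => i _; apply: ler_sum => j _.
have hi := h0 i; have hj := h0 j.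
have -> : h i * (x j ^+ 2 / h j) + h j * (x i ^+ 2 / h i) =
   2 * (x i * x j) + (h i * x j - h j * x i) ^+ 2 / (h i * h j).
  by field; rewrite !gt_eqF.
have : 0 <= (h i * x j - h j * x i) ^+ 2 / (h i * h j).
  by rewrite divr_ge0 ?sqr_ge0 // mulr_ge0 ?ltW.
lra.
Qed.

End WeightedSums.

(** * Schur's test and the resolvent on a locally finite digraph *)

Section Resolvent.
Import numFieldNormedType.Exports.
Variables (R : realType) (V : choiceType).
Local Notation C := R[i].
Implicit Types f g : V -> C.

(** A bound on all finite partial sums; by [sqnorm_le] it is a bound on the extended-real norm, and
    it is easier to carry through the iteration. *)
Definition sq_summable f (B : R) :=
  forall s : seq V, uniq s -> \sum_(v <- s) normc (f v) ^+ 2 <= B.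

Definition sqnorm f : \bar R := (\esum_(v in [set: V]) ((normc (f v)) ^+ 2)%:E)%E.

Lemma sqnorm_le f B : (sqnorm f <= B%:E)%E <-> sq_summable f B.
Proof.
split=> [H s us|H].
  rewrite -lee_fin; apply: le_trans H.
  rewrite -sumEFin fsbig_seq //; apply: ereal_sup_ubound.
  by exists [set` s] => //; split=> //; exact: finite_seq.
apply: ge_ereal_sup => _ [A [finA _] <-].
by rewrite fsbig_finite // sumEFin lee_fin; apply: H; exact: fset_uniq.
Qed.

Lemma sqnorm_ge0 f : (0 <= sqnorm f)%E.
Proof. by apply: esum_ge0 => v _; rewrite lee_fin sqr_ge0. Qed.

Lemma sq_summable_ge0 f B : sq_summable f B -> 0 <= B.
Proof. by move=> /(_ [::] isT); rewrite big_nil. Qed.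

Lemma sq_summable_pt f B v : sq_summable f B -> normc (f v) ^+ 2 <= B.
Proof. by move=> /(_ [:: v] isT); rewrite big_seq1. Qed.

Lemma sq_summableZ a f B : sq_summable f B ->
  sq_summable (fun v => a * f v) (normc a ^+ 2 * B).
Proof.
move=> H s us; under eq_bigr do rewrite normcM exprMn.
by rewrite -mulr_sumr ler_wpM2l ?sqr_ge0 ?H.
Qed.

Lemma sq_summableB f g B B' : sq_summable f B -> sq_summable g B' ->
  sq_summable (fun v => f v - g v) (2 * B + 2 * B').
Proof.
move=> Hf Hg s us; apply: le_trans (ler_sum _ (fun v _ => normcB_sqr (f v) (g v))) _.
by rewrite big_split /= -!mulr_sumr lerD // ler_wpM2l ?Hf ?Hg.
Qed.

Lemma eq_sq_summable f g B : f =1 g -> sq_summable f B -> sq_summable g B.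
Proof. by move=> fg H s us; under eq_bigr do rewrite -fg; exact: H. Qed.

Variables (outs ins : V -> seq V) (h : V -> R) (c : R).
Hypothesis outs_uniq : forall v, uniq (outs v).
Hypothesis ins_uniq : forall v, uniq (ins v).
Hypothesis outs_ins : forall v w, (w \in outs v) = (v \in ins w).
Hypothesis h_gt0 : forall v, 0 < h v.
Hypothesis c_gt0 : 0 < c.
Hypothesis outs_h : forall v, \sum_(w <- outs v) h w <= c * h v.
Hypothesis ins_h : forall w, \sum_(v <- ins w) h v <= c * h w.

Definition out_op f v : C := \sum_(w <- outs v) f w.

Lemma out_op_pt f v :
  normc (out_op f v) ^+ 2 <= c * h v * \sum_(w <- outs v) normc (f w) ^+ 2 / h w.
Proof.
have -> : normc (out_op f v) ^+ 2 = (\sum_(w <- outs v) complex.Re (f w)) ^+ 2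
    + (\sum_(w <- outs v) complex.Im (f w)) ^+ 2.
  rewrite sqr_normc; congr (_ ^+ 2 + _ ^+ 2); rewrite /out_op.
    by elim/big_rec2: _ => // w y z _ <-; case: (f w) z => [? ?] [].
  by elim/big_rec2: _ => // w y z _ <-; case: (f w) z => [? ?] [].
under [X in _ <= _ * X]eq_bigr do rewrite sqr_normc mulrDl.
rewrite big_split /= mulrDr; apply: lerD; apply: le_trans (weighted_sum_sqr _ _ h_gt0) _.
  rewrite ler_wpM2r ?outs_h //; apply: sumr_ge0 => w _.
  by rewrite divr_ge0 ?sqr_ge0 // ltW.
rewrite ler_wpM2r ?outs_h //; apply: sumr_ge0 => w _.
by rewrite divr_ge0 ?sqr_ge0 // ltW.
Qed.

(* Schur's test with the weight h. *)
Lemma out_op_summable f B : sq_summable f B -> sq_summable (out_op f) (c ^+ 2 * B).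
Proof.
move=> H s us; pose W := undup (flatten [seq outs v | v <- s]).
pose G w := normc (f w) ^+ 2 / h w.
have G0 w : 0 <= G w by rewrite divr_ge0 ?sqr_ge0 // ltW.
apply: le_trans (ler_sum _ (fun v _ => out_op_pt f v)) _.
have outW v : v \in s -> \sum_(w <- outs v) G w = \sum_(w <- W | w \in outs v) G w.
  move=> vs; rewrite -[RHS]big_filter; apply: perm_big; apply: uniq_perm => //.
    by rewrite filter_uniq // undup_uniq.
  move=> w; rewrite mem_filter mem_undup; case: (boolP (w \in outs v)) => //= wv.
  by apply/esym/flattenP; exists (outs v) => //; exact: map_f.
have -> : \sum_(v <- s) c * h v * \sum_(w <- outs v) normc (f w) ^+ 2 / h w =
    \sum_(w <- W) G w * (c * \sum_(v <- s | v \in ins w) h v).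
  transitivity (\sum_(v <- s) \sum_(w <- W | w \in outs v) c * h v * G w).
    by apply: eq_big_seq => v vs; rewrite -mulr_sumr outW.
  rewrite (exchange_big_dep xpredT) //=; apply: eq_bigr => w _.
  rewrite mulr_sumr mulr_sumr; apply: eq_big => [v|v _]; first exact: outs_ins.
  by rewrite mulrC.
apply: le_trans (_ : \sum_(w <- W) c ^+ 2 * normc (f w) ^+ 2 <= _); last first.
  by rewrite -mulr_sumr ler_wpM2l ?sqr_ge0 // H // undup_uniq.
apply: ler_sum => w _.
have -> : c ^+ 2 * normc (f w) ^+ 2 = G w * (c * (c * h w)).
  by rewrite /G; field; rewrite gt_eqF.
rewrite ler_wpM2l // ler_wpM2l ?(ltW c_gt0) //; apply: le_trans (ins_h w).
have -> : \sum_(v <- s | v \in ins w) h v = \sum_(v <- ins w | v \in s) h v.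
  rewrite -[LHS]big_filter -[RHS]big_filter; apply: perm_big; apply: uniq_perm;
    rewrite ?filter_uniq //.
  by move=> v; rewrite !mem_filter andbC.
by rewrite [leRHS](bigID [in s]) /= lerDl sumr_ge0 // => v _; rewrite ltW.
Qed.

Variable lam : C.
Hypothesis lam_big : 2 * c < normc lam.

Let lam2 : 4 * c ^+ 2 <= normc lam ^+ 2.
Proof.
have -> : 4 * c ^+ 2 = (2 * c) ^+ 2 by ring.
have c0 : 0 <= 2 * c by rewrite mulr_ge0 // ltW.
by rewrite lerXn2r ?nnegrE ?normc_ge0 // ltW.
Qed.

Let lam_gt0 : 0 < normc lam ^+ 2.
Proof. by apply: lt_le_trans lam2; rewrite mulr_gt0 // exprn_gt0. Qed.

Let lam_neq0 : lam != 0.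
Proof.
apply: contraTneq lam_gt0 => ->.
by rewrite [normc _]normc0 expr0n ltxx.
Qed.

Let contraction f B : sq_summable f B ->
  sq_summable (fun v => lam^-1 * out_op f v) (4^-1 * B).
Proof.
move=> H; have B0 := sq_summable_ge0 H.
move=> s us; apply: le_trans (sq_summableZ lam^-1 (out_op_summable H) us) _.
rewrite mulrA ler_wpM2r // normcV exprVn ler_pdivrMl //.
have := lam2; lra.
Qed.

Lemma out_opB f g v : out_op (fun w => f w - g w) v = out_op f v - out_op g v.
Proof. by rewrite /out_op -sumrB. Qed.

(* Fixed-point iteration for f |-> lam^-1 (A f - id); as |lam| exceeds 2 ||A||, the
   crude bound |x - y|^2 <= 2 |x|^2 + 2 |y|^2 is enough to control it. *)
Fixpoint neumann f n : V -> C :=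
  if n is n'.+1 then fun v => lam^-1 * (out_op (neumann f n') v - f v) else fun=> 0.

(** The constant solves B' = 2 (B' / 4) + 2 B / |lam|^2, so one step of the iteration reproduces the
    bound. *)
Lemma neumann_bound f B n : sq_summable f B ->
  sq_summable (neumann f n) (4 / normc lam ^+ 2 * B).
Proof.
move=> H; have B0 := sq_summable_ge0 H.
elim: n => [|n IH] s us /=.
  rewrite big1 => [|v _]; first by rewrite mulr_ge0 // divr_ge0 // ltW.
  by rewrite !expr0n addr0 sqrtr0 expr0n.
apply: le_trans (_ : _ <= 2 * (4^-1 * (4 / normc lam ^+ 2 * B))
    + 2 * (normc lam^-1 ^+ 2 * B)) _.
  have := sq_summableB (contraction IH) (sq_summableZ lam^-1 H) us.
  by apply: le_trans; apply: ler_sum => v _; rewrite mulrBr.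
rewrite normcV exprVn; move: lam_gt0; set L := normc lam ^+ 2 => L0.
by rewrite le_eqVlt; apply/orP; left; apply/eqP; field; rewrite gt_eqF.
Qed.

Lemma neumann_step f B n : sq_summable f B ->
  sq_summable (fun v => neumann f n.+1 v - neumann f n v)
    (normc lam ^- 2 * B * 4^-1 ^+ n).
Proof.
move=> H; elim: n => [|n IH].
  rewrite expr0 mulr1 -exprVn -normcV -[_ ^+ 2]/(normc (lam^-1) ^+ 2).
  have -> : normc lam^-1 ^+ 2 = normc (- lam^-1) ^+ 2.
    by rewrite !sqr_normc; case: lam^-1 => a b /=; rewrite !sqrrN.
  apply: eq_sq_summable (sq_summableZ (- lam^-1) H) => v /=.
  by rewrite subr0 /out_op big1 // sub0r mulNr mulrN.
have := contraction IH; rewrite mulrCA -exprS.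
apply: eq_sq_summable => v; rewrite out_opB /=.
by rewrite -mulrBr opprB addrA subrK.
Qed.

Definition resolvent f v : C := clim (neumann f ^~ v).

Lemma resolvent_cvg f B v : sq_summable f B -> ccvg (neumann f ^~ v) (resolvent f v).
Proof.
move=> H; apply: (@ccvg_geometric _ _ (normc lam ^- 2 * B)) => n.
exact: (sq_summable_pt v (neumann_step n H)).
Qed.

Lemma ler_lim_sqsum (z : nat -> V -> C) (l : V -> C) (s : seq V) B :
  (forall v, ccvg (z^~ v) (l v)) -> (forall n, \sum_(v <- s) normc (z n v) ^+ 2 <= B) ->
  \sum_(v <- s) normc (l v) ^+ 2 <= B.
Proof.
move=> zl H.
have c2 : (fun n => \sum_(v <- s) normc (z n v) ^+ 2) @ \oo --> \sum_(v <- s) normc (l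
  v) ^+ 2.
  elim: s {H} => [|v s IH].
    by rewrite big_nil; under eq_fun do rewrite big_nil; exact: cvg_cst.
  rewrite big_cons; under eq_fun do rewrite big_cons.
  apply: cvgD => //; rewrite sqr_normc; under eq_fun do rewrite sqr_normc.
  have [zr zi] := zl v.
  by apply: cvgD; rewrite expr2; under eq_fun do rewrite expr2; apply: cvgM.
rewrite -(cvg_lim _ c2) //; apply: limr_le; first by apply/cvg_ex; eexists; exact: c2.
by near=> n; exact: H.
Unshelve. all: by end_near.
Qed.

Lemma resolvent_bound f B : sq_summable f B ->
  sq_summable (resolvent f) (4 / normc lam ^+ 2 * B).
Proof.
move=> H s us; apply: (@ler_lim_sqsum (neumann f)) => [v|n].
  exact: resolvent_cvg H.
exact: (neumann_bound n H).
Qed.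

Lemma resolvent_right f B v : sq_summable f B ->
  out_op (resolvent f) v - lam * resolvent f v = f v.
Proof.
move=> H; have c1 : ccvg (fun n => out_op (neumann f n) v) (out_op (resolvent f) v).
  by apply: ccvg_sum => w; exact: resolvent_cvg H.
have c2 := ccvgM (- lam) (ccvg_shift (resolvent_cvg v H)).
have := ccvgD c1 c2; rewrite mulNr => /ccvg_uniq; apply.
rewrite (_ : (fun n => _) = fun=> f v); first exact: ccvg_cst.
by apply/funext => n /=; rewrite mulNr mulVKf // opprB addrC subrK.
Qed.

(** For the right-hand side A f - lam f, the function f is itself fixed by the iteration, so the
    distance of the iterates to f contracts. *)
Lemma resolvent_left f B v : sq_summable f B ->
  resolvent (fun w => out_op f w - lam * f w) v = f v.
Proof.
move=> H; pose g w := out_op f w - lam * f w.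
have d n : sq_summable (fun w => neumann g n w - f w) (B * 4^-1 ^+ n).
  elim: n => [|n IH].
    rewrite expr0 mulr1 => s us; have := H s us; apply: le_trans.
    apply: ler_sum => w _ /=; rewrite sub0r !sqr_normc.
    by case: (f w) => a b /=; rewrite !sqrrN.
  have := contraction IH; rewrite mulrCA -exprS.
  apply: eq_sq_summable => w; rewrite out_opB /= /g.
  by move: (out_op _ _) (out_op _ _) (f w) => x y z; field.
have c0 : ccvg (fun n => neumann g n v - f v) 0.
  apply: (@ccvg0_geometric _ _ B) => n; exact: (sq_summable_pt v (d n)).
apply: ccvg_clim; have := ccvgD c0 (ccvg_cst (f v)); rewrite add0r.
by under eq_fun do rewrite subrK.
Qed.

End Resolvent.

(** * The Busemann function of a rational plane *)

Section Busemann.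
Variable F : local_field.
Local Notation k := (residue_field F).
Local Notation pi := (@uniformizer F).
Local Notation N1 := (@intdet F 1 3).
Local Notation GLO := (@intdet F 0 3).
Local Notation q := (residue_card F).
Implicit Types (u v w : vertex F) (g n : 'M[F]_3) (rho : 'rV[F]_3).

(** The least valuation of an entry, stated through a vector with nonzero reduction so that
    invariance under GL_3(O) is immediate. *)
Definition has_val rho (a : int) :=
  exists rho', [/\ intmx rho', redmx rho' != 0 & rho = pi ^ a *: rho'].

Lemma integers_expz (a : int) : 0 <= a -> integers (pi ^ a).
Proof. by move=> a0; right; rewrite ordv_expz. Qed.

Lemma has_valP rho a : has_val rho a -> forall b, intmx (pi ^ (- b) *: rho) <-> b <= a.
Proof.
move=> [rho' [ir rr ->]] b; rewrite scalerA -expfzDr ?pi_neq0 //.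
split=> [iY|ba]; last by apply: intmxZ ir; apply: integers_expz; rewrite addrC subr_ge0.
rewrite leNgt; apply: contraNN rr => ab.
have e1 : pi * (pi ^ (b - a - 1) * pi ^ (- b + a)) = 1.
  rewrite -[X in X * _]expr1z -!expfzDr ?pi_neq0 //.
  by rewrite (_ : 1 + _ = 0) //; clear; lia.
have : redmx (pi *: (pi ^ (b - a - 1) *: (pi ^ (- b + a) *: rho'))) = 0.
  by apply: redmx_piZ; apply: intmxZ iY; apply: integers_expz; move: ab; clear; lia.
by rewrite !scalerA -?mulrA e1 scale1r => ->.
Qed.

Lemma has_val_uniq rho a b : has_val rho a -> has_val rho b -> a = b.
Proof.
move=> ha hb; apply: le_anti; apply/andP; split.
  by apply/(has_valP hb)/(has_valP ha).
by apply/(has_valP ha)/(has_valP hb).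
Qed.

Lemma has_val_ex rho : rho != 0 -> exists a, has_val rho a.
Proof.
move=> /rV0Pn[j0 j0P].
have [j rj minj] := @Order.TotalTheory.arg_minP _ _ _ j0 (fun j => rho 0 j != 0)
  (fun j => ordv (rho 0 j)) j0P.
exists (ordv (rho 0 j)), (pi ^ (- ordv (rho 0 j)) *: rho); split.
- move=> i i'; rewrite ord1 mxE; have [->|r0] := eqVneq (rho 0 i') 0.
    by rewrite mulr0; exact: integers0.
  by right; rewrite ordvM ?pi_expz_neq0 // ordv_expz addrC subr_ge0 minj.
- apply/rV0Pn; exists j; rewrite !mxE; apply/red_neq0.
    by right; rewrite ordvM ?pi_expz_neq0 // ordv_expz addNr.
  by rewrite mulf_neq0 ?pi_expz_neq0 // ordvM ?pi_expz_neq0 // ordv_expz addNr.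
- by rewrite scalerA -expfzDr ?pi_neq0 // subrr scale1r.
Qed.

Lemma redmxZ m p (a : F) (A : 'M[F]_(m, p)) : integers a -> intmx A ->
  redmx (a *: A) = reduction a *: redmx A.
Proof.
move=> ia iA; apply/matrixP => i j; rewrite !mxE.
by have [_] := reductionDM ia (iA i j).
Qed.

Lemma redmx_unit n : GLO n -> redmx n \in unitmx.
Proof.
case=> iN n0 on; rewrite unitmxE unitfE -red_det //.
by apply/red_neq0; [exact: integers_det|].
Qed.

Lemma has_val_mul rho a (c : F) (u : 'M[F]_3) : has_val rho a -> c != 0 -> GLO u ->
  has_val (c *: (rho *m u)) (a + ordv c).
Proof.
move=> [rho' [ir rr ->]] c0 hu; have [iu _ _] := hu.
pose e := c * pi ^ (- ordv c).
have e0 : e != 0 by rewrite mulf_neq0 ?pi_expz_neq0.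
have oe : ordv e = 0 by rewrite ordvM ?pi_expz_neq0 // ordv_expz subrr.
have ie : integers e by right; rewrite oe.
exists (e *: (rho' *m u)); split.
- by apply: intmxZ => //; apply: intmxM.
- rewrite redmxZ //; last exact: intmxM.
  rewrite scaler_eq0 negb_or redmxM //; apply/andP; split; first exact/red_neq0.
  apply: contraNneq rr => E; rewrite -(mulmxK (redmx_unit hu) (redmx rho')) E.
  by rewrite mul0mx.
- rewrite -scalemxAl !scalerA; congr (_ *: _).
  rewrite /e mulrCA -expfzDr ?pi_neq0 //; congr (_ * pi ^ _).
  by move: (ordv c) => x; clear; lia.
Qed.

Definition rowval rho := xget 0 [set a | has_val rho a].

Lemma rowvalP rho : rho != 0 -> has_val rho (rowval rho).
Proof.
move=> /has_val_ex[a ha]; rewrite /rowval; case: xgetP => [b _ //|/(_ a)].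
by [].
Qed.

Lemma rowvalE rho a : has_val rho a -> rowval rho = a.
Proof.
move=> ha; rewrite /rowval; case: xgetP => [b _ hb|/(_ a) //].
exact: has_val_uniq hb ha.
Qed.

Lemma row_unit_neq0 g : g \in unitmx -> row 0 g != 0.
Proof.
move=> gu; apply/eqP => r0;
  have : row 0 g *m invmx g = row 0 1%:M by rewrite -row_mul mulmxV.
rewrite r0 mul0mx => /matrixP/(_ 0 0); rewrite !mxE eqxx => /eqP.
by rewrite eq_sym oner_eq0.
Qed.

(* The least valuation of the first coordinate on a lattice representing v, compared
   to its covolume: a Busemann function. It only sees a maximal parabolic subgroup,
   which suffices for a bound of order q^{3/2}. *)
Definition busemann v : int :=
  3 * rowval (row 0 (repr v)) - ordv (\det (repr v)).

Lemma busemann_cls g : g \in unitmx ->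
  busemann (cls g) = 3 * rowval (row 0 g) - ordv (\det g).
Proof.
move=> gu; have [hu E] := reprP (cls g); rewrite /busemann; move: (repr _) hu E => h hu E.
have [c [u [c0 hU ->]]] := (cls_eq gu hu).1 E; have [iu u0 ou] := hU.
have ha := rowvalP (row_unit_neq0 gu).
rewrite linearZ /= row_mul (rowvalE (has_val_mul ha c0 hU)) detZ det_mulmx.
have g0 : \det g != 0 by rewrite -unitfE -unitmxE.
move: g0 u0 ou; move: (\det g) (\det u) => x y x0 y0 oy.
rewrite ordvM ?expf_neq0 ?mulf_neq0 // ordvX // ordvM // oy.
by move: (ordv c) (ordv x) (rowval _) => ? ? ?; clear; lia.
Qed.

(** The valuation rises exactly when the primitive row rho' defines the plane of the edge. It cannot
    rise by two: rho' is the divided row times the integral matrix pi n^{-1}, so the divided row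
    does not reduce to 0. *)
Lemma rowval_edge g n rho' : g \in unitmx -> N1 n -> intmx rho' -> redmx rho' != 0 ->
  row 0 g = pi ^ (rowval (row 0 g)) *: rho' ->
  rowval (row 0 (g *m n)) = rowval (row 0 g) + (redmx rho' *m redmx n == 0)%:Z.
Proof.
move=> gu hn ir rr gE; have [iN _ _] := hn; have nu := intdet_unit hn.
have [iX _] := N1_coadj hn.
rewrite row_mul {1}gE -scalemxAl; case: eqVneq => [r0|r0].
  have irn : intmx (rho' *m n) by apply: intmxM.
  have isig : intmx (pi^-1 *: (rho' *m n)) by apply: redmx_eq0_div; rewrite ?redmxM.
  apply: rowvalE; exists (pi^-1 *: (rho' *m n)); split=> //.
    apply: contraNneq rr => s0.
    have -> : rho' = (pi^-1 *: (rho' *m n)) *m (pi *: invmx n).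
      by rewrite -scalemxAl -scalemxAr mulmxK // scalerA mulVf ?pi_neq0 // scale1r.
    by rewrite redmxM // s0 mul0mx.
  by rewrite scalerA expfzDr ?pi_neq0 // expr1z mulfK ?pi_neq0.
rewrite addr0; apply: rowvalE; exists (rho' *m n); split=> //; first exact: intmxM.
by rewrite redmxM.
Qed.

Lemma row_primitive g : g \in unitmx -> exists rho', [/\ intmx rho', redmx rho' != 0 &
  row 0 g = pi ^ (rowval (row 0 g)) *: rho'].
Proof. by move=> gu; exact: (rowvalP (row_unit_neq0 gu)). Qed.

Lemma busemann_edge_cls g n : g \in unitmx -> N1 n ->
  busemann (cls (g *m n)) =
  busemann (cls g) + 3 * (rowval (row 0 (g *m n)) - rowval (row 0 g)) - 1.
Proof.
move=> gu hn; have nu := intdet_unit hn; have [_ n0 on] := hn.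
have gnu : g *m n \in unitmx by rewrite unitmx_mul gu.
have g0 : \det g != 0 by rewrite -unitfE -unitmxE.
rewrite !busemann_cls // det_mulmx.
move: g0 n0 on; move: (\det g) (\det n) => x y x0 y0 oy.
rewrite ordvM // oy; move: (ordv x) (rowval _) (rowval _) => ? ? ?; clear; lia.
Qed.

Lemma busemann_edge v w : edge1 v w ->
  busemann w = busemann v - 1 \/ busemann w = busemann v + 2.
Proof.
move=> [g [n [gu hn -> ->]]]; have [rho' [ir rr gE]] := row_primitive gu.
rewrite busemann_edge_cls // (rowval_edge gu hn ir rr gE).
case: (_ == 0); [right|left]; move: (busemann _) (rowval _) => ? ?; clear; lia.
Qed.

(** The vertex w0 belongs to the plane cut out by the first row of g. It is the only successor with
    increment 2, and a predecessor of value one above that of v is a line of this plane. *)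
Lemma busemann_up v : exists w0, [/\ edge1 v w0,
  forall w, edge1 v w -> busemann w = busemann v + 2 -> w = w0 &
  forall u, edge1 u v -> busemann u = busemann v + 1 -> edge1 w0 u].
Proof.
have [g gu ->] := cls_surj v; have [rho' [ir rr gE]] := row_primitive gu.
exists (plane_vertex g (redmx rho')); split; first exact: plane_vertex_edge.
  move=> w /(edge1_out _ gu)[n hn ->]; rewrite busemann_edge_cls //.
  rewrite (rowval_edge gu hn ir rr gE).
  case: eqVneq => [r0 _|_]; first exact/plane_vertexP.
  by move: (busemann _) (rowval _) => ? ?; clear; lia.
move=> u /(line_vertex_surj gu)[psi psi0 ->]; rewrite /line_vertex.
have [hm pm] := plane_mxP psi0; have hn := intdet_tr hm.
move=> bE; apply/edge1_plane_line => //.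
have nu := intdet_unit hn; set n := (plane_mx psi)^T in hn nu bE *.
have gnu : g *m invmx n \in unitmx by rewrite unitmx_mul gu unitmx_inv.
have := busemann_edge_cls gnu hn; rewrite mulmxKV // bE => bE'.
(* The value drops by one from u to v, so the row valuation stays the same. Hence rho' = sig n with
   sig integral, and rho' vanishes on the line of u, which n kills modulo pi. *)
have vE : rowval (row 0 (g *m invmx n)) = rowval (row 0 g).
  by move: bE'; move: (busemann _) (rowval _) (rowval _) => ? ? ?; clear; lia.
have [iN _ _] := hn.
pose sig := pi ^ (- rowval (row 0 g)) *: row 0 (g *m invmx n).
have isig : intmx sig.
  by apply/(has_valP (rowvalP (row_unit_neq0 gnu))); rewrite vE.
have rE : rho' = sig *m n.
  rewrite /sig -scalemxAl -row_mul mulmxKV //; move: gE; set a := rowval _ => ->.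
  rewrite scalerA -expfzDr ?pi_neq0 //.
  by rewrite addNr scale1r.
have nE : redmx n *m psi^T = 0 by rewrite redmx_tr -trmx_mul pm trmx0.
by rewrite rE redmxM // -mulmxA nE mulmx0.
Qed.

End Busemann.

(** * The norm of A_1 on the building *)

Section HeckeSpectrum.
Variables (R : realType) (F : local_field).
Local Notation q := (residue_card F).
Local Notation N := (q ^ 2 + q + 1)%N.
Implicit Types (u v w : vertex F).

Let s : R := Num.sqrt q%:R.
Let h v : R := s ^ (busemann v).

Let q_gt0 : (0 < q)%N.
Proof. by apply: ltnW; exact: card_finNzRing_gt1. Qed.

Let s_ge1 : 1 <= s.
Proof. by rewrite -sqrtr1 ler_wsqrtr // ler1n. Qed.

Let s_gt0 : 0 < s. Proof. exact: lt_le_trans ltr01 s_ge1. Qed.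

Let s2 : s ^+ 2 = q%:R. Proof. by rewrite sqr_sqrtr. Qed.

Let s0 : s != 0. Proof. by rewrite gt_eqF. Qed.

Let h_gt0 v : 0 < h v. Proof. exact: exprz_gt0. Qed.

Let NE : N%:R = s ^+ 4 + s ^+ 2 + 1 :> R.
Proof. by rewrite !natrD natrX -s2 -exprM. Qed.

Let hD v (m : int) : s ^ (busemann v + m) = h v * s ^ m.
Proof. by rewrite expfzDr. Qed.

Let sum_indicator (I : Type) (r : seq I) (P : pred I) (a b : R) :
  \sum_(i <- r) (a + (P i)%:R * b) = (size r)%:R * a + (count P r)%:R * b.
Proof.
elim: r => [|i r IH]; first by rewrite big_nil !mul0r addr0.
by rewrite big_cons IH /= -[(size r).+1]add1n !natrD; ring.
Qed.

Let s_pow : [/\ 1 <= s ^+ 3, s <= s ^+ 3 & s ^+ 2 <= s ^+ 3].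
Proof.
split; first exact: exprn_ege1.
  by rewrite -[leLHS]expr1 ler_weXn2l.
by rewrite ler_weXn2l.
Qed.

(** With s = q^{1/2}, one successor carries the relative weight s^2 and the others s^{-1}; there are
    about s^4 of the latter, whence the order s^3. *)
Let outs_h v : \sum_(w <- outs v) h w <= 5 * s ^+ 3 * h v.
Proof.
have [w0 [e0 H _]] := busemann_up v; have h0 := h_gt0 v.
have sV : 0 < s^-1 by rewrite invr_gt0.
apply: le_trans (_ : _ <= \sum_(w <- outs v) (h v * s^-1 + (w == w0)%:R * (h v * s ^+
  2))) _.
  rewrite !big_seq; apply: ler_sum => w /mem_outs e.
  have [E|E] := busemann_edge e; rewrite {1}/h E hD.
    by rewrite exprN1 lerDl !mulr_ge0 ?sqr_ge0 ?ler0n // ltW.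
  by rewrite (H w e E) eqxx mul1r lerDr mulr_ge0 // ltW.
rewrite sum_indicator size_outs NE count_uniq_mem ?outs_uniq //.
have -> : w0 \in outs v by apply/mem_outs.
have -> : (s ^+ 4 + s ^+ 2 + 1) * (h v / s) = (s ^+ 3 + s + s^-1) * h v.
  by move: (h v) => ?; field.
have -> : 1 * (h v * s ^+ 2) = s ^+ 2 * h v by rewrite mul1r mulrC.
rewrite -mulrDl ler_wpM2r ?(ltW h0) //.
have [p1 p2 p3] := s_pow; have : s^-1 <= 1 by rewrite invf_le1.
lra.
Qed.

(** Predecessors have relative weight s, for at most q + 1 = s^2 + 1 of them, or s^{-2}. The total
    is at most s^3 + s^2 + s + 1 + s^{-2}; each of these five terms is at most s^3, which is the
    origin of the constant 5. *)
Let ins_h v : \sum_(u <- ins v) h u <= 5 * s ^+ 3 * h v.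
Proof.
have [w0 [e0 _ H]] := busemann_up v; have h0 := h_gt0 v.
have sV : 0 < s^-1 by rewrite invr_gt0.
apply: le_trans (_ : _ <= \sum_(u <- ins v) (h v * s ^- 2 + `[<edge1 w0 u>]%:R * (h v *
  s))) _.
  rewrite !big_seq; apply: ler_sum => u /mem_ins e.
  have [E|E] := busemann_edge e.
    have {}E : busemann u = busemann v + 1 by rewrite E subrK.
    rewrite {1}/h E hD asboolT; last exact: H.
    by rewrite mul1r expr1z lerDr mulr_ge0 ?(ltW h0) // invr_ge0 sqr_ge0.
  have {}E : busemann u = busemann v + (- 2%:Z) by rewrite E addrK.
  by rewrite {1}/h E hD exprnN lerDl !mulr_ge0 ?ler0n ?(ltW h0) // ltW.
rewrite sum_indicator size_ins NE count_ins //.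
have -> : (s ^+ 4 + s ^+ 2 + 1) * (h v / s ^+ 2) = (s ^+ 2 + 1 + s^-1 ^+ 2) * h v.
  by move: (h v) => ?; field.
have -> : q.+1%:R * (h v * s) = (s ^+ 3 + s) * h v.
  by rewrite -natr1 -s2; ring.
rewrite -mulrDl ler_wpM2r ?(ltW h0) //.
have [p1 p2 p3] := s_pow; have : s^-1 ^+ 2 <= 1.
  by rewrite exprn_ile1 ?(ltW sV) // invf_le1.
lra.
Qed.

Lemma hecke1E (f : vertex F -> R[i]) v : hecke 1 f v = out_op (@outs F) f v.
Proof.
rewrite /out_op fsbig_seq ?outs_uniq // /hecke.
suff -> : [set w | adjacent v w /\ color w - color v = 1] = [set` outs v] by [].
by apply/seteqP; split=> w /=; [move/adjacent_color/mem_outs|move/mem_outs/adjacent_color].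
Qed.

(** The 10 is twice the 5 of Schur's test, since the fixed-point iteration asks for |lam| > 2 c. *)
Lemma hecke1_resolvent (lam : R[i]) :
  10 * Num.sqrt q%:R ^+ 3 < normc lam -> @hecke_resolvent R F 1 lam.
Proof.
move=> lam_big; have c0 : 0 < 5 * s ^+ 3 by rewrite mulr_gt0 // exprn_gt0.
have lam_big' : 2 * (5 * s ^+ 3) < normc lam.
  by apply: le_lt_trans lam_big; rewrite mulrA -natrM.
have io v w : (w \in outs v) = (v \in ins w) by apply/idP/idP; rewrite mem_outs mem_ins.
exists (resolvent (@outs F) lam), (4 / normc lam ^+ 2) => f ffin.
have fB : (l2norm_sq f = (fine (l2norm_sq f))%:E)%E.
  by rewrite fineK // ge0_fin_numE //; exact: (sqnorm_ge0 f).
have fs : sq_summable f (fine (l2norm_sq f)) by apply/sqnorm_le; rewrite -fB.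
split.
- rewrite fB -EFinM; apply/sqnorm_le.
  exact: (resolvent_bound (@outs_uniq F) (@ins_uniq F) io h_gt0 c0 outs_h ins_h
    lam_big' fs).
- apply/funext => v; rewrite hecke1E.
  exact: (resolvent_right (@outs_uniq F) (@ins_uniq F) io h_gt0 c0 outs_h ins_h
    lam_big' v fs).
- have -> : (fun v => hecke 1 f v - lam * f v) =
      (fun v => out_op (@outs F) f v - lam * f v).
    by apply/funext => v; rewrite hecke1E.
  apply/funext => v.
  exact: (resolvent_left (@outs_uniq F) (@ins_uniq F) io h_gt0 c0 outs_h ins_h lam_big'
    v fs).
Qed.

End HeckeSpectrum.

(** * The quotient complex *)

Section Action.
Variable F : local_field.
Implicit Types (u v w : vertex F) (g h : 'M[F]_3).
Local Notation pi := (@uniformizer F).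

Lemma act_mul g h v : g \in unitmx -> h \in unitmx -> act (g *m h) v = act g (act h v).
Proof.
move=> gu hu; have [x xu ->] := cls_surj v.
by rewrite !act_cls ?unitmx_mul ?gu ?hu // mulmxA.
Qed.

Lemma act_scalar (c : F) v : c != 0 -> act c%:M v = v.
Proof.
move=> c0; have [x xu ->] := cls_surj v.
rewrite act_cls // ?mul_scalar_mx ?cls_scale //.
by rewrite unitmxE det_scalar unitrX ?unitfE.
Qed.

Lemma edge1_act g v w : g \in unitmx -> edge1 v w -> edge1 (act g v) (act g w).
Proof.
move=> gu [x [n [xu hn -> ->]]]; have nu := intdet_unit hn.
exists (g *m x), n; rewrite !act_cls ?unitmx_mul ?gu ?xu ?nu // mulmxA.
by split; rewrite ?unitmx_mul ?gu.
Qed.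

Lemma scale_integral g : g \in unitmx ->
  exists c (d : nat), c != 0 /\ intdet d%:Z (c *: g).
Proof.
(* A power of pi large enough to clear the denominators of all entries. *)
move=> gu; pose j := (\sum_i \sum_l `|ordv (g i l)|)%N.
have p0 : pi ^+ j != 0 by rewrite expf_neq0 ?pi_neq0.
have ig : intmx (pi ^+ j *: g).
  move=> i l; rewrite mxE; have [->|gil] := eqVneq (g i l) 0.
    by rewrite mulr0; exact: integers0.
  right; rewrite ordvM // ordvX ?pi_neq0 // ordv_pi natz.
  have : (`|ordv (g i l)| <= j)%N.
    by rewrite /j (bigD1 i) //= (bigD1 l) //= -addnA leq_addr.
  by move: (ordv _) j {p0} => x j; clear; lia.
have d0 : \det (pi ^+ j *: g) != 0 by rewrite detZ mulf_neq0 ?expf_neq0 ?pi_neq0 //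
  -unitfE -unitmxE.
have D : intdet (ordv (\det (pi ^+ j *: g))) (pi ^+ j *: g) by split.
exists (pi ^+ j), `|ordv (\det (pi ^+ j *: g))|%N; split=> //.
by rewrite gez0_abs //; exact: intdet_ge0 D.
Qed.

Lemma simplex1 v : simplex [set v].
Proof. by split; [exists v|exact: finite_set1|move=> x y -> ->]. Qed.

Lemma simplex2 v w : edge1 v w -> simplex [set v; w].
Proof.
move=> /adjacent_sym_edge[vw wv]; split; first by exists v; left.
  by rewrite finite_setU; split; exact: finite_set1.
by move=> x y [->|->] [->|->].
Qed.

Lemma simplex3 u v w : edge1 u v -> edge1 v w -> edge1 w u -> simplex [set u; v; w].
Proof.
move=> /adjacent_sym_edge[uv vu] /adjacent_sym_edge[vw wv] /adjacent_sym_edge[wu uw].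
split; first by exists v; left; right.
  by rewrite !finite_setU; do !split; exact: finite_set1.
by move=> x y [[->|->]|->] [[->|->]|->].
Qed.

End Action.

(** * The quotient map is an isomorphism on links *)

Section Quotient.
Variables (F : local_field) (Gam : set 'M[F]_3).
Hypothesis Gam_lattice : A2_lattice Gam.
Implicit Types (u v w : vertex F) (g : 'M[F]_3).
Local Notation q := (residue_card F).

Let Gam_unit g : Gam g -> g \in unitmx.
Proof. by case: Gam_lattice => -[H _ _ _] _ _ _ _; exact: H. Qed.

Let Gam_mul g h : Gam g -> Gam h -> Gam (g *m h).
Proof. by case: Gam_lattice => -[_ H _ _] _ _ _ _; exact: H. Qed.

Let Gam_inv g : Gam g -> Gam (invmx g).
Proof. by case: Gam_lattice => -[_ _ H _] _ _ _ _; exact: H. Qed.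

Let Gam1 : Gam 1%:M.
Proof. by case: Gam_lattice => -[_ _ _ H] _ _ _ _; apply: H; exact: oner_neq0. Qed.

Lemma orbit_act g v : Gam g -> orbit Gam (act g v) = orbit Gam v.
Proof.
move=> hg; have gu := Gam_unit hg; apply/seteqP; split=> [_ [h hh <-]|_ [h hh <-]].
  by exists (h *m g); [exact: Gam_mul|rewrite act_mul // Gam_unit].
exists (h *m invmx g); first by apply: Gam_mul => //; exact: Gam_inv.
by rewrite -act_mul ?mulmxKV // ?unitmx_mul ?unitmx_inv ?gu ?andbT; exact: Gam_unit.
Qed.

Lemma orbit_refl v : orbit Gam v v.
Proof. by exists 1%:M => //; rewrite -[1%:M]/(1%:M) act_scalar ?oner_neq0. Qed.

Lemma orbitP v w : orbit Gam v = orbit Gam w <-> exists2 g, Gam g & w = act g v.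
Proof.
split=> [E|[g hg ->]]; last by rewrite orbit_act.
by have := orbit_refl w; rewrite -E => -[g hg <-]; exists g.
Qed.

(** Stabilizers of vertices are open: h = g (1 + g^{-1} (h - g)), and the second factor is in
    GL_3(O) as soon as g^{-1} (h - g) is divisible by pi. *)
Lemma cls_close g : g \in unitmx ->
  exists n : int, forall h, h \in unitmx -> mx_close n h g -> cls h = cls g.
Proof.
move=> gu; have giu : invmx g \in unitmx by rewrite unitmx_inv.
have [c [d [c0 [ic _ _]]]] := scale_integral giu.
exists (ordv c + 1) => h hu hg.
pose X := invmx g *m (h - g).
have iX : intmx (uniformizer^-1 *: X).
  have -> : uniformizer^-1 *: X = (c *: invmx g) *m ((c * uniformizer)^-1 *: (h - g)).
    by rewrite -scalemxAl -scalemxAr scalerA invfM mulrA divff // mul1r.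
  apply: intmxM => // i j; rewrite mxE.
  have := hg i j; rewrite !mxE => -[->|ho]; first by rewrite mulr0; exact: integers0.
  have [->|x0] := eqVneq (h i j - g i j) 0; first by rewrite mulr0; exact: integers0.
  have cp0 : c * uniformizer != 0 by rewrite mulf_neq0 ?pi_neq0.
  right; rewrite ordvM ?invr_eq0 // ordvV // ordvM ?pi_neq0 // ordv_pi.
  by move: (ordv _) (ordv _) ho => x y; clear; lia.
have hE : h = g *m (1%:M + X).
  by rewrite mulmxDr mulmx1 /X mulKVmx // addrC subrK.
have XE : X = uniformizer *: (uniformizer^-1 *: X).
  by rewrite scalerA divff ?pi_neq0 // scale1r.
rewrite hE cls_mulr //.
have iX' : intmx X by rewrite XE; apply: intmxZ => //; exact: integers_pi.
have iX1 : intmx (1%:M + X).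
  by move=> i j; rewrite mxE; apply: integersD => //; exact: intmx1.
have r1 : redmx (1%:M + X) = 1%:M.
  apply/matrixP => i j; rewrite mxE mxE.
  have [-> _] := reductionDM (@intmx1 F 3 i j) (iX' i j).
  have /matrixP/(_ i j) : redmx X = 0 by rewrite XE redmx_piZ.
  rewrite !mxE => ->; rewrite addr0.
  by have /matrixP/(_ i j) := redmx1 F 3; rewrite !mxE.
have : reduction (\det (1%:M + X)) != 0 by rewrite red_det // r1 det1 oner_neq0.
by move/(red_neq0 (integers_det iX1)) => [? ?]; split.
Qed.

(** By [cls_close], the matrices whose vertex lies in a given orbit form an open Gam-invariant set.
    Cocompactness extracts finitely many of these sets, and each determines its orbit. Without
    finiteness the type [X0] would be empty. *)
Lemma finite_orbits : finite_set (range (orbit Gam)).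
Proof.
have [_ [_ coc] _ _ _] := Gam_lattice.
pose U v : set 'M[F]_3 := [set g | g \in unitmx /\ orbit Gam (cls g) = orbit Gam v].
have [|g gu|D [finD DC] cov] := coc (range U).
- move=> _ [v _ <-]; split.
    move=> g gu [_ gv]; have [n hn] := cls_close gu.
    by exists n => h hu hg; split=> //; rewrite hn.
  move=> g h hg [hu hv]; have gu := Gam_unit hg; split; first by rewrite unitmx_mul gu.
  by rewrite -act_cls // orbit_act.
- by exists (U (cls g)) => //; exists (cls g).
pose f (A : set 'M[F]_3) := orbit Gam (cls (xget 1%:M A)).
apply: (@sub_finite_set _ _ (f @` D)); last exact: finite_image.
move=> _ [v _ <-]; have [g gu vE] := cls_surj v; have [A DA Ag] := cov g gu.
exists A => //; have [w _ UA] := DC _ DA.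
have [_ gw] : U w g by rewrite UA.
have [_ xw] : U w (xget 1%:M A).
  by rewrite UA; case: xgetP => [y _ //|/(_ g)]; case.
by rewrite /f xw -gw vE.
Qed.

Lemma orbit_in v : orbit Gam v \in fset_set (range (orbit Gam)).
Proof. by rewrite in_fset_set; [apply/mem_set; exists v|exact: finite_orbits]. Qed.

Definition proj v : X0 Gam := FSetSub (orbit_in v).

Lemma proj_eq v w : proj v = proj w <-> orbit Gam v = orbit Gam w.
Proof.
split=> [/(congr1 val) //|E]; exact: val_inj.
Qed.

Lemma proj_surj (x : X0 Gam) : exists v, x = proj v.
Proof.
have := valP x; rewrite in_fset_set; last exact: finite_orbits.
rewrite inE => -[v _ vE]; exists v; exact: val_inj.
Qed.

Lemma overP (x : X0 Gam) v : over x v <-> x = proj v.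
Proof.
have [w ->] := proj_surj x; rewrite proj_eq orbitP; rewrite /over /=.
by split=> [[g hg E]|[g hg ->]]; exists g.
Qed.

Lemma proj_act g v : Gam g -> proj (act g v) = proj v.
Proof. by move=> hg; apply/proj_eq; exact: orbit_act. Qed.

Lemma proj_lift v w : proj v = proj w -> exists2 g, Gam g & w = act g v.
Proof. by move/proj_eq/orbitP. Qed.

Let simplex_orbits s v w : simplex s -> s v -> s w -> proj v = proj w -> v = w.
Proof.
case: Gam_lattice => _ _ _ _ [H _] hs sv sw /proj_eq; exact: H hs sv sw.
Qed.

Let simplex_lift (s t : set (vertex F)) : simplex s -> simplex t ->
  proj @` s = proj @` t -> exists2 g, Gam g & act g @` s = t.
Proof.
case: Gam_lattice => _ _ _ _ [_ H] hs ht E; apply: H => //.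
have imE (r : set (vertex F)) : orbit Gam @` r = val @` (proj @` r).
  by rewrite image_comp.
by rewrite !imE E.
Qed.

(** Simplices with the same image are translates of each other. The translation cannot swap the
    endpoints, as the projection is injective on an edge. *)
Let lift_edge v w v' w' : edge1 v w -> edge1 v' w' ->
  proj v = proj v' -> proj w = proj w' -> exists g, [/\ Gam g, v' = act g v & w' = act g w].
Proof.
move=> e e' pv pw.
have [g hg gE] : exists2 g, Gam g & act g @` [set v; w] = [set v'; w'].
  apply: (simplex_lift (simplex2 e) (simplex2 e')).
  by rewrite !image_setU !image_set1 pv pw.
exists g; have nvw : proj v' <> proj w'.
  move=> /(simplex_orbits (simplex2 e') (or_introl erefl) (or_intror erefl)).
  exact: edge1_neq e'.
have gv : [set v'; w'] (act g v) by rewrite -gE; exists v => //; left.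
have gw : [set v'; w'] (act g w) by rewrite -gE; exists w => //; right.
split=> //.
  by case: gv => // E; case: nvw; rewrite -pv -(proj_act v hg) E.
by case: gw => // E; case: nvw; rewrite -pw -(proj_act w hg) E.
Qed.

Let stab_trivial g v w : Gam g -> act g v = v -> act g w = w.
Proof.
move=> hg gv; case: Gam_lattice => _ _ _ H _.
have : is_scalar_mx g by apply: (H g [set v]) => //;
  [exact: simplex1|rewrite image_set1 gv].
move=> /is_scalar_mxP[c gE]; have := Gam_unit hg; rewrite gE => cu.
by apply: act_scalar; apply: contraTneq cu => ->; rewrite unitmxE det_scalar expr0n unitr0.
Qed.

(** [lift_edge] gives an element of Gam that fixes v and maps w to w'. Fixing a vertex, it is scalar
    and fixes w. *)
Lemma proj_inj_out v w w' : edge1 v w -> edge1 v w' -> proj w = proj w' -> w = w'.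
Proof.
move=> e e' pw; have [g [hg gv ->]] := lift_edge e e' erefl pw.
by rewrite (stab_trivial w hg (esym gv)).
Qed.

Lemma proj_inj_in v u u' : edge1 u v -> edge1 u' v -> proj u = proj u' -> u = u'.
Proof.
move=> e e' pu; have [g [hg -> gv]] := lift_edge e e' pu erefl.
by rewrite (stab_trivial u hg (esym gv)).
Qed.

Definition eX : rel (X0 Gam) := fun x y => `[< colored_edge 1 x y >].

Lemma eXP x y : eX x y <-> exists v w, [/\ x = proj v, y = proj w & edge1 v w].
Proof.
split=> [/asboolP[_ [v [w [/overP -> /overP -> vw cvw]]]]|[v [w [-> -> e]]]].
  by exists v, w; split=> //; apply/adjacent_color.
apply/asboolP; have [vw cvw] := (adjacent_color v w).2 e; split; last first.
  by exists v, w; split=> //; apply/overP.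
split.
  rewrite cards2 (_ : proj v != proj w) //; apply/eqP.
  move=> /(simplex_orbits (simplex2 e) (or_introl erefl) (or_intror erefl)).
  exact: edge1_neq e.
exists [set v; w]; first exact: simplex2.
move=> x0; rewrite !inE; split=> [/orP[/eqP ->|/eqP ->]|[z [->|->] /overP ->]].
- by exists v; [left|apply/overP].
- by exists w; [right|apply/overP].
- by rewrite eqxx.
- by rewrite eqxx orbT.
Qed.

Lemma eX_proj v w : edge1 v w -> eX (proj v) (proj w).
Proof. by move=> e; apply/eXP; exists v, w. Qed.

Lemma eX_out v y : eX (proj v) y -> exists2 w, edge1 v w & y = proj w.
Proof.
move=> /eXP[v' [w' [pv -> e]]]; have [g hg ->] := proj_lift (esym pv).
by exists (act g w'); [apply: edge1_act => //; exact: Gam_unit|rewrite proj_act].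
Qed.

Lemma eX_in v x : eX x (proj v) -> exists2 u, edge1 u v & x = proj u.
Proof.
move=> /eXP[u' [v' [-> pv e]]]; have [g hg ->] := proj_lift (esym pv).
by exists (act g u'); [apply: edge1_act => //; exact: Gam_unit|rewrite proj_act].
Qed.

(** Two opposite edges would lift to v -> w and w' -> v with w and w' in one orbit. An element of
    Gam carries {v, w} to {w', v}; it fixes v, so it maps the first edge to v -> w', against the
    orientation of the second. *)
Lemma eX_asym x y : eX x y -> ~ eX y x.
Proof.
move=> /eXP[v [w [-> -> e]]] /eX_in[w' e' pw].
have /eXP[v2 [w2 [pv2 pw2 e2]]] : eX (proj v) (proj w) by exact: eX_proj.
have [|g hg gE] := simplex_lift (simplex2 e) (simplex2 e').
  by rewrite !image_setU !image_set1 -pw setUC.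
have nvw : proj v <> proj w.
  move=> /(simplex_orbits (simplex2 e) (or_introl erefl) (or_intror erefl)).
  exact: edge1_neq e.
have gv : [set w'; v] (act g v) by rewrite -gE; exists v => //; left.
have gw : [set w'; v] (act g w) by rewrite -gE; exists w => //; right.
have {}gv : act g v = v.
  by case: gv => // E; case: nvw; rewrite -(proj_act v hg) E pw.
have {}gw : act g w = w'.
  by case: gw => // E; case: nvw; rewrite -(proj_act w hg) E.
apply: (edge1_asym e'); rewrite -gv -gw; apply: edge1_act => //; exact: Gam_unit.
Qed.

Definition triX (x y z : X0 Gam) : bool := `[< exists u v w,
  [/\ [/\ x = proj u, y = proj v & z = proj w], edge1 u v, edge1 v w & edge1 w u] >].

Lemma triX_rot x y z : triX x y z -> triX y z x.
Proof.
move=> /asboolP[u [v [w [[-> -> ->] uv vw wu]]]]; apply/asboolP.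
by exists v, w, u.
Qed.

Lemma triX_edge x y z : triX x y z -> eX x y.
Proof. by move=> /asboolP[u [v [w [[-> -> _] uv vw wu]]]]; exact: eX_proj. Qed.

(** A triangle of X through the image of v is translated to one through v itself; injectivity on the
    link identifies its other two vertices with u and w. *)
Lemma triX_lift u v w : edge1 u v -> edge1 v w ->
  triX (proj u) (proj v) (proj w) = `[< edge1 w u >].
Proof.
move=> uv vw; apply/asboolP/asboolP => [|wu]; last by exists u, v, w.
move=> [u' [v' [w' [[pu pv pw] uv' vw' wu']]]].
have [g hg vE] := proj_lift (esym pv); have gu := Gam_unit hg.
have -> : w = act g w'.
  apply: (@proj_inj_out v) => //; last by rewrite proj_act.
  by rewrite vE; apply: edge1_act.
have -> : u = act g u'.
  apply: (@proj_inj_in v) => //; last by rewrite proj_act.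
  by rewrite vE; apply: edge1_act.
exact: edge1_act.
Qed.

(** A 2-cell only provides pairwise adjacent lifts. By [eX_asym] two of the edges are oriented as in
    X, and colors then orient the third. *)
Lemma cell2_triX x y z : eX x y -> eX y z -> cell 2 [set x; y; z]%SET <-> triX x y z.
Proof.
move=> xy yz; split; last first.
  move=> /asboolP[u [v [w [[-> -> ->] uv vw wu]]]].
  have s3 := simplex3 uv vw wu.
  have inj a b : [set u; v; w] a -> [set u; v; w] b -> proj a = proj b -> a = b.
    exact: simplex_orbits s3.
  have U : [set u; v; w] u by left; left.
  have V : [set u; v; w] v by left; right.
  have W : [set u; v; w] w by right.
  split.
    rewrite finset.setUC cardsU1 cards2 !inE.
    have /eqP/negPf -> : proj u <> proj v by move=> /(inj _ _ U V); exact: edge1_neq.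
    have /eqP/negPf -> : proj w <> proj u by move=> /(inj _ _ W U); exact: edge1_neq.
    have /eqP/negPf -> : proj w <> proj v.
      by move=> /(inj _ _ W V)/esym; exact: edge1_neq.
    by [].
  exists [set u; v; w] => // x'; rewrite !inE.
  split=> [/orP[/orP[]|] /eqP ->|[a [[->|->]|->] /overP ->]]; rewrite ?eqxx ?orbT //.
  - by exists u => //; apply/overP.
  - by exists v => //; apply/overP.
  - by exists w => //; apply/overP.
move=> [c3 [s hs sE]].
have [u su /overP xu] : exists2 u, s u & over x u by apply/sE; rewrite !inE eqxx.
have [v sv /overP yv] : exists2 u, s u & over y u by apply/sE; rewrite !inE eqxx orbT.
have [w sw /overP zw] : exists2 u, s u & over z u by apply/sE; rewrite !inE eqxx !orbT.
have adj a b : s a -> s b -> a <> b -> adjacent a b by case: hs => _ _; exact.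
have neq a b : eX a b -> a <> b by move=> ab E; subst b; exact: (eX_asym ab ab).
have uv : edge1 u v.
  have /(adj _ _ su sv)/adjacentP[//|vu] : u <> v.
    by move=> E; apply: (neq _ _ xy); rewrite xu yv E.
  by case: (eX_asym xy); rewrite xu yv; exact: eX_proj.
have vw : edge1 v w.
  have /(adj _ _ sv sw)/adjacentP[//|wv] : v <> w.
    by move=> E; apply: (neq _ _ yz); rewrite yv zw E.
  by case: (eX_asym yz); rewrite yv zw; exact: eX_proj.
(* The opposite orientation u -> w would give w the color of u plus 1, while the path through v
   gives plus 2. *)
have wu : edge1 w u.
  have /(adj _ _ sw su)/adjacentP[//|uw] : w <> u.
    move=> E; move: c3; rewrite xu yv zw E finset.setUC finset.setUA finset.setUid cards2.
    by case: (_ != _).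
  have := color_edge1 uw; rewrite (color_edge1 vw) (color_edge1 uv) -addrA.
  by move=> /addrI /eqP; rewrite -subr_eq0 addrK oner_eq0.
by apply/asboolP; exists u, v, w.
Qed.

Lemma card_eX_out v (P : pred (X0 Gam)) :
  #|[pred y | eX (proj v) y && P y]| = count (fun w => P (proj w)) (outs v).
Proof.
rewrite -(count_map proj) -size_filter; apply/eqP.
have u : uniq [seq proj w | w <- outs v].
  rewrite map_inj_in_uniq ?outs_uniq // => w w' /mem_outs e /mem_outs e'.
  exact: proj_inj_out e e'.
rewrite -(card_uniqP _) ?filter_uniq //; apply/eqP; apply: eq_card => y.
rewrite inE mem_filter andbC; congr (_ && _).
apply/idP/mapP => [/eX_out[w e ->]|[w /mem_outs e ->]]; last exact: eX_proj.
by exists w => //; apply/mem_outs.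
Qed.

Lemma card_eX_in v (P : pred (X0 Gam)) :
  #|[pred x | eX x (proj v) && P x]| = count (fun u => P (proj u)) (ins v).
Proof.
rewrite -(count_map proj) -size_filter; apply/eqP.
have u : uniq [seq proj w | w <- ins v].
  rewrite map_inj_in_uniq ?ins_uniq // => w w' /mem_ins e /mem_ins e'.
  exact: proj_inj_in e e'.
rewrite -(card_uniqP _) ?filter_uniq //; apply/eqP; apply: eq_card => y.
rewrite inE mem_filter andbC; congr (_ && _).
apply/idP/mapP => [/eX_in[w e ->]|[w /mem_ins e ->]]; last exact: eX_proj.
by exists w => //; apply/mem_ins.
Qed.

Lemma X_plane_links : plane_links q eX triX.
Proof.
have T2 x y z : triX x y z -> eX y z by move/triX_rot/triX_edge.
split; first exact: triX_rot.
- exact: triX_edge.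
- move=> x; have [v ->] := proj_surj x.
  rewrite -(size_outs v) -count_predT; apply: etrans (card_eX_out v predT).
  by apply: eq_card => y; rewrite !inE andbT.
- move=> x; have [v ->] := proj_surj x.
  rewrite -(size_ins v) -count_predT; apply: etrans (card_eX_in v predT).
  by apply: eq_card => y; rewrite !inE andbT.
- move=> x y; have [v ->] := proj_surj y => /eX_in[u e ->].
  rewrite -(count_outs e).
  rewrite (eq_card (B := [pred z | eX (proj v) z && triX (proj u) (proj v) z])); last first.
    by move=> z; rewrite !inE; case: (boolP (triX _ _ _)) => [/T2 ->|]; rewrite ?andbF.
  rewrite card_eX_out; apply: eq_in_count => w /mem_outs e'.
  exact: triX_lift.
- move=> x x' y; have [v ->] := proj_surj y => /eX_in[u e ->] /eX_in[u' e' ->] neq.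
  have neq' : u != u' by apply: contraNneq neq => ->.
  rewrite -(count_outs2 e e' neq').
  rewrite (eq_card (B := [pred z | eX (proj v) z &&
      (triX (proj u) (proj v) z && triX (proj u') (proj v) z)])); last first.
    by move=> z; rewrite !inE; case: (boolP (triX (proj u) _ _)) => [/T2 ->|];
      rewrite ?andbF.
  rewrite card_eX_out; apply: eq_in_count => w /mem_outs e''.
  by rewrite !triX_lift.
- move=> y z z'; have [v ->] := proj_surj y => /eX_out[w e ->] /eX_out[w' e' ->] neq.
  have neq' : w != w' by apply: contraNneq neq => ->.
  rewrite -(count_ins2 e e' neq').
  rewrite (eq_card (B := [pred x | eX x (proj v) &&
      (triX x (proj v) (proj w) && triX x (proj v) (proj w'))])); last first.
    move=> x; rewrite !inE; case: (boolP (triX _ _ (proj w))) => [/triX_edge ->|] //=.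
    by rewrite andbF.
  rewrite card_eX_in; apply: eq_in_count => u /mem_ins e''.
  by rewrite !triX_lift.
Qed.

End Quotient.

(** * Normality of A_1 and its eigenvectors of maximal modulus *)

Section RegularDigraph.
Variables (T : finType) (e : rel T).

(* Both sides count the pairs (z, p) such that x, z, p and y, z, p are triangles. *)
Lemma plane_links_normal (R : rcfType) q tri x y : @plane_links T q e tri ->
  \sum_z (e x z)%:R * (e y z)%:R = \sum_z (e z x)%:R * (e z y)%:R :> R.
Proof.
move=> links; have [<-|xy] := eqVneq x y.
  under eq_bigr do rewrite -natrM mulnb andbb.
  under [RHS]eq_bigr do rewrite -natrM mulnb andbb.
  by rewrite (sum_out _ links) (sum_in _ links).
transitivity (\sum_z \sum_p (tri x z p && tri y z p)%:R : R).
  apply: eq_bigr => z _; rewrite -natrM mulnb sum_pred.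
  case: (boolP (e x z)) => xz; last first.
    rewrite eq_card0 // => p; rewrite !inE; apply/negP => /andP[/(tri_edge links)].
    by rewrite (negPf xz).
  case: (boolP (e y z)) => yz; last first.
    rewrite eq_card0 // => p; rewrite !inE; apply/negP => /andP[_ /(tri_edge links)].
    by rewrite (negPf yz).
  by rewrite (card_meet links xz yz xy).
rewrite exchange_big /=; apply: eq_bigr => p _; rewrite -natrM mulnb sum_pred.
rewrite (eq_card (B := [pred z | tri z p x && tri z p y])); last first.
  by move=> z; rewrite !inE !(triE links _ z p).
case: (boolP (e p x)) => px; last first.
  rewrite eq_card0 // => z; rewrite !inE; apply/negP => /andP[/(tri_edge2 links)].
  by rewrite (negPf px).
case: (boolP (e p y)) => py; last first.
  rewrite eq_card0 // => z; rewrite !inE; apply/negP => /andP[_ /(tri_edge2 links)].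
  by rewrite (negPf py).
by rewrite (card_join links px py xy).
Qed.

(* The sum of |f y - z f x|^2 over the edges x -> y, where z = lam / N, vanishes. *)
Lemma maximal_eigenvector (C : numClosedFieldType) (N : nat) (f : T -> C) (lam : C) :
  (0 < N)%N -> (forall x, #|[pred y | e x y]| = N) -> (forall y, #|[pred x | e x y]| = N) ->
  `|lam| = N%:R -> (forall x, \sum_(y | e x y) f y = lam * f x) ->
  forall x y, e x y -> f y = lam / N%:R * f x.
Proof.
move=> N0 outN inN lamN eig; have [z zE] : exists z, z = lam / N%:R by exists (lam / N%:R).
rewrite -zE.
have N0' : N%:R != 0 :> C by rewrite pnatr_eq0 -lt0n.
have zz : z * z^* = 1.
  by rewrite -normCK zE normrM lamN normfV normr_nat divff ?expr1n.
have lamE : lam = N%:R * z by rewrite zE mulrCA divff ?mulr1.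
have S0 : \sum_x \sum_(y | e x y) `|f y - z * f x| ^+ 2 = 0.
  have expand x y : `|f y - z * f x| ^+ 2 =
      `|f y| ^+ 2 + `|f x| ^+ 2 - ((z * f x)^* * f y + (f y)^* * (z * f x)).
    rewrite normCK rmorphB rmorphM /=.
    have -> : `|f x| ^+ 2 = z * z^* * (f x * (f x)^*) by rewrite zz mul1r normCK.
    by rewrite normCK; ring.
  have sumN x (c : C) : \sum_(y | e x y) c = N%:R * c.
    by rewrite big_const iter_addr_0 -(outN x) mulr_natl.
  have row x : \sum_(y | e x y) `|f y - z * f x| ^+ 2 =
      \sum_(y | e x y) `|f y| ^+ 2 - N%:R * `|f x| ^+ 2.
    under eq_bigr do rewrite expand.
    rewrite sumrB !big_split /= sumN -!mulr_sumr -mulr_suml -rmorph_sum eig /=.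
    rewrite lamE !rmorphM /= conjC_nat normCK.
    set P := f x * (f x)^*; set S := \sum_(y | e x y) _.
    transitivity (S + N%:R * P - z * z^* * (N%:R * P + N%:R * P)); first by rewrite /P;
      ring.
    by rewrite zz; ring.
  under eq_bigr do rewrite row.
  rewrite sumrB (exchange_big_dep xpredT) //= -sumrB big1 // => y _.
  by rewrite big_const iter_addr_0 -(inN y) mulr_natl subrr.
move=> x y xy; apply/eqP; rewrite -subr_eq0 -normr_eq0 -sqrf_eq0.
have ge0 x' y' : 0 <= `|f y' - z * f x'| ^+ 2 by rewrite exprn_ge0.
have /(_ x isT)/eqP := psumr_eq0P (fun x _ => sumr_ge0 _ (fun y _ => ge0 x y)) S0.
rewrite psumr_eq0 => [/allP/(_ y)|y' _]; last exact: ge0.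
by rewrite mem_index_enum xy => /(_ isT).
Qed.

End RegularDigraph.

(** * The nontrivial spectrum of the quotient *)

Section QuotientSpectrum.
Variables (R : realType) (F : local_field) (Gam : set 'M[F]_3).
Hypothesis Gam_lattice : A2_lattice Gam.
Local Notation q := (residue_card F).
Local Notation N := (q ^ 2 + q + 1)%N.
Local Notation eX := (@eX F Gam).
Local Notation proj := (proj Gam_lattice).

(** Lifted to the building, f is multiplied by zeta along each edge of color one. Closed paths of X
    whose lengths are 3 and some d prime to 3, the latter because Gam moves a color, force zeta = 1;
    connectedness then makes f constant. *)
Lemma trivial_eigenvector_const (f : X0 Gam -> R[i]) (zeta : R[i]) : ~ tripartite Gam ->
  (forall x y, eX x y -> f y = zeta * f x) -> (exists x, f x != 0) ->
  exists c, forall x, f x = c.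
Proof.
move=> ntri fz [x0 fx0].
pose G v := f (proj v).
have Gz v w : edge1 v w -> G w = zeta * G v by move=> e; apply: fz; exact: eX_proj.
have path g h : g \in unitmx -> h \in unitmx ->
    exists d, G (cls h) = zeta ^+ d * G (cls g).
  move=> gu hu; have mu : invmx g *m h \in unitmx by rewrite unitmx_mul unitmx_inv gu.
  have [c [d [c0 hm]]] := scale_integral mu; exists d.
  rewrite -(edge1_path Gz gu hm) -scalemxAr mulKVmx // cls_scale //.
have [g [v [hg nc]]] : exists g v, Gam g /\ color (act g v) <> color v.
  apply: contrapT => H; apply: ntri => g v hg; apply: contrapT => nc.
  by apply: H; exists g, v.
have gu : g \in unitmx by case: Gam_lattice => -[+ _ _ _] _ _ _ _; apply.
have [h hu vE] := cls_surj v.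
have Gv0 : G v != 0.
  have [w xw] := proj_surj Gam_lattice x0; have [y yu wE] := cls_surj w.
  have [d Gd] := path _ _ hu yu; move: fx0; rewrite xw -/(G w) wE Gd -vE.
  by rewrite mulf_eq0 negb_or => /andP[].
(* The matrix pi has determinant valuation 3 and fixes every vertex: a closed path of length 3. *)
have z3 : zeta ^+ 3 = 1.
  have h1 : intdet 3%:Z (@uniformizer F *: (1%:M : 'M[F]_3)).
    split; first by apply: intmxZ; [exact: integers_pi|exact: intmx1].
      by rewrite detZ det1 mulr1 expf_neq0 ?pi_neq0.
    by rewrite detZ det1 mulr1 ordvX ?pi_neq0 // ordv_pi.
  have := edge1_path Gz hu h1; rewrite -scalemxAr mulmx1 cls_scale ?pi_neq0 //.
  rewrite -vE -{1}[G v]mul1r => /(mulIf Gv0) <-; exact: erefl.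
have mu : invmx h *m (g *m h) \in unitmx by rewrite !unitmx_mul unitmx_inv hu gu.
have [c [d [c0 hm]]] := scale_integral mu.
have zd : zeta ^+ d = 1.
  have := edge1_path Gz hu hm; rewrite -scalemxAr mulKVmx // cls_scale ?unitmx_mul ?gu //.
  rewrite -act_cls // -vE /G proj_act // -{1}[f _]mul1r => /(mulIf Gv0) <-.
  exact: erefl.
(* Modulo 3, d is the amount by which g changes the color. *)
have d3 : ~~ (3 %| d)%N.
  apply/negP => d3; case: nc; rewrite vE act_cls // !color_cls ?unitmx_mul ?gu //.
  have g0 : \det g != 0 by rewrite -unitfE -unitmxE.
  have h0 : \det h != 0 by rewrite -unitfE -unitmxE.
  case: hm => _ _; rewrite detZ !det_mulmx det_inv.
  move: g0 h0; move: (\det g) (\det h) => a b a0 b0.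
  have -> : c ^+ 3 * (b^-1 * (a * b)) = c ^+ 3 * a by field.
  rewrite (ordvM a0 b0) (ordvM (expf_neq0 3 c0) a0) ordvX // => dE.
  have aE : ordv a = d%:Z - ordv c *+ 3 by rewrite -dE addrC addKr.
  have Z3 : 3%:R = 0 :> 'Z_3 by apply: val_inj.
  rewrite intrD -[RHS]add0r; congr (_ + _).
  rewrite aE rmorphB rmorphMn /= -[X in _ - X]mulr_natr Z3 mulr0 subr0.
  by move/dvdnP: d3 => [j ->]; rewrite -pmulrn natrM Z3 mulr0.
have z1 : zeta = 1.
  move: zd d3; rewrite {1}(divn_eq d 3) exprD mulnC exprM z3 expr1n mul1r /dvdn.
  have : (d %% 3 < 3)%N by rewrite ltn_mod.
  case: (d %% 3)%N => [|[|[|]]] // _; rewrite ?expr1 // => z2 _.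
  by move: z3; rewrite exprS z2 mulr1.
exists (G v) => x; have [w ->] := proj_surj Gam_lattice x.
have [y yu wE] := cls_surj w; have [d' Gd] := path _ _ hu yu.
by rewrite -/(G w) wE Gd -vE z1 expr1n mul1r.
Qed.

Lemma heckeX_eigenvalue_bound (f : X0 Gam -> R[i]) (lam : R[i]) :
  ~ tripartite Gam -> ramanujan R Gam -> (exists x, f x != 0) ->
  (forall x, \sum_y (real_complex R) (eX x y)%:R * f y = lam * f x) ->
  normc lam <= 10 * Num.sqrt q%:R ^+ 3 \/ exists c, forall x, f x = c.
Proof.
move=> ntri ram f0 eig.
have eig' x : \sum_(y | eX x y) f y = lam * f x.
  rewrite -eig big_mkcond; apply: eq_bigr => y _.
  by case: (eX x y); rewrite ?rmorph1 ?mul1r ?rmorph0 ?mul0r.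
have [triv|spec] := ram 1 (mem_head _ _) lam (ex_intro2 _ _ f f0 eig').
  right; have links := X_plane_links Gam_lattice.
  apply: (trivial_eigenvector_const ntri _ f0).
  apply: (@maximal_eigenvector _ eX _ N f lam) => //; first by rewrite addn1.
  - exact: card_out links.
  - exact: card_in links.
  - by rewrite normcE triv rmorph_nat.
left; rewrite leNgt; apply/negP => lt; apply: spec.
exact: hecke1_resolvent.
Qed.

Lemma out_sum_bound (f : X0 Gam -> R) :
  ~ tripartite Gam -> ramanujan R Gam -> \sum_x f x = 0 ->
  l2norm (out_sum eX f) <= 10 * Num.sqrt q%:R ^+ 3 * l2norm f.
Proof.
move=> ntri ram f0; have links := X_plane_links Gam_lattice.
have a0 : 0 <= 10 * Num.sqrt q%:R ^+ 3 :> R by rewrite mulr_ge0 ?exprn_ge0 ?sqrtr_ge0.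
rewrite -(ler_pXn2r (n := 2)) ?nnegrE ?mulr_ge0 ?l2norm_ge0 // exprMn !sqr_l2norm.
apply: (@normal_kernel_bound R _ (fun x y => (eX x y)%:R)) => //.
  by move=> x y; exact: plane_links_normal links.
move=> g lam g0 eig; exact: heckeX_eigenvalue_bound ntri ram g0 eig.
Qed.

(** A normal matrix and its transpose give vectors of the same norm. *)
Lemma in_sum_bound (f : X0 Gam -> R) :
  ~ tripartite Gam -> ramanujan R Gam -> \sum_x f x = 0 ->
  l2norm (in_sum eX f) <= 10 * Num.sqrt q%:R ^+ 3 * l2norm f.
Proof.
move=> ntri ram f0; suff -> : l2norm (in_sum eX f) = l2norm (out_sum eX f).
  exact: out_sum_bound.
have sq (k : X0 Gam -> X0 Gam -> R) : \sum_z (\sum_x k z x * f x) ^+ 2 =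
    \sum_x \sum_y f x * f y * \sum_z k z x * k z y.
  under eq_bigr => z _ do rewrite expr2 big_distrlr /=.
  rewrite exchange_big /=; apply: eq_bigr => x _.
  rewrite exchange_big /=; apply: eq_bigr => y _.
  by rewrite mulr_sumr; apply: eq_bigr => z _; ring.
rewrite /l2norm (sq (fun z x => (eX x z)%:R)) (sq (fun z x => (eX z x)%:R)).
congr Num.sqrt; apply: eq_bigr => x _; apply: eq_bigr => y _; congr (_ * _).
by rewrite (plane_links_normal R x y (X_plane_links Gam_lattice)).
Qed.

End QuotientSpectrum.

(** * The spectrum of the geodesic graph *)

Section BipartiteEigenvectors.
Variables (C : numClosedFieldType) (X P : finType) (m : X -> P -> C).
Hypothesis m_real : forall x p, (m x p)^* = m x p.

Definition dot (T : finType) (f g : T -> C) : C := \sum_x f x * (g x)^*.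

Record bip_eigen (f : X -> C) (g : P -> C) (mu : C) : Prop := BipEigen {
  bip_left : forall x, \sum_p m x p * g p = mu * f x;
  bip_right : forall p, \sum_x m x p * f x = mu * g p;
  bip_real : mu^* = mu }.

Lemma dotE (T : finType) (f : T -> C) : dot f f = \sum_x `|f x| ^+ 2.
Proof. by apply: eq_bigr => x _; rewrite normCK. Qed.

Lemma dot_ge0 (T : finType) (f : T -> C) : 0 <= dot f f.
Proof. by rewrite dotE sumr_ge0 // => x _; rewrite exprn_ge0. Qed.

Lemma dotC (T : finType) (f g : T -> C) : dot f g = (dot g f)^*.
Proof.
by rewrite rmorph_sum; apply: eq_bigr => x _; rewrite rmorphM /= conjCK mulrC.
Qed.

(** Both sides are the sum over x and p of m x p times f1 x times the conjugate of g2 p, evaluated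
    first along x or first along p. *)
Lemma bip_eigen_dot f1 g1 mu1 f2 g2 mu2 : bip_eigen f1 g1 mu1 -> bip_eigen f2 g2 mu2 ->
  mu1 * dot g1 g2 = mu2 * dot f1 f2.
Proof.
move=> [l1 r1 e1] [l2 r2 e2]; rewrite !mulr_sumr.
transitivity (\sum_p \sum_x f1 x * (m x p * g2 p)^*).
  apply: eq_bigr => p _; rewrite mulrA -r1 mulr_suml; apply: eq_bigr => x _.
  by rewrite rmorphM /= m_real; ring.
rewrite exchange_big /=; apply: eq_bigr => x _.
by rewrite -mulr_sumr -rmorph_sum l2 rmorphM /= e2 mulrCA.
Qed.

Lemma bip_eigen_norm f g mu : bip_eigen f g mu -> mu != 0 -> dot g g = dot f f.
Proof. by move=> H mu0; apply: (mulfI mu0); exact: bip_eigen_dot. Qed.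

Lemma bip_eigen_bound f g mu K : bip_eigen f g mu -> 0 < mu -> 0 < dot f f ->
  (forall h : X -> C,
     \sum_p `|\sum_x m x p * h x| ^+ 2 <= K * \sum_x `|h x| ^+ 2) ->
  mu ^+ 2 <= K.
Proof.
move=> H mu0 f0 /(_ f); under eq_bigr do rewrite (bip_right H) normrM exprMn.
by rewrite -mulr_sumr -!dotE (bip_eigen_norm H) ?gt_eqF // ler_pM2r // (ger0_norm (ltW
  mu0)).
Qed.

(** A Courant-Fischer argument. The parts on X of the two eigenvectors are orthogonal and span a
    plane on which the form exceeds b^2; this plane meets the hyperplane of functions with sum zero,
    where the form is at most b^2. *)
Lemma bip_eigen2_bound f1 g1 mu1 f2 g2 mu2 b :
  bip_eigen f1 g1 mu1 -> bip_eigen f2 g2 mu2 ->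
  dot f1 f2 + dot g1 g2 = 0 -> 0 < dot f1 f1 -> 0 < dot f2 f2 -> 0 <= b ->
  b < mu1 -> b < mu2 ->
  (forall h : X -> C, \sum_x h x = 0 ->
     \sum_p `|\sum_x m x p * h x| ^+ 2 <= b ^+ 2 * \sum_x `|h x| ^+ 2) -> False.
Proof.
move=> H1 H2 orth f1_gt0 f2_gt0 b0 b1 b2 bound.
have m1 := le_lt_trans b0 b1; have m2 := le_lt_trans b0 b2.
have gf : dot g1 g2 = dot f1 f2.
  have e1 := bip_eigen_dot H1 H2.
  have e2 : mu2 * dot g1 g2 = mu1 * dot f1 f2.
    have := bip_eigen_dot H2 H1 => /(congr1 (fun z => z^*)).
    by rewrite !rmorphM /= -!dotC (bip_real H1) (bip_real H2).
  (* The two relations are added; as mu1 + mu2 > 0, orthogonality of the whole vectors splits into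
     orthogonality on each side. *)
  have : (mu1 + mu2) * (dot g1 g2 - dot f1 f2) = 0.
    by rewrite mulrBr !mulrDl e1 e2; ring.
  by move/eqP; rewrite mulf_eq0 gt_eqF ?addr_gt0 //= subr_eq0 => /eqP.
have f12 : dot f1 f2 = 0.
  by move: orth; rewrite gf -mulr2n => /eqP; rewrite mulrn_eq0 /= => /eqP.
have g12 : dot g1 g2 = 0 by rewrite gf.
(* Some combination of the two eigenvectors is orthogonal to the constants. *)
pose S1 := \sum_x f1 x; pose S2 := \sum_x f2 x.
have [al [be [nz S0]]] : exists al be, (al != 0) || (be != 0) /\ al * S1 + be * S2 = 0.
  have [S20|S20] := eqVneq S2 0.
    by exists 0, 1; rewrite oner_neq0 orbT S20 mul0r mulr0 addr0.
  by exists S2, (- S1); rewrite S20; split=> //; ring.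
have dot_comb (T : finType) (a1 a2 : T -> C) (c1 c2 : C) : dot a1 a2 = 0 ->
    \sum_x `|c1 * a1 x + c2 * a2 x| ^+ 2 =
    `|c1| ^+ 2 * dot a1 a1 + `|c2| ^+ 2 * dot a2 a2.
  move=> a12; have a21 : dot a2 a1 = 0 by rewrite dotC a12 rmorph0.
  transitivity (c1 * c1^* * dot a1 a1 + c1 * c2^* * dot a1 a2
     + c2 * c1^* * dot a2 a1 + c2 * c2^* * dot a2 a2).
    rewrite /dot !mulr_sumr -!big_split /=; apply: eq_bigr => x _.
    by rewrite normCK rmorphD !rmorphM /=; ring.
  by rewrite a12 a21 !mulr0 !addr0 !normCK.
have := bound (fun x => al * f1 x + be * f2 x).
rewrite big_split /= -!mulr_sumr => /(_ S0).
rewrite (dot_comb _ _ _ _ _ f12).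
under eq_bigr => p _.
  rewrite (_ : \sum_x _ = (al * mu1) * g1 p + (be * mu2) * g2 p); last first.
    rewrite -2!mulrA -(bip_right H1) -(bip_right H2) !mulr_sumr -big_split /=.
    by apply: eq_bigr => x _; ring.
  over.
rewrite (dot_comb _ _ _ _ _ g12) (bip_eigen_norm H1) ?gt_eqF //.
rewrite (bip_eigen_norm H2) ?gt_eqF // !normrM !exprMn (ger0_norm (ltW m1)) (ger0_norm
  (ltW m2)).
apply/negP; rewrite lt_geF //.
have sqb (mu : C) : b < mu -> b ^+ 2 < mu ^+ 2.
  by move=> bm; rewrite ltrXn2r // ?nnegrE // (le_trans b0) // ltW.
have le1 : b ^+ 2 * (`|al| ^+ 2 * dot f1 f1) <= `|al| ^+ 2 * mu1 ^+ 2 * dot f1 f1.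
  by rewrite mulrA [b ^+ 2 * _]mulrC ler_wpM2r ?dot_ge0 // ler_wpM2l ?exprn_ge0 // ltW ?sqb.
have le2 : b ^+ 2 * (`|be| ^+ 2 * dot f2 f2) <= `|be| ^+ 2 * mu2 ^+ 2 * dot f2 f2.
  by rewrite mulrA [b ^+ 2 * _]mulrC ler_wpM2r ?dot_ge0 // ler_wpM2l ?exprn_ge0 // ltW ?sqb.
rewrite mulrDr; case/orP: nz => nz.
  apply: ltr_leD => //.
  by rewrite mulrA [b ^+ 2 * _]mulrC ltr_pM2r // ltr_pM2l ?sqb // exprn_gt0 // ?normr_gt0.
apply: ler_ltD => //.
by rewrite mulrA [b ^+ 2 * _]mulrC ltr_pM2r // ltr_pM2l ?sqb // exprn_gt0 // ?normr_gt0.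
Qed.

End BipartiteEigenvectors.

(** * The two largest eigenvalues of a biregular bipartite graph *)

Section BipartiteSpectrum.
Variables (R : realType) (X P : finType) (m : X -> P -> R).
Local Notation C := R[i].
Local Notation toC := (real_complex R).

Definition bip_adj (a b : X + P) : R :=
  match a, b with
  | inl x, inr p | inr p, inl x => m x p
  | _, _ => 0
  end.

Definition bip_mx : 'M[R]_#|{: X + P}| :=
  \matrix_(a, b) bip_adj (enum_val a) (enum_val b).

Lemma sqr_normcE (z : C) : `|z| ^+ 2 = toC (complex.Re z ^+ 2 + complex.Im z ^+ 2).
Proof. by rewrite normcE -rmorphXn /= sqr_normc. Qed.

(** The predicate Q stands for a condition inherited by real and imaginary parts: none for the first
    eigenvalue, sum zero for the second. *)
Lemma complex_form_bound (Q : (X -> R) -> Prop) (K : R) (h : X -> C) :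
  (forall f : X -> R, Q f -> \sum_p (\sum_x m x p * f x) ^+ 2 <= K * \sum_x f x ^+ 2) ->
  Q (fun x => complex.Re (h x)) -> Q (fun x => complex.Im (h x)) ->
  \sum_p `|\sum_x toC (m x p) * h x| ^+ 2 <= toC K * \sum_x `|h x| ^+ 2.
Proof.
move=> H Qr Qi.
have sumRe (z : X -> C) : complex.Re (\sum_x z x) = \sum_x complex.Re (z x).
  by elim/big_rec2: _ => // x y w _ <-; case: (z x) w => [? ?] [].
have sumIm (z : X -> C) : complex.Im (\sum_x z x) = \sum_x complex.Im (z x).
  by elim/big_rec2: _ => // x y w _ <-; case: (z x) w => [? ?] [].
have ReM (r : R) (z : C) : complex.Re (toC r * z) = r * complex.Re z.
  by case: z => a' b' /=; rewrite mul0r subr0.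
have ImM (r : R) (z : C) : complex.Im (toC r * z) = r * complex.Im z.
  by case: z => a' b' /=; rewrite mul0r addr0.
under eq_bigr do rewrite sqr_normcE sumRe sumIm.
under [X in _ <= _ * X]eq_bigr do rewrite sqr_normcE.
rewrite -!(raddf_sum toC) -rmorphM lecR !big_split /= mulrDr.
apply: lerD.
  under eq_bigr => p _ do under eq_bigr do rewrite ReM.
  exact: H Qr.
under eq_bigr => p _ do under eq_bigr do rewrite ImM.
exact: H Qi.
Qed.

Lemma sorted_ge_nth (s : seq R) i j : sorted >=%R s -> (i <= j)%N -> (j < size s)%N ->
  s`_j <= s`_i.
Proof.
move=> ss ij js; apply: (sorted_leq_nth _ _ 0 ss) => //.
- by move=> x y z xy yz; exact: le_trans yz xy.
- exact: lexx.
- by rewrite inE (leq_ltn_trans ij).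
Qed.

Variables (c d b : R).
Hypothesis m_ge0 : forall x p, 0 <= m x p.
Hypothesis c_gt0 : 0 < c.
Hypothesis d_gt0 : 0 < d.
Hypothesis X_inh : (0 < #|X|)%N.
Hypothesis sum_x : forall p, \sum_x m x p = c.
Hypothesis sum_p : forall x, \sum_p m x p = d.
Hypothesis b_ge0 : 0 <= b.
Hypothesis form_bound : forall f : X -> R, \sum_x f x = 0 ->
  \sum_p (\sum_x m x p * f x) ^+ 2 <= b ^+ 2 * \sum_x f x ^+ 2.

(** Cauchy-Schwarz for the weights m x p, that is Schur's test with constant weights. *)
Lemma form_bound_top (f : X -> R) :
  \sum_p (\sum_x m x p * f x) ^+ 2 <= (c * d) * \sum_x f x ^+ 2.
Proof.
have cs p : (\sum_x m x p * f x) ^+ 2 <= c * \sum_x m x p * f x ^+ 2.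
  rewrite -(sum_x p).
  have := @cauchy_schwarz_sum X R (fun x => Num.sqrt (m x p)) (fun x =>
    Num.sqrt (m x p) * f x).
  under eq_bigr do rewrite mulrA -expr2 sqr_sqrtr //.
  under [X in _ <= X * _]eq_bigr do rewrite sqr_sqrtr //.
  by under [X in _ <= _ * X]eq_bigr do rewrite exprMn sqr_sqrtr //.
apply: le_trans (ler_sum _ (fun p _ => cs p)) _.
rewrite -mulr_sumr exchange_big /= -mulrA ler_wpM2l ?(ltW c_gt0) // mulr_sumr.
by apply: ler_sum => x _; rewrite -mulr_suml sum_p.
Qed.

Lemma bip_mx_sym : bip_mx^T = bip_mx.
Proof.
by apply/matrixP => i j; rewrite !mxE; case: (enum_val i) (enum_val j) => [?|?] [?|?].
Qed.

Lemma sum_enum_bip (V : nmodType) (G : X + P -> V) :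
  \sum_(i < #|{: X + P}|) G (enum_val i) = \sum_x G (inl x) + \sum_p G (inr p).
Proof.
rewrite -(big_sumType _ xpredT G) /=.
rewrite [RHS](reindex (fun i : 'I_#|{: X + P}| => enum_val i)) //=.
exact: onW_bij (enum_val_bij _).
Qed.

Lemma bip_eigen_row (v : 'rV[C]_#|{: X + P}|) (mu : R) :
  v *m map_mx toC bip_mx = toC mu *: v ->
  bip_eigen (fun x p => toC (m x p)) (fun x => v 0 (enum_rank (inl x)))
    (fun p => v 0 (enum_rank (inr p))) (toC mu).
Proof.
move=> /matrixP H; split; last exact: conjc_real.
- move=> x; have := H 0 (enum_rank (inl x)); rewrite !mxE => <-.
  rewrite -[RHS]/(\sum_(i < #|{: X + P}|) v 0 i * map_mx toC bip_mx i (enum_rank (inl x))).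
  rewrite (eq_bigr (fun i => v 0 (enum_rank (enum_val i)) *
     toC (bip_adj (enum_val i) (inl x)))); last first.
    by move=> i _; rewrite !mxE enum_valK enum_rankK.
  rewrite (sum_enum_bip (fun a => v 0 (enum_rank a) * toC (bip_adj a (inl x)))) /=.
  rewrite [X in X + _]big1 ?add0r => [|y _]; last exact: mulr0.
  by apply: eq_bigr => p _; rewrite mulrC.
- move=> p; have := H 0 (enum_rank (inr p)); rewrite !mxE => <-.
  rewrite -[RHS]/(\sum_(i < #|{: X + P}|) v 0 i * map_mx toC bip_mx i (enum_rank (inr p))).
  rewrite (eq_bigr (fun i => v 0 (enum_rank (enum_val i)) *
     toC (bip_adj (enum_val i) (inr p)))); last first.
    by move=> i _; rewrite !mxE enum_valK enum_rankK.
  rewrite (sum_enum_bip (fun a => v 0 (enum_rank a) * toC (bip_adj a (inr p)))) /=.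
  rewrite [X in _ + X]big1 ?addr0 => [|y _]; last exact: mulr0.
  by apply: eq_bigr => x _; rewrite mulrC.
Qed.

Let m_real x p : (toC (m x p))^* = toC (m x p). Proof. exact: conjc_real. Qed.

(** The vector equal to the square root of d on X and of c on P is an eigenvector, and
    [form_bound_top] shows that its eigenvalue is maximal. The bound b then comes from
    [bip_eigen2_bound]. *)
Lemma bip_spectrum :
  nth 0 (spectrum bip_mx) 0 = Num.sqrt (c * d) /\ nth 0 (spectrum bip_mx) 1 <= b.
Proof.
have [size_s [sorted_s charE] [Q QU Qrow]] := spectrum_symP bip_mx_sym.
move: size_s sorted_s charE Qrow; set s := spectrum bip_mx => size_s sorted_s charE Qrow.
have QQ : Q *m (Q ^t* )%sesqui = 1%:M by apply/unitarymxP.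
pose f i x := Q i (enum_rank (inl x)); pose g i p := Q i (enum_rank (inr p)).
have eig i : bip_eigen (fun x p => toC (m x p)) (f i) (g i) (toC s`_i).
  have := bip_eigen_row (Qrow i).
  have E (a : X + P) : row i Q 0 (enum_rank a) = Q i (enum_rank a) by rewrite mxE.
  by case=> l r re; split=> [x|p|//]; [have := l x; rewrite E|have := r p; rewrite E];
     under eq_bigr do rewrite E.
have orth i j : dot (f i) (f j) + dot (g i) (g j) = (i == j)%:R.
  have /matrixP/(_ i j) := QQ; rewrite [RHS]mxE mxE => <-.
  rewrite (eq_bigr (fun l =>
    Q i (enum_rank (enum_val l)) * (Q j (enum_rank (enum_val l)))^* )); last first.
    by move=> l _; rewrite !mxE enum_valK.
  by rewrite (sum_enum_bip (fun a => Q i (enum_rank a) * (Q j (enum_rank a))^* )).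
have n_gt0 : (0 < #|{: X + P}|)%N by rewrite card_sum addn_gt0 X_inh.
(* For a positive eigenvalue, the two parts of a unit eigenvector have equal norms, so neither
   vanishes. *)
have f_gt0 (i : 'I_#|{: X + P}|) : 0 < s`_i -> 0 < dot (f i) (f i).
  move=> si; have := orth i i; rewrite eqxx (bip_eigen_norm m_real (eig i)); last first.
    by rewrite gt_eqF // ltcR.
  move=> ff; rewrite lt_def dot_ge0 andbT; apply/eqP => f0.
  by move/eqP: ff; rewrite f0 addr0 eq_sym oner_eq0.
have cd0 : 0 < c * d by rewrite mulr_gt0.
have top_in : Num.sqrt (c * d) \in s.
  pose v : 'rV[R]_#|{: X + P}| := \row_i
    (match enum_val i with inl _ => Num.sqrt d | inr _ => Num.sqrt c end).
  have vE : v *m bip_mx = Num.sqrt (c * d) *: v.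
    apply/rowP => j; rewrite !mxE.
    rewrite (eq_bigr (fun i => (match enum_val i with inl _ => Num.sqrt d | inr _ =>
      Num.sqrt c end)
       * bip_adj (enum_val i) (enum_val j))); last by move=> i _; rewrite !mxE.
    rewrite (sum_enum_bip (fun a => (match a with inl _ => Num.sqrt d | inr _ =>
      Num.sqrt c end)
       * bip_adj a (enum_val j))) sqrtrM ?ltW //.
    case: (enum_val j) => [x|p] /=.
      rewrite big1 ?add0r => [|y _]; last by rewrite mulr0.
      by rewrite -mulr_sumr sum_p -{1}(sqr_sqrtr (ltW d_gt0)) expr2 mulrA.
    rewrite [X in _ + X]big1 ?addr0 => [|y _]; last by rewrite mulr0.
    by rewrite -mulr_sumr sum_x -{1}(sqr_sqrtr (ltW c_gt0)) expr2; ring.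
  have v0 : v != 0.
    apply/eqP => /rowP/(_ (Ordinal n_gt0)); rewrite !mxE => /eqP.
    by case: (enum_val _) => ?; rewrite gt_eqF // sqrtr_gt0.
  have : root (char_poly bip_mx) (Num.sqrt (c * d)).
    by rewrite -eigenvalue_root_char; apply/eigenvalueP; exists v.
  by rewrite charE root_prod_XsubC.
have sqrt_gt0 : 0 < Num.sqrt (c * d) by rewrite sqrtr_gt0.
have ge0 : Num.sqrt (c * d) <= s`_0.
  have [j js <-] : exists2 j, (j < size s)%N & s`_j = Num.sqrt (c * d).
    by exists (index (Num.sqrt (c * d)) s); rewrite ?index_mem ?nth_index.
  exact: sorted_ge_nth.
split.
  apply: le_anti; rewrite ge0 andbT.
  pose i0 := Ordinal n_gt0; have s0 : 0 < s`_i0 by exact: lt_le_trans ge0.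
  have H := @bip_eigen_bound _ X P _ m_real _ _ _ (toC (c * d)) (eig i0).
  have : toC s`_i0 ^+ 2 <= toC (c * d).
    apply: H; [by rewrite ltcR|exact: f_gt0|].
    by move=> h; apply: (@complex_form_bound (fun=> True)) => // f' _;
      exact: form_bound_top.
  rewrite -rmorphXn lecR => H2.
  by rewrite -(ler_pXn2r (n := 2)) ?nnegrE ?sqrtr_ge0 ?(ltW s0) // sqr_sqrtr // (ltW cd0).
(* If there is no second eigenvalue, [nth] returns its default 0, which is at most b. *)
have [s2|s1] := ltnP 1 (size s); last by rewrite nth_default.
rewrite leNgt; apply/negP => lt_b.
have n1 : (1 < #|{: X + P}|)%N by rewrite -size_s.
pose i0 := Ordinal n_gt0; pose i1 := Ordinal n1.
have b0 : b < s`_i0 by apply: lt_le_trans lt_b _; exact: sorted_ge_nth.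
have s1_gt0 : 0 < s`_i1 by exact: le_lt_trans b_ge0 lt_b.
have s0_gt0 : 0 < s`_i0 by exact: le_lt_trans b_ge0 b0.
apply: (@bip_eigen2_bound _ X P _ m_real _ _ _ _ _ _ (toC b) (eig i0) (eig i1)).
- by rewrite orth.
- exact: f_gt0.
- exact: f_gt0.
- by rewrite ler0c.
- by rewrite ltcR.
- by rewrite ltcR.
move=> h h0; rewrite -rmorphXn.
apply: (@complex_form_bound (fun f => \sum_x f x = 0)) => //.
- rewrite -[RHS]/(complex.Re (0 : C)) -h0.
  by elim/big_rec2: _ => // x y w _ ->; case: (h x) y => [? ?] [].
- rewrite -[RHS]/(complex.Im (0 : C)) -h0.
  by elim/big_rec2: _ => // x y w _ ->; case: (h x) y => [? ?] [].
Qed.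

End BipartiteSpectrum.

Lemma geoP (T : finType) (e : rel T) (tri : T -> T -> T -> bool) (x0 : T) s :
  geo e tri s <->
  (forall i, (i.+1 < size s)%N -> e (nth x0 s i) (nth x0 s i.+1)) /\
  (forall i, (i.+2 < size s)%N -> ~~ tri (nth x0 s i) (nth x0 s i.+1) (nth x0 s i.+2)).
Proof.
elim: s => [|x s IH]; first by split=> // _; split.
split.
  move=> /= /andP[h /IH[h1 h2]]; split=> -[|i] // hi.
  - by case: s h hi {IH h1 h2} => [|y s] //= /andP[].
  - exact: h1.
  - by case: s h hi {IH h1 h2} => [|y [|z s]] //= /andP[].
  - exact: h2.
move=> [h1 h2] /=; apply/andP; split.
  case: s h1 h2 {IH} => [|y s] // h1 h2; rewrite (h1 0%N isT) /=.
  by case: s h1 h2 => [|z s] // h1 h2; exact: (h2 0%N isT).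
by apply/IH; split=> i hi; [exact: (h1 i.+1)|exact: (h2 i.+1)].
Qed.

Section GeodesicGraph.
Variables (R : realType) (F : local_field) (Gam : set 'M[F]_3).
Hypothesis Gam_lattice : A2_lattice Gam.
Local Notation q := (residue_card F).
Local Notation N := (q ^ 2 + q + 1)%N.
Local Notation eX := (@eX F Gam).
Local Notation triX := (triX Gam_lattice).
Variable r : nat.

Lemma r_geodesicP (p : {ffun 'I_r.+1 -> X0 Gam}) :
  r_geodesic p <-> geo eX triX [seq p i | i <- enum 'I_r.+1].
Proof.
have nthE (i : 'I_r.+1) : nth (p ord0) [seq p i | i <- enum 'I_r.+1] i = p i.
  by rewrite (nth_map ord0) ?size_enum_ord // nth_ord_enum.
rewrite (geoP _ _ (p ord0)) size_map size_enum_ord; split=> [[h1 h2]|[h1 h2]].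
  split=> i hi.
    have hi' : (i < r.+1)%N by exact: ltnW.
    by rewrite (nthE (Ordinal hi')) (nthE (Ordinal hi)); apply/asboolP; exact: h1.
  have hi1 : (i.+1 < r.+1)%N by exact: ltnW.
  have hi0 : (i < r.+1)%N by exact: ltnW.
  rewrite (nthE (Ordinal hi0)) (nthE (Ordinal hi1)) (nthE (Ordinal hi)).
  have [_ nc] := h2 (Ordinal hi0) (Ordinal hi1) (Ordinal hi) erefl erefl.
  apply/negP => t; apply: nc; apply/(cell2_triX Gam_lattice) => //.
    by apply/asboolP; exact: h1.
  by apply/asboolP; exact: h1.
have edge (i j : 'I_r.+1) : j = i.+1 :> nat -> eX (p i) (p j).
  by move=> ji; have := h1 i; rewrite -ji ltn_ord !nthE; apply.
split=> [i j ji|i j k ji ki]; first exact/asboolP/edge.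
have e1 := edge _ _ ji; have e2 : eX (p j) (p k) by apply: edge; rewrite ki ji.
(* If p k = p i, the two consecutive edges would be opposite to each other, against [eX_asym]. *)
split=> [E|/(cell2_triX Gam_lattice e1 e2) t].
  by rewrite E in e2; exact: (eX_asym Gam_lattice e1 e2).
have := h2 i; rewrite -ki ltn_ord => /(_ isT).
by rewrite -ji !nthE t.
Qed.

Lemma sum_geodesics (G : seq (X0 Gam) -> R) :
  \sum_(p : geodesics Gam r) G [seq val p i | i <- enum 'I_r.+1] =
  gsum eX triX r G.
Proof.
rewrite /gsum -seqsum_ffun.
transitivity (\sum_(p : {ffun 'I_r.+1 -> X0 Gam} | `[< r_geodesic p >])
    G [seq p i | i <- enum 'I_r.+1]).
  rewrite [RHS](reindex_omap (val : geodesics Gam r -> _) insub); last first.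
    by move=> p hp; rewrite insubT.
  by apply: eq_bigl => -[p hp] /=; rewrite insubT hp /= eqxx.
rewrite big_mkcond; apply: eq_bigr => p _.
have -> : `[< r_geodesic p >] = geo eX triX [seq p i | i <- enum 'I_r.+1].
  by apply/asboolP/idP => /r_geodesicP.
by case: (geo _ _ _); rewrite ?mul1r ?mul0r.
Qed.

Definition mult (x : X0 Gam) (p : geodesics Gam r) : R :=
  #|[pred i | val p i == x]|%:R.

Lemma sum_mult (f : X0 Gam -> R) (p : geodesics Gam r) :
  \sum_x mult x p * f x = visit_sum f [seq val p i | i <- enum 'I_r.+1].
Proof.
rewrite /visit_sum big_map big_enum /=.
transitivity (\sum_x \sum_(i : 'I_r.+1) (val p i == x)%:R * f x).
  apply: eq_bigr => x _; rewrite -mulr_suml; congr (_ * _).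
  by rewrite sum_pred.
rewrite exchange_big /=; apply: eq_bigr => i _.
rewrite (bigD1 (val p i)) //= eqxx mul1r big1 ?addr0 // => x.
by rewrite eq_sym => /negPf ->; rewrite mul0r.
Qed.

Lemma geodesic_graph_bip : geodesic_graph_mx R Gam r = bip_mx mult.
Proof. by []. Qed.

Lemma sum_mult_vertices (p : geodesics Gam r) : \sum_x mult x p = r.+1%:R.
Proof.
have := sum_mult (fun=> 1) p; under eq_bigr do rewrite mulr1.
move=> ->; rewrite /visit_sum big_const_seq count_predT size_map size_enum_ord.
by rewrite iter_addr_0.
Qed.

End GeodesicGraph.

(** * The eigenvalues of the geodesic graph, with r = k + 1 *)

Section GeodesicSpectrum.
Variables (R : realType) (F : local_field) (Gam : set 'M[F]_3).
Hypothesis Gam_lattice : A2_lattice Gam.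
Local Notation q := (residue_card F).
Local Notation N := (q ^ 2 + q + 1)%N.
Local Notation s := (Num.sqrt (q%:R : R)).
Hypothesis not_tripartite : ~ tripartite Gam.
Hypothesis X_ramanujan : ramanujan R Gam.
Variable k : nat.
Let links := X_plane_links Gam_lattice.

(** [gsum_visits] for the indicator function of x. *)
Lemma sum_mult_geodesics (x : X0 Gam) :
  \sum_(p : geodesics Gam k.+1) mult R x p = (k.+2 * N)%:R * q%:R ^+ (2 * k) :> R.
Proof.
have := @sum_geodesics R F Gam Gam_lattice k.+1 (visit_sum (fun y => (y == x)%:R)).
rewrite (gsum_visits links) => E.
have -> : \sum_(p : geodesics Gam k.+1) mult R x p =
    \sum_(p : geodesics Gam k.+1)
      visit_sum (fun y => (y == x)%:R) [seq val p i | i <- enum 'I_k.+2].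
  apply: eq_bigr => p _; rewrite -sum_mult (bigD1 x) //= eqxx mulr1 big1 ?addr0 //.
  by move=> y /negPf ->; rewrite mulr0.
rewrite E (bigD1 x) //= eqxx big1 ?addr0 ?mulr1 // => y /negPf ->.
by [].
Qed.

Lemma mult_form_bound (f : X0 Gam -> R) : 4 * (10 * s ^+ 3) <= q%:R ^+ 2 ->
  \sum_x f x = 0 ->
  \sum_(p : geodesics Gam k.+1) (\sum_x mult R x p * f x) ^+ 2 <=
  q%:R ^+ (2 * k) * (k.+2%:R * N%:R + k.+1%:R * (8 * (10 * s ^+ 3))) * \sum_x f x ^+ 2.
Proof.
move=> q_big f0; under eq_bigr do rewrite sum_mult.
rewrite (sum_geodesics Gam_lattice k.+1 (fun t => visit_sum f t ^+ 2)).
apply: (gsum_visits_sqr_bound links) => //.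
- by apply: ltnW; exact: card_finNzRing_gt1.
- rewrite exprMn -(exprM _ 3 2) mulnC exprM sqr_sqrtr //.
  by rewrite ler_peMl ?exprn_ge0 // expr2 -natrM ler1n.
- by move=> g g0; exact: out_sum_bound.
- by move=> g g0; exact: in_sum_bound.
Qed.

(** The first eigenvalue is the square root of the product of the two degrees: k + 2 for a geodesic
    and (k + 2) N q^{2k} for a vertex. *)
Lemma geodesic_graph_spectrum b : 0 <= b -> 4 * (10 * s ^+ 3) <= q%:R ^+ 2 ->
  q%:R ^+ (2 * k) * (k.+2%:R * N%:R + k.+1%:R * (8 * (10 * s ^+ 3))) <= b ^+ 2 ->
  eigenvalue_nth (geodesic_graph_mx R Gam k.+1) 1 =
    k.+2%:R * q%:R ^+ k * Num.sqrt N%:R /\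
  eigenvalue_nth (geodesic_graph_mx R Gam k.+1) 2 <= b.
Proof.
move=> b0 q_big bb; rewrite geodesic_graph_bip /eigenvalue_nth.
have q0 : 0 < q%:R :> R by rewrite ltr0n; apply: ltnW; exact: card_finNzRing_gt1.
have d_gt0 : 0 < (k.+2 * N)%:R * q%:R ^+ (2 * k) :> R.
  by rewrite mulr_gt0 ?exprn_gt0 // ltr0n muln_gt0 addn1.
have X_inh : (0 < #|X0 Gam|)%N.
  by apply/card_gt0P; exists (proj Gam_lattice (cls 1%:M)).
have [||||||||h1 h2] := @bip_spectrum R (X0 Gam) (geodesics Gam k.+1) (@mult R F Gam k.+1)
  k.+2%:R ((k.+2 * N)%:R * q%:R ^+ (2 * k)) b.
- by [].
- by [].
- by [].
- by [].
- exact: sum_mult_vertices.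
- exact: sum_mult_geodesics.
- exact: b0.
- move=> f f0; apply: le_trans (mult_form_bound q_big f0) _.
  by rewrite ler_wpM2r // sumr_ge0 // => x _; rewrite sqr_ge0.
rewrite h1; split=> //.
have -> : k.+2%:R * ((k.+2 * N)%:R * q%:R ^+ (2 * k)) =
    (k.+2%:R * q%:R ^+ k) ^+ 2 * N%:R :> R.
  by rewrite natrM exprMn -(exprM _ k 2) (mulnC k 2); ring.
by rewrite sqrtrM ?sqr_ge0 // sqrtr_sqr ger0_norm // mulr_ge0 // exprn_ge0.
Qed.

End GeodesicSpectrum.

(* Here w = r, u = q and s = sqrt q. *)
Section Asymptotics.
Variables (R : realType) (e w u s : R).
Hypothesis e_gt0 : 0 < e.
Hypothesis e_le1 : e <= 1.
Hypothesis w_big : 8 <= e * w.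
Hypothesis s_big : 320 <= e * s.
Hypothesis s_gt0 : 0 < s.
Hypothesis uE : u = s ^+ 2.

Let s_ge320 : 320 <= s.
Proof. by apply: le_trans s_big _; rewrite ler_piMl // ltW. Qed.

Let u_big : 8 <= e * u.
Proof.
have : 320 * s <= e * s * s by rewrite ler_wpM2r // ltW.
by rewrite uE expr2; have := s_ge320; lra.
Qed.

Let w_ge8 : 8 <= w.
Proof.
have w0 : 0 < w by rewrite -(pmulr_rgt0 _ e_gt0); apply: lt_le_trans w_big.
by apply: le_trans w_big _; rewrite ler_piMl // ltW.
Qed.

Let u_ge8 : 8 <= u.
Proof.
have u0 : 0 <= u by rewrite uE sqr_ge0.
by apply: le_trans u_big _; rewrite ler_piMl.
Qed.

Lemma lambda1_estimate : (w + 1) * (u + 1) <= (1 + e) * (w * u).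
Proof.
have wu : 8 * u <= e * w * u by rewrite ler_wpM2r //; have := u_ge8; lra.
have uw : 8 * w <= e * u * w by rewrite ler_wpM2r //; have := w_ge8; lra.
have := u_ge8; have := w_ge8; lra.
Qed.

Lemma lambda2_estimate :
  (w + 1) * (u + 1) ^+ 2 + 80 * (w * s ^+ 3) <= (1 + e) * (w * u ^+ 2).
Proof.
have u8 := u_ge8; have w8 := w_ge8.
have w0 : 0 <= w by lra.
have u0 : 0 <= u by lra.
have wu0 : 0 <= w * u by rewrite mulr_ge0.
have i1 : 8 * (w * u) <= e * u * (w * u) by rewrite ler_wpM2r.
have i2 : 8 * w <= w * u by rewrite mulrC ler_wpM2l.
have i3 : 8 * u ^+ 2 <= e * w * u ^+ 2 by rewrite ler_wpM2r ?sqr_ge0.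
have i4 : 8 * u <= u ^+ 2 by rewrite expr2 ler_wpM2r.
(* The term 80 w s^3 stems from 8 a with a = 10 s^3. As 320 = 4 * 80, it takes up a quarter of the
   margin e w u^2. *)
have i5 : 320 * (w * s ^+ 3) <= e * w * u ^+ 2.
  have -> : e * w * u ^+ 2 = (e * s) * (w * s ^+ 3) by rewrite uE; ring.
  by rewrite ler_wpM2r // mulr_ge0 // exprn_ge0 // ltW.
lra.
Qed.

Lemma degree_estimate : 4 * (10 * s ^+ 3) <= u ^+ 2.
Proof.
have -> : u ^+ 2 = s * s ^+ 3 by rewrite uE; ring.
by rewrite mulrA ler_wpM2r ?exprn_ge0 ?(ltW s_gt0) //; have := s_ge320; lra.
Qed.

End Asymptotics.

Theorem proposition3p10 (R : realType) (eps : R) (heps : 0 < eps) :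
  exists q0 r0 : nat,
  forall (F : local_field) (Gam : set 'M[F]_3) (r : nat),
    let q := residue_card F in
    let A := geodesic_graph_mx R Gam r in
    (q0 <= q)%N -> (r0 <= r)%N ->
    A2_lattice Gam -> ~ tripartite Gam -> ramanujan R Gam ->
    `|eigenvalue_nth A 1 / (r%:R * q%:R ^+ r) - 1| <= eps /\
    eigenvalue_nth A 2 <= Num.sqrt r%:R * q%:R ^+ r * (1 + eps).
Proof.
(* With e <= 1, the conditions 320 <= e s and 8 <= e w also bound s and w themselves from below. *)
pose e := Num.min eps 1.
have e0 : 0 < e by rewrite lt_min heps ltr01.
have e1 : e <= 1 by rewrite ge_min lexx orbT.
have e_eps : e <= eps by rewrite ge_min lexx.
pose q0 := Num.bound ((320 / e) ^+ 2); pose r0 := Num.bound (8 / e).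
have q0P : (320 / e) ^+ 2 < q0%:R by apply: archi_boundP; rewrite sqr_ge0.
have r0P : 8 / e < r0%:R by apply: archi_boundP; rewrite divr_ge0 // ltW.
exists q0, r0 => F Gam r q A hq hr hG ntri ram; rewrite {}/A.
pose u : R := q%:R; pose s := Num.sqrt u.
have u0 : 0 <= u by rewrite ler0n.
have uE : u = s ^+ 2 by rewrite sqr_sqrtr.
have w_big : 8 <= e * r%:R.
  rewrite mulrC -ler_pdivrMr // (le_trans (ltW r0P)) // ler_nat //.
have s_big : 320 <= e * s.
  rewrite mulrC -ler_pdivrMr //.
  have c0 : 0 <= 320 / e by rewrite divr_ge0 ?ler0n ?(ltW e0).
  rewrite -(ler_pXn2r (n := 2)) ?nnegrE ?sqrtr_ge0 ?c0 // -uE.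
  by apply: le_trans (ltW q0P) _; rewrite ler_nat.
have s_gt0 : 0 < s.
  by rewrite -(pmulr_rgt0 _ e0); apply: lt_le_trans s_big; rewrite ltr0n.
have u_gt0 : 0 < u by rewrite uE exprn_gt0.
have r_gt0 : (0 < r)%N.
  by rewrite lt0n; apply/eqP => rz; move: w_big; rewrite rz mulr0; lra.
have l1 := lambda1_estimate e0 e1 w_big s_big s_gt0 uE.
have l2 := lambda2_estimate e0 e1 w_big s_big s_gt0 uE.
have dg := degree_estimate e1 s_big s_gt0 uE.
case: r r_gt0 hr w_big l1 l2 => // k _ hr w_big l1 l2.
set w : R := k.+1%:R in w_big l1 l2 *.
have w_gt0 : 0 < w by rewrite ltr0n.
have kw : k.+2%:R = w + 1 by rewrite -natr1.
have NE : (q ^ 2 + q + 1)%:R = u ^+ 2 + u + 1 by rewrite !natrD natrX.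
have Nle : u ^+ 2 + u + 1 <= (u + 1) ^+ 2.
  have -> : (u + 1) ^+ 2 = u ^+ 2 + u + 1 + u by ring.
  by rewrite lerDl.
(* This is the claimed bound itself, with w = r and k = r - 1, so that only its square has to be
   compared. *)
pose b := Num.sqrt w * u ^+ k.+1 * (1 + eps).
have b0 : 0 <= b by rewrite !mulr_ge0 ?sqrtr_ge0 ?exprn_ge0 // addr_ge0 // ltW.
have [|h1 h2] := @geodesic_graph_spectrum R F Gam hG ntri ram k b b0 dg.
  rewrite -/q -/u -/s NE kw -/w.
  have -> : b ^+ 2 = u ^+ (2 * k) * (w * u ^+ 2 * (1 + eps) ^+ 2).
    have -> : u ^+ (2 * k) * (w * u ^+ 2 * (1 + eps) ^+ 2) =
      w * (u ^+ (2 * k) * u ^+ 2) * (1 + eps) ^+ 2 by ring.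
    rewrite /b 2!exprMn sqr_sqrtr ?(ltW w_gt0) // -exprM -exprD.
    by rewrite mulSn mulnC addnC.
  rewrite ler_wpM2l ?exprn_ge0 //.
  (* The estimate yields the factor 1 + e, while b^2 carries (1 + eps)^2, which is larger. *)
  apply: le_trans (_ : _ <= (1 + e) * (w * u ^+ 2)) _.
    apply: le_trans l2; apply: lerD.
      by rewrite ler_wpM2l // addr_ge0 // ltW.
    by rewrite le_eqVlt; apply/orP; left; apply/eqP; ring.
  rewrite [leRHS]mulrC ler_wpM2r ?mulr_ge0 ?sqr_ge0 ?(ltW w_gt0) //.
  apply: le_trans (_ : _ <= 1 + eps) _; first by rewrite lerD2l.
  by rewrite expr2 ler_peMl // ?addr_ge0 ?lerDl // ltW.
split; last exact: h2.
rewrite h1 -/q -/u kw -/w NE.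
set S := Num.sqrt _.
have S1 : u <= S.
  rewrite -(ger0_norm u0) -sqrtr_sqr ler_wsqrtr // -addrA lerDl addr_ge0 //.
have S2 : S <= u + 1.
  rewrite -[leRHS]ger0_norm ?addr_ge0 // -sqrtr_sqr ler_wsqrtr //.
have -> : (w + 1) * u ^+ k * S / (w * u ^+ k.+1) = (w + 1) * S / (w * u).
  by rewrite exprS; field; rewrite expf_neq0 ?gt_eqF //.
have wu : 0 < w * u by rewrite mulr_gt0.
have lo : 1 <= (w + 1) * S / (w * u).
  rewrite ler_pdivlMr // mul1r; apply: le_trans (_ : w * S <= _).
    by rewrite ler_wpM2l // ltW.
  by rewrite ler_wpM2r ?sqrtr_ge0 // lerDl.
rewrite ger0_norm ?subr_ge0 // lerBlDl (le_trans _ (_ : 1 + e <= _)) //; last first.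
  by rewrite lerD2l.
rewrite ler_pdivrMr //; apply: le_trans l1.
by rewrite ler_wpM2l // addr_ge0 // ltW.
Qed.
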